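(* Let $M$ be a complex manifold and suppose there is a holomorphic connection on $M$. Then for any compact topological space $A$, the space $C(A,M)$ of continuous maps is a complex Banach manifold.
   Context: $M$ is finite-dimensional. A holomorphic connection on $M$ means a holomorphic connection on the holomorphic tangent bundle $T^{(1,0)}M$. $C(A,M)$ carries the compact-open topology, which is the underlying topology of the complex Banach manifold structure. *)

(* Defs.v *)
From HB Require Import structures.
From mathcomp Require Import all_boot all_order all_algebra.
From mathcomp Require Import complex.
From mathcomp Require Import all_classical all_reals all_analysis.
Import Order.TTheory GRing.Theory Num.Theory.
Import numFieldNormedType.Exports.
Local Open Scope classical_set_scope.
Local Open Scope ring_scope.
Local Open Scope complex_scope.

(* Complex Frechet differentiability ('d f z is R[i]-linear and continuous);
   only used with U open. *)
Definition holomorphic_on {R : realType} {V W : normedModType R[i]}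
    (U : set V) (f : V -> W) : Prop :=
  forall z, U z -> differentiable f z.

(* The models E k may differ from one chart to another. *)
Record complex_atlas {R : realType} (M : topologicalType) {I : Type}
    (E : I -> normedModType R[i]) := ComplexAtlas {
  dom : I -> set M ;
  coord : forall k, M -> E k ;
  param : forall k, E k -> M ;
  dom_cover : forall x, exists k, dom k x ;
  dom_open : forall k, open (dom k) ;
  img_open : forall k, open (coord k @` dom k) ;
  coordK : forall k x, dom k x -> param k (coord k x) = x ;
  coord_continuous : forall k, {within dom k, continuous (coord k)} ;
  param_continuous : forall k,
    {within coord k @` dom k, continuous (param k)} ;
  transition_holomorphic : forall k l,
    holomorphic_on (coord k @` (dom k `&` dom l)) (coord l \o param k)
}.
Arguments dom {R M I E}.
Arguments coord {R M I E}.
Arguments param {R M I E}.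

Definition is_complex_banach_manifold (R : realType) (M : topologicalType) :
    Prop :=
  hausdorff_space M /\
  exists (I : Type) (E : I -> completeNormedModType R[i]),
    inhabited (complex_atlas M E).

(* A finite-dimensional complex manifold; as for Banach manifolds, the
   dimension is only locally constant. No countability axiom is imposed. *)
Record complex_manifold (R : realType) := ComplexManifold {
  carrier :> topologicalType ;
  carrier_hausdorff : hausdorff_space carrier ;
  chart : Type ;
  dim : chart -> nat ;
  atlas : complex_atlas carrier (fun k => 'rV[R[i]]_(dim k))
}.
Arguments carrier {R}.
Arguments chart {R}.
Arguments dim {R _}.
Arguments atlas {R}.

Section HolomorphicConnection.
Context {R : realType} (M : complex_manifold R).
Local Notation C := R[i].
Local Notation dom := (dom (atlas M)).
Local Notation coord := (coord (atlas M)).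
Local Notation param := (param (atlas M)).

(* D(coord l o param k) at the point of chart k representing x: the cocycle
   (k, l) |-> transition k l defines the holomorphic tangent bundle
   T^{(1,0)}M, with fibre 'rV_(dim k) over dom k. *)
Definition transition (k l : chart M) (x : M) :
    'rV[C]_(dim k) -> 'rV[C]_(dim l) :=
  'd (coord l \o param k) (coord k x).

Definition holomorphic_function (U : set M) (f : M -> C) : Prop :=
  forall k, holomorphic_on (coord k @` (U `&` dom k))
                           (f \o param k : _ -> C^o).

(* df applied to the tangent vector with coordinates t in the chart k *)
Definition differential (f : M -> C) (k : chart M) (x : M)
    (t : 'rV[C]_(dim k)) : C :=
  'd (f \o param k : _ -> C^o) (coord k x) t.

(* A section of a bundle over U is given by its coordinates in all charts;
   the value of s k x is meaningful only for x in U `&` dom k. *)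
Definition eq_section {T : chart M -> Type} (U : set M)
    (s s' : forall k, M -> T k) : Prop :=
  forall k x, U x -> dom k x -> s k x = s' k x.

Definition field_coords := forall k : chart M, M -> 'rV[C]_(dim k).

Definition holomorphic_vector_field (U : set M) (v : field_coords) : Prop :=
  (forall k l x, U x -> dom k x -> dom l x ->
     v l x = transition k l x (v k x)) /\
  (forall k, holomorphic_on (coord k @` (U `&` dom k)) (v k \o param k)).

(* Sections over U of Omega^1 (x) T^{(1,0)}M = Hom(T^{(1,0)}M, T^{(1,0)}M):
   the tangent vector t is sent to t *m w k x. *)
Definition form_coords := forall k : chart M, M -> 'M[C]_(dim k).

Definition holomorphic_tangent_form (U : set M) (w : form_coords) : Prop :=
  (forall k l x (t : 'rV[C]_(dim k)), U x -> dom k x -> dom l x ->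
     transition k l x t *m w l x = transition k l x (t *m w k x)) /\
  (forall k, holomorphic_on (coord k @` (U `&` dom k)) (w k \o param k)).

(* A C-linear morphism of sheaves from O(T^{(1,0)}M) to
   Omega^1 (x) O(T^{(1,0)}M) satisfying the Leibniz rule. *)
Record holomorphic_connection := HolomorphicConnection {
  nabla : set M -> field_coords -> form_coords ;
  nabla_form : forall U v, open U -> holomorphic_vector_field U v ->
    holomorphic_tangent_form U (nabla U v) ;
  nabla_restrict : forall U V v v', open U -> open V -> V `<=` U ->
    holomorphic_vector_field U v -> holomorphic_vector_field V v' ->
    eq_section V v v' -> eq_section V (nabla U v) (nabla V v') ;
  nabla_linear : forall U (a : C) v v', open U ->
    holomorphic_vector_field U v -> holomorphic_vector_field U v' ->
    eq_section U (nabla U (fun k x => a *: v k x + v' k x))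
                 (fun k x => a *: nabla U v k x + nabla U v' k x) ;
  nabla_leibniz : forall U f v, open U ->
    holomorphic_function U f -> holomorphic_vector_field U v ->
    forall k x (t : 'rV[C]_(dim k)), U x -> dom k x ->
      t *m nabla U (fun l y => f y *: v l y) k x =
      differential f k x t *: v k x + f x *: (t *m nabla U v k x)
}.

End HolomorphicConnection.

(* A need not be Hausdorff; compact sets are quasi-compact throughout. *)
Definition mapping_space (A M : topologicalType) : topologicalType :=
  initial_topology
    ((fun f => f) : continuousType A M -> {compact-open, A -> M}).

(* Main.v *)
Require Import Defs.
From HB Require Import structures.
From mathcomp Require Import all_boot all_order all_algebra.
From mathcomp Require Import finmap complex ring lra zify.
From mathcomp Require Import all_classical all_reals all_analysis.

(** The classical construction of charts on a mapping space uses a local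
    addition: an identification, for every x in M, of a neighbourhood of x
    with a neighbourhood of 0 in the tangent space at x. Maps g close to a
    given map f then correspond to small continuous sections of the
    pulled-back tangent bundle along f, and these sections form a Banach space
    because the source A is compact. The point is that the change between two
    such charts acts pointwise, w |-> (a |-> Phi_a (w a)), so that the local
    addition has to be holomorphic in the second variable only; in the first
    variable, continuity is enough. Such a local addition always exists, by
    averaging charts.

    Cover f(A) by finitely many charts k_l with continuous bump functions, and
    let weight l be their normalisation. For y near x put xi x y = sum over l
    of weight l x times the tangent vector at x that the chart k_l attaches to
    the difference coord y - coord x. The map xi x is holomorphic near x, as a
    finite combination of charts followed by linear maps, and it is a small
    Lipschitz perturbation of any one of the charts, because the transition
    maps are strictly differentiable and the weights add up to 1
    (exists_good_ball). A contraction argument inverts it, uniformly in x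
    (theta_open), and the inverse is holomorphic (inverse_theta_diff).

    A tangent vector v at x is stored as the family theta of the vectors beta
    i x times the coordinates of v in the chart k_i. Each component extends by
    0 to a continuous function on all of A, and the families that arise are
    cut out by closed linear conditions (fib). Thus the sections along f
    become a closed space of bounded scalar functions on A times a finite set
    (section_space), a Banach space for the sup norm. The maps whose graph
    stays in a suitable tube around the graph of f form an open set in the
    compact-open topology (open_tube_dom), and a finite subcover of A turns
    the pointwise inversion of theta into a homeomorphism from this set onto
    an open set of sections (solve_uniform, open_tube_image, tube_coord_cvg,
    tube_param_cvg).

    Holomorphy of the chart changes is then reduced to finite dimensions: a
    locally bounded map into a space of functions with the sup norm is
    differentiable as soon as each of its evaluations is
    (differentiable_fvec). This rests on Cauchy's estimate, which makes the
    error of the linear approximation depend only on a bound for the function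
    (strict_estimate). Cauchy's estimate itself, with a non-optimal constant,
    is derived from midpoint Riemann sums over the boundaries of squares:
    cutting a square into nine gives exact cancellation of the inner edges
    (sq_subdivision), hence Goursat's lemma, hence the comparison of a large
    and a small square around a pole (sq_shrink, cauchy_bound). *)

Set Implicit Arguments.
Unset Strict Implicit.
Unset Printing Implicit Defensive.
Import Order.TTheory GRing.Theory Num.Theory.
Import numFieldNormedType.Exports.
Local Open Scope classical_set_scope.
Local Open Scope ring_scope.
Local Open Scope complex_scope.

(** * Real-valued norms on complex normed spaces *)

Section RealNorm.
Context {R : realType}.
Local Notation C := (R[i]).

(** The norm of a normed module over R[i] has its values in R[i], where the
    order is only partial; nm is the same number in R. *)
Definition nm {V : normedModType C} (v : V) : R := complex.Re `|v|.
Definition cabs (z : C) : R := complex.Re `|z|.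

Lemma nmE {V : normedModType C} (v : V) : `|v| = (nm v)%:C.
Proof. by have := normr_ge0 v; rewrite lecE /nm => /andP[/eqP]; case: `|v| => a b /= ->. Qed.

Lemma cabsE (z : C) : `|z| = (cabs z)%:C. Proof. exact: (@nmE C^o). Qed.

Lemma nm_cabs (z : C^o) : nm z = cabs z. Proof. by []. Qed.

Lemma nm_ge0 {V : normedModType C} (v : V) : 0 <= nm v.
Proof. by have := normr_ge0 v; rewrite nmE lecR. Qed.

Lemma nmD {V : normedModType C} (u v : V) : nm (u + v) <= nm u + nm v.
Proof. by have := ler_normD u v; rewrite !nmE -rmorphD lecR. Qed.

Lemma nm_ltD {V : normedModType C} (u v : V) (s : R) : nm u + nm v < s -> nm (u + v) < s.
Proof. by apply: le_lt_trans; exact: nmD. Qed.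

Lemma nmZ {V : normedModType C} (a : C) (v : V) : nm (a *: v) = cabs a * nm v.
Proof. by have := normrZ a v; rewrite (nmE (a *: v)) (nmE v) cabsE -rmorphM => /complexI. Qed.

Lemma nmN {V : normedModType C} (v : V) : nm (- v) = nm v.
Proof. by rewrite /nm normrN. Qed.

Lemma nmB {V : normedModType C} (u v : V) : nm (u - v) = nm (v - u).
Proof. by rewrite /nm distrC. Qed.

Lemma nm0 {V : normedModType C} : nm (0 : V) = 0.
Proof. by rewrite /nm normr0. Qed.

Lemma nm_eq0 {V : normedModType C} (v : V) : nm v = 0 -> v = 0.
Proof. by move=> v0; apply/eqP; rewrite -normr_eq0 nmE v0. Qed.

Lemma cabsM (a b : C) : cabs (a * b) = cabs a * cabs b.
Proof. exact: (@nmZ C^o). Qed.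
Lemma cabsD (a b : C) : cabs (a + b) <= cabs a + cabs b.
Proof. exact: (@nmD C^o). Qed.
Lemma cabsN (a : C) : cabs (- a) = cabs a.
Proof. exact: (@nmN C^o). Qed.
Lemma cabs_ge0 (a : C) : 0 <= cabs a.
Proof. exact: (@nm_ge0 C^o). Qed.
Lemma cabsV (a : C) : cabs a^-1 = (cabs a)^-1.
Proof.
have := normfV a; rewrite !cabsE => h; apply: complexI.
by rewrite h -[RHS]/((real_complex R) _) fmorphV.
Qed.
Lemma cabsR (x : R) : cabs x%:C = `|x|.
Proof. by rewrite /cabs normc_def /= expr0n /= addr0 sqrtr_sqr. Qed.
Lemma cabsi : cabs 'i%C = 1.
Proof. by rewrite /cabs normc_def /= expr0n /= add0r expr1n sqrtr1. Qed.
Lemma cabs_eq0 (a : C) : cabs a = 0 -> a = 0.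
Proof. exact: (@nm_eq0 C^o). Qed.
Lemma Re_cabs (a : C) : `|complex.Re a| <= cabs a.
Proof. by have := normc_ge_Re a; rewrite cabsE lecR. Qed.
Lemma Im_cabs (a : C) : `|complex.Im a| <= cabs a.
Proof.
rewrite -[leRHS]mul1r -cabsi -cabsM.
suff -> : complex.Im a = - complex.Re ('i%C * a) by rewrite normrN Re_cabs.
by case: a => x y /=; rewrite mul0r mul1r sub0r opprK.
Qed.
Lemma cabs_ReIm (a : C) : cabs a <= `|complex.Re a| + `|complex.Im a|.
Proof.
rewrite {1}[a]complexE; apply: le_trans (cabsD _ _) _.
by rewrite cabsM cabsi mul1r !cabsR.
Qed.
Lemma rcD (x y : R) : (x + y)%:C = x%:C + y%:C.
Proof. exact: (rmorphD (real_complex R)). Qed.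
Lemma rcN (x : R) : (- x)%:C = - x%:C.
Proof. exact: (rmorphN (real_complex R)). Qed.
Lemma rcM (x y : R) : (x * y)%:C = x%:C * y%:C.
Proof. exact: (rmorphM (real_complex R)). Qed.
Lemma rcV (x : R) : (x^-1)%:C = (x%:C)^-1.
Proof. exact: (fmorphV (real_complex R)). Qed.
Lemma rc_nat n : (n%:R : R)%:C = n%:R.
Proof. exact: (rmorph_nat (real_complex R)). Qed.
Lemma rc1 : (1 : R)%:C = 1.
Proof. by []. Qed.
Lemma rc0 : (0 : R)%:C = 0.
Proof. by []. Qed.
Lemma Ci2 : 'i%C * 'i%C = -1 :> C.
Proof. by rewrite -expr2 sqr_i. Qed.

Lemma ballR {V : normedModType C} (x y : V) (e : R) : ball x e%:C y <-> nm (x - y) < e.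
Proof. by rewrite -ball_normE /= nmE ltcR. Qed.

Lemma nbhsR {V : normedModType C} (x : V) (P : set V) :
  nbhs x P <-> exists2 e : R, 0 < e & forall y, nm (y - x) < e -> P y.
Proof.
split.
- move=> /nbhs_ballP[e /= e0 h]; exists (complex.Re e).
    by move: e0; rewrite ltcE => /andP[].
  have eE : e = (complex.Re e)%:C.
    by move: e0; rewrite ltcE; case: (e) => a b /= /andP[/eqP ->].
  by move=> y; rewrite nmB => hy; apply: h; rewrite eE; exact/ballR.
- move=> [e e0 h]; apply/nbhs_ballP; exists e%:C; first by rewrite /= ltcR.
  by move=> y /ballR; rewrite nmB; exact: h.
Qed.

Lemma cvgR {T : Type} {F : set_system T} {FF : Filter F} {V : normedModType C} (f : T -> V) (l : V) :
  (f @ F --> l) <-> (forall e : R, 0 < e -> \forall t \near F, nm (f t - l) < e).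
Proof.
split.
- move=> h e e0; apply: (h [set y | nm (y - l) < e]); apply/nbhsR; by exists e.
- move=> h P /nbhsR[e e0 he]; rewrite nbhs_simpl /=.
  by apply: filterS (h e e0) => t; exact: he.
Qed.

(** The definition of differentiability quantifies over positive elements of
    R[i]; this criterion and its converse diffRE only need real ones. *)
Lemma diffR {V W : normedModType C} (f : V -> W) (x : V) (df : {linear V -> W}) (K : R) :
  (forall h, nm (df h) <= K * nm h) ->
  (forall e : R, 0 < e -> exists2 d : R, 0 < d &
     forall h, nm h < d -> nm (f (x + h) - f x - df h) <= e * nm h) ->
  differentiable f x /\ ('d f x = df :> (V -> W)).
Proof.
move=> bd H.
have cdf : continuous df.
  move=> y; apply/cvgR => e e0; apply/nbhsR; exists (e / (`|K| + 1)).
    by rewrite divr_gt0// ltr_wpDl.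
  move=> z; rewrite ltr_pdivlMr ?ltr_wpDl// => hz.
  rewrite -linearB; apply: le_lt_trans (bd _) _; apply: le_lt_trans _ hz.
  rewrite mulrC ler_wpM2l ?nm_ge0// (le_trans (ler_norm _))// lerDl//.
have E : f \o shift x = cst (f x) + df +o_ 0 id.
  apply/eqaddoP => eps; move=> e0.
  have er : eps = (complex.Re eps)%:C.
    by move: e0; rewrite ltcE; case: (eps) => a b /= /andP[/eqP ->].
  have e0' : 0 < complex.Re eps by move: e0; rewrite ltcE => /andP[].
  have [d d0 hd] := H _ e0'.
  apply/nbhsR; exists d => // h; rewrite subr0 => hh.
  rewrite er !nmE -rmorphM lecR /=.
  have := hd _ hh; congr (nm _ <= _).
  by rewrite [RHS]/GRing.add/= /cst /= [h + x]addrC opprD addrA.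
have D := diff_unique cdf E.
split => //; apply/diff_locallyP; rewrite D; split => //.
Qed.

Lemma diffRE {V W : normedModType C} (f : V -> W) (x : V) : differentiable f x ->
  forall e : R, 0 < e -> exists2 d : R, 0 < d &
     forall h, nm h < d -> nm (f (x + h) - f x - 'd f x h) <= e * nm h.
Proof.
move=> /diff_locallyP [_] /eqaddoP H e e0.
have := H e%:C; rewrite ltcR => /(_ e0) /nbhsR[d d0 hd].
exists d => // h hh; have := hd h; rewrite subr0 => /(_ hh) /=.
rewrite !nmE -rmorphM lecR /=; congr (nm _ <= _).
by rewrite [LHS]/GRing.add/= /cst /= [h + x]addrC opprD addrA.
Qed.

Lemma lin_bd {V W : normedModType C} (f : {linear V -> W}) :
  continuous f -> exists2 K : R, 0 < K & forall h, nm (f h) <= K * nm h.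
Proof.
move=> /linear_lipschitz[k k0 hk].
have kr : k = (complex.Re k)%:C.
  by move: k0; rewrite ltcE; case: (k) => a b /= /andP[/eqP ->].
exists (complex.Re k); first by move: k0; rewrite ltcE => /andP[].
by move=> h; have := hk h; rewrite kr !nmE -rmorphM lecR.
Qed.

Lemma diff_bd {V W : normedModType C} (f : V -> W) (x : V) : differentiable f x ->
  exists2 K : R, 0 < K & forall h, nm ('d f x h) <= K * nm h.
Proof. by move=> h; apply: lin_bd; exact: diff_continuous. Qed.

End RealNorm.

(** * Trisection and the mean value inequality *)

Section Trisection.
Context {R : realType}.

(** The intervals of centre v n and half-length 3^-n are nested, since 2/3 +
    1/3 = 1; the supremum of their left ends lies in all of them. *)
Lemma nested_trisection (v : nat -> R) :
  (forall n, `|v n.+1 - v n| <= 2 / 3 * 3^-1 ^+ n) ->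
  exists l, forall n, `|l - v n| <= 3^-1 ^+ n.
Proof.
move=> hv; pose s n : R := 3^-1 ^+ n.
have s0 n : 0 <= s n by rewrite exprn_ge0// invr_ge0.
have sS n : s n.+1 = s n / 3 by rewrite /s exprSr.
have lo n k : v n - s n <= v (n + k)%N - s (n + k)%N.
  elim: k => [|k ih]; first by rewrite addn0.
  apply: le_trans ih _; rewrite addnS sS.
  by have := hv (n + k)%N; rewrite -/(s _) ler_norml => /andP[]; have := s0 (n + k)%N; lra.
have hi n k : v (n + k)%N + s (n + k)%N <= v n + s n.
  elim: k => [|k ih]; first by rewrite addn0.
  apply: le_trans _ ih; rewrite addnS sS.
  by have := hv (n + k)%N; rewrite -/(s _) ler_norml => /andP[]; have := s0 (n + k)%N; lra.
have lohi m n : v m - s m <= v n + s n.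
  have := lo m n; have := hi n m; rewrite addnC; have := s0 (m + n)%N; lra.
pose E := [set v n - s n | n in setT].
have E0 : E !=set0 by exists (v 0%N - s 0%N), 0%N.
have ubE n : ubound E (v n + s n) by move=> _ [m _ <-]; exact: lohi.
exists (sup E) => n; rewrite ler_norml; apply/andP; split.
  suff : v n - s n <= sup E by rewrite /s; lra.
  by apply: ub_le_sup; [exists (v 0%N + s 0%N); exact: ubE|exists n].
suff : sup E <= v n + s n by rewrite /s; lra.
by apply: ge_sup => //; exact: ubE.
Qed.

(** When [-1, 1] is cut into three equal parts, the centres are the numbers
    2/3 p with third p. *)
Definition third (p : R) := p = -1 \/ p = 0 \/ p = 1.

(** A property of squares (centre (x, y), half-side s) which passes from a
    square to one of its nine subsquares holds for arbitrarily small squares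
    around some point. Cutting in nine rather than in four keeps the centre of
    a square at the centre of one of its parts, which sq_shrink needs. *)
Lemma trisection (B : R -> R -> R -> Prop) :
  B 0 0 1 ->
  (forall x y s, B x y s -> exists p q, [/\ third p, third q &
     B (x + 2 / 3 * p * s) (y + 2 / 3 * q * s) (s / 3)]) ->
  exists x y, [/\ `|x| <= 1, `|y| <= 1 & forall n, exists x' y',
    [/\ B x' y' (3^-1 ^+ n), `|x - x'| <= 3^-1 ^+ n & `|y - y'| <= 3^-1 ^+ n]].
Proof.
move=> B0 BS.
have /choice[f Hf] : forall t : R * R * nat, exists t' : R * R,
    B t.1.1 t.1.2 (3^-1 ^+ t.2) ->
    [/\ B t'.1 t'.2 (3^-1 ^+ t.2.+1), `|t'.1 - t.1.1| <= 2 / 3 * 3^-1 ^+ t.2 &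
        `|t'.2 - t.1.2| <= 2 / 3 * 3^-1 ^+ t.2].
  move=> [[x y] n] /=; case: (pselect (B x y (3^-1 ^+ n))) => [h|h]; last by exists (x, y).
  have [p [q [hp hq hB]]] := BS _ _ _ h.
  exists (x + 2 / 3 * p * 3^-1 ^+ n, y + 2 / 3 * q * 3^-1 ^+ n) => _ /=.
  have aux r : third r -> `|2 / 3 * r * 3^-1 ^+ n| <= 2 / 3 * 3^-1 ^+ n :> R.
    move=> hr; rewrite 2!normrM [ `|3^-1 ^+ n|]ger0_norm ?exprn_ge0 ?invr_ge0//.
    rewrite [ `|2 / 3|]ger0_norm ?divr_ge0// ler_wpM2r ?exprn_ge0 ?invr_ge0// ler_piMr//.
    by case: hr => [|[]] ->; rewrite ?normrN ?normr1 ?normr0.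
  by split; rewrite ?exprSr// addrAC subrr add0r; exact: aux.
pose u := fix u n : R * R := if n is n'.+1 then f (u n', n') else (0, 0).
have Bu n : B (u n).1 (u n).2 (3^-1 ^+ n).
  elim: n => [|n ih] /=; first by rewrite expr0.
  by have [] := Hf (u n, n) ih.
have [x hx] : exists l, forall n, `|l - (u n).1| <= 3^-1 ^+ n.
  by apply: (@nested_trisection (fun n => (u n).1)) => n; have [] := Hf (u n, n) (Bu n).
have [y hy] : exists l, forall n, `|l - (u n).2| <= 3^-1 ^+ n.
  by apply: (@nested_trisection (fun n => (u n).2)) => n; have [] := Hf (u n, n) (Bu n).
exists x, y; split.
- by have := hx 0%N; rewrite /= subr0 expr0.
- by have := hy 0%N; rewrite /= subr0 expr0.
- by move=> n; exists (u n).1, (u n).2.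
Qed.

Lemma pow3_small (e : R) : 0 < e -> exists n, 3^-1 ^+ n < e.
Proof.
move=> e0; have := @cvg_geometric R 1 3^-1.
rewrite ger0_norm ?invr_ge0// invf_lt1// ltr1n => /(_ isT)/cvgrPdist_lt h.
have [n _ hn] := h e e0.
by exists n; have := hn n (leqnn n); rewrite /= sub0r normrN /geometric /= mul1r ger0_norm ?exprn_ge0 ?invr_ge0.
Qed.

End Trisection.

Section MeanValue.
Context {R : realType}.
Local Notation C := (R[i]).

(** Differentiability with the derivative as a number w, for functions on C
    itself instead of its copy as a normed module. *)
Definition cdiff (F : C -> C) (z w : C) := forall e : R, 0 < e ->
  exists2 d : R, 0 < d & forall h, cabs h < d -> cabs (F (z + h) - F z - w * h) <= e * cabs h.

Lemma differentiable_cdiff (F : C -> C) (z : C) :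
  differentiable (F : C^o -> C^o) (z : C^o) -> cdiff F z ('d (F : C^o -> C^o) (z : C^o) (1 : C^o)).
Proof.
move=> D e e0; have [d d0 hd] := diffRE D e0; exists d => // h hh.
have := hd h hh; congr (cabs (_ - _) <= _).
by rewrite -[h in LHS]mulr1 -[h * 1]/(h *: (1 : C^o)) linearZ /= mulrC.
Qed.

(** A complex-valued function has no intermediate point. Instead, if the
    inequality failed with L + eps in place of L, it would fail on one third
    of the segment, then on arbitrarily small segments around a point, where
    it contradicts the existence of the derivative. *)
Lemma mean_value (F : C -> C) (m d : C) (L : R) :
  (forall x : R, `|x| <= 1 -> exists2 w, cdiff F (m + x%:C * d) w & cabs w <= L) ->
  cabs (F (m + d) - F (m - d)) <= L * (2 * cabs d).
Proof.
move=> H; apply/ler_addgt0Pr => e e0.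
have [->|dn0] := eqVneq d 0.
  by rewrite addr0 subr0 subrr /cabs normr0 /=; lra.
have d0 : 0 < cabs d.
  rewrite lt_neqAle cabs_ge0 andbT eq_sym; apply/eqP => h.
  by move: dn0; rewrite (cabs_eq0 h) eqxx.
pose eps := e / (2 * cabs d).
have eps0 : 0 < eps by rewrite divr_gt0// mulr_gt0.
rewrite leNgt; apply/negP => Hlt.
pose B (x y s : R) := s > 0 /\ cabs (F (m + (x + s)%:C * d) - F (m + (x - s)%:C * d)) >
   (L + eps) * (2 * s * cabs d).
have [||x [y [hx _ hB]]] := @trisection _ B.
- split => //; rewrite add0r sub0r rmorph1 mul1r rmorphN rmorph1 mulN1r.
  apply: le_lt_trans Hlt; rewrite /eps mulrDl mulr1.
  by rewrite -[X in _ <= _ + X](@divfK _ (2 * cabs d)) // gt_eqF// mulr_gt0.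
- move=> {H Hlt} x y s [s0 Bx]; apply: contrapT => hn.
  have {}hn p : third p -> cabs (F (m + (x + 2 / 3 * p * s + s / 3)%:C * d) - F (m + (x + 2 / 3 * p * s - s / 3)%:C * d)) <= (L + eps) * (2 * (s / 3) * cabs d).
    (* a segment is treated as a square whose centre stays on the line y = 0 *)
    move=> hp; rewrite leNgt; apply/negP => h; apply: hn; exists p, 0; split => //.
      by right; left.
    by split => //; rewrite divr_gt0.
  have h1 := hn (-1) (or_introl erefl); have h2 := hn 0 (or_intror (or_introl erefl)).
  have h3 := hn 1 (or_intror (or_intror erefl)); move: Bx; apply/negP; rewrite -leNgt.
  have e1 : x + 2 / 3 * (-1) * s - s / 3 = x - s by field.
  have e2 : x + 2 / 3 * (-1) * s + s / 3 = x + 2 / 3 * 0 * s - s / 3 by field.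
  have e3 : x + 2 / 3 * 1 * s - s / 3 = x + 2 / 3 * 0 * s + s / 3 by field.
  have e4 : x + 2 / 3 * 1 * s + s / 3 = x + s by field.
  rewrite e1 e2 in h1; rewrite e3 e4 in h3.
  move: h1 h2 h3; set A1 := F _; set A2 := F _; set A3 := F _; set A4 := F _ => h1 h2 h3.
  have -> : A4 - A2 = (A4 - A3) + (A3 - A1) + (A1 - A2) by ring.
  apply: le_trans (cabsD _ _) _; apply: le_trans (lerD (cabsD _ _) (lexx _)) _.
  set K := (L + eps) in h1 h2 h3 *.
  have -> : K * (2 * s * cabs d) = K * (2 * (s / 3) * cabs d) + K * (2 * (s / 3) * cabs d) + K * (2 * (s / 3) * cabs d) by field.
  by rewrite lerD// lerD.
have [w Hw wL] := H x hx.
have [|dl dl0 hdl] := Hw (eps / 2); first by rewrite divr_gt0.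
have [n hn] : exists n, 3^-1 ^+ n < dl / (2 * cabs d) by apply: pow3_small; rewrite divr_gt0// mulr_gt0.
have [x' [y' [[s0]]]] := hB n; set s := 3^-1 ^+ n in s0 hn *.
move=> Bx hxx' _; move: Bx; apply/negP; rewrite -leNgt.
have sd : 2 * s * cabs d < dl by move: hn; rewrite ltr_pdivlMr ?mulr_gt0//; lra.
have bnd (t : R) : `|x' + t - x| <= 2 * s -> cabs (F (m + (x' + t)%:C * d) - F (m + x%:C * d) - w * ((x' + t - x)%:C * d)) <= eps / 2 * (2 * s * cabs d).
  move=> ht; have -> : m + (x' + t)%:C * d = m + x%:C * d + (x' + t - x)%:C * d.
    by rewrite rmorphB /=; ring.
  have hh : cabs ((x' + t - x)%:C * d) <= 2 * s * cabs d by rewrite cabsM cabsR ler_wpM2r ?cabs_ge0.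
  apply: le_trans (hdl _ _) _; first exact: le_lt_trans hh sd.
  by rewrite ler_wpM2l// divr_ge0 ?ltW.
have b1 := bnd s _; have b2 := bnd (- s) _.
have {}b1 : cabs (F (m + (x' + s)%:C * d) - F (m + x%:C * d) - w * ((x' + s - x)%:C * d)) <= eps / 2 * (2 * s * cabs d).
  by apply: b1; move: hxx'; rewrite !ler_norml => /andP[]; lra.
have {}b2 : cabs (F (m + (x' - s)%:C * d) - F (m + x%:C * d) - w * ((x' - s - x)%:C * d)) <= eps / 2 * (2 * s * cabs d).
  by apply: b2; move: hxx'; rewrite !ler_norml => /andP[]; lra.
move: b1 b2; set A := F _; set A0 := F _; set A' := F _ => b1 b2.
have -> : A - A' = (A - A0 - w * ((x' + s - x)%:C * d)) - (A' - A0 - w * ((x' - s - x)%:C * d)) + w * ((2 * s)%:C * d).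
  have -> : 2 * s = (x' + s - x) - (x' - s - x) by ring.
  by rewrite !rmorphB/=; ring.
apply: le_trans (cabsD _ _) _; apply: le_trans (lerD (cabsD _ _) (lexx _)) _.
have s20 : 0 <= 2 * s by rewrite mulr_ge0// ltW.
rewrite cabsN cabsM (cabsM (2 * s)%:C) cabsR (ger0_norm s20).
have wK : cabs w * (2 * s * cabs d) <= L * (2 * s * cabs d) by rewrite ler_wpM2r// mulr_ge0 ?cabs_ge0// mulr_ge0// ltW.
move: b1 b2 wK; move: (2 * s * cabs d) => X; move: (cabs w * X) (cabs _) (cabs _) => Z Y1 Y2.
have -> : eps / 2 * X = eps * X / 2 by field.
by rewrite mulrDl; move: (L * X) (eps * X) => U V; lra.
Qed.
End MeanValue.

(** * Contour sums over squares *)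

Section Contour.
Context {R : realType}.
Local Notation C := (R[i]).
Local Notation I := ('i%C : C).

(** The midpoint Riemann sum, with 3^n steps, of the integral of F along the
    segment from m - d to m + d. *)
Fixpoint ssum (n : nat) (F : C -> C) (m d : C) : C :=
  if n is n'.+1 then
    ssum n' F (m - 2 / 3 * d) (d / 3) + ssum n' F m (d / 3)
      + ssum n' F (m + 2 / 3 * d) (d / 3)
  else 2 * d * F m.

(** The sum over the sides of the square with centre c, run anticlockwise; the
    centre of the right side is c + e, so that a complex e tilts the square. *)
Definition sq n F (c e : C) : C :=
  ssum n F (c + e) (I * e) + ssum n F (c + I * e) (- e)
  + ssum n F (c - e) (- (I * e)) + ssum n F (c - I * e) e.

Lemma ssum_bound n F m d (B : R) :
  (forall t : R, `|t| <= 1 -> cabs (F (m + t%:C * d)) <= B) ->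
  cabs (ssum n F m d) <= B * (2 * cabs d).
Proof.
have c3 : cabs 3^-1 = 3^-1 :> R by rewrite cabsV -rc_nat cabsR ger0_norm.
have c2 : cabs 2 = 2 :> R by rewrite -rc_nat cabsR ger0_norm.
elim: n m d => [|n ih] m d H /=.
  have := H 0; rewrite normr0 ler01 => /(_ isT); rewrite mul0r addr0 => h.
  by rewrite 2!cabsM c2 [leRHS]mulrC ler_wpM2l// mulr_ge0 ?cabs_ge0.
apply: le_trans (cabsD _ _) _; apply: le_trans (lerD (cabsD _ _) (lexx _)) _.
have -> : B * (2 * cabs d) = B * (2 * cabs (d / 3)) + B * (2 * cabs (d / 3)) + B * (2 * cabs (d / 3)).
  by rewrite cabsM c3; field.
have aux (k : R) : `|k| <= 2 -> forall t : R, `|t| <= 1 ->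
    cabs (F (m + (k / 3)%:C * d + t%:C * (d / 3))) <= B.
  move=> hk t ht.
  have -> : m + (k / 3)%:C * d + t%:C * (d / 3) = m + ((k + t) / 3)%:C * d.
    by rewrite rcM rcM rcD rcV rc_nat; field.
  apply: H; rewrite normrM [ `|_^-1|]ger0_norm// ler_pdivrMr// mul1r.
  by apply: le_trans (ler_normD _ _) _; lra.
have r2 : (2 / 3)%:C = 2 / 3 :> C by rewrite rcM rcV !rc_nat.
apply: lerD; first apply: lerD.
- apply: ih => t ht; have := @aux (-2); rewrite normrN normr_nat lexx => /(_ isT t ht).
  by rewrite mulNr rcN r2 mulNr.
- apply: ih => t ht; have := @aux 0; rewrite normr0 => /(_ _ t ht).
  by rewrite mul0r mul0r addr0; apply.
- apply: ih => t ht; have := @aux 2; rewrite normr_nat lexx => /(_ isT t ht).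
  by rewrite r2.
Qed.

Lemma ssumD n F G m d : ssum n (fun z => F z + G z) m d = ssum n F m d + ssum n G m d.
Proof. by elim: n m d => [|n ih] m d /=; rewrite ?ih; ring. Qed.

Lemma ssumZ n a F m d : ssum n (fun z => a * F z) m d = a * ssum n F m d.
Proof. by elim: n m d => [|n ih] m d /=; rewrite ?ih; ring. Qed.

Lemma ssum_affine n (a b : C) m d : ssum n (fun z => a * z + b) m d = 2 * d * (a * m + b).
Proof. by elim: n m d => [|n ih] m d //=; rewrite !ih; field. Qed.

Lemma ssum_rev n F m d : ssum n F m (- d) = - ssum n F m d.
Proof.
elim: n m d => [|n ih] m d /=; first by ring.
rewrite !mulNr !ih mulrN opprK; ring.
Qed.

Lemma sqD n F G c e : sq n (fun z => F z + G z) c e = sq n F c e + sq n G c e.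
Proof. by rewrite /sq !ssumD; ring. Qed.

Lemma sqZ n a F c e : sq n (fun z => a * F z) c e = a * sq n F c e.
Proof. by rewrite /sq !ssumZ; ring. Qed.

(** The midpoint rule is exact for affine functions, whose integral along a
    closed contour vanishes. In goursat this removes the first-order expansion
    of F, whatever n is. *)
Lemma sq_affine n (a b : C) c e : sq n (fun z => a * z + b) c e = 0.
Proof.
rewrite /sq !ssum_affine.
transitivity (2 * a * e * e * (2 * I + 2 * (- I))); ring.
Qed.

Definition on_square (x y : R) := (`|x| <= 1 /\ `|y| = 1) \/ (`|x| = 1 /\ `|y| <= 1).

Lemma sq_bound n F c e (B : R) :
  (forall x y : R, on_square x y -> cabs (F (c + (x%:C + I * y%:C) * e)) <= B) ->
  cabs (sq n F c e) <= 8 * B * cabs e.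
Proof.
move=> H; rewrite /sq.
have eI : cabs e = cabs (I * e) by rewrite cabsM cabsi mul1r.
have -> : 8 * B * cabs e = B * (2 * cabs e) + B * (2 * cabs e) + B * (2 * cabs e) + B * (2 * cabs e) by ring.
apply: le_trans (cabsD _ _) _; apply: le_trans (lerD (cabsD _ _) (lexx _)) _.
apply: le_trans (lerD (lerD (cabsD _ _) (lexx _)) (lexx _)) _.
apply: lerD; first apply: lerD; first apply: lerD.
- rewrite eI; apply: ssum_bound => t ht.
  have := H 1 t; rewrite rc1; have -> : (1 + I * t%:C) * e = e + t%:C * (I * e) by ring.
  by rewrite addrA; apply; right; rewrite normr1.
- rewrite -[X in 2 * X]cabsN; apply: ssum_bound => t ht.
  have := H (- t) 1; rewrite rc1 rcN.
  have -> : (- t%:C + I * 1) * e = I * e + t%:C * (- e) by ring.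
  by rewrite addrA; apply; left; rewrite normr1 normrN.
- rewrite eI -[X in 2 * X]cabsN; apply: ssum_bound => t ht.
  have := H (- 1) (- t); rewrite !rcN rc1.
  have -> : (- 1 + I * (- t%:C)) * e = - e + t%:C * (- (I * e)) by ring.
  by rewrite addrA; apply; right; rewrite !normrN normr1.
- apply: ssum_bound => t ht.
  have := H t (-1); rewrite !rcN rc1.
  have -> : (t%:C + I * (- 1)) * e = - (I * e) + t%:C * e by ring.
  by rewrite addrA; apply; left; rewrite !normrN normr1.
Qed.

(** The inner edges of the nine subsquares are run twice, in opposite
    directions. The cancellation is exact for the sums, and not only in the
    limit, because a side with 3^n.+1 steps consists of three sides with 3^n
    steps. *)
Lemma sq_subdivision n F c e :
  let Q (p q : C) := sq n F (c + 2 / 3 * (p + I * q) * e) (e / 3) in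
  sq n.+1 F c e = Q (-1) (-1) + Q 0 (-1) + Q 1 (-1) + Q (-1) 0 + Q 0 0 + Q 1 0
                  + Q (-1) 1 + Q 0 1 + Q 1 1.
Proof.
move=> Q.
(* vertical and horizontal edges, indexed by their midpoints on the lattice
   of mesh e / 3 *)
pose V (a b : C) := ssum n F (c + (a + I * b) * (e / 3)) (I * (e / 3)).
pose H (a b : C) := ssum n F (c + (a + I * b) * (e / 3)) (e / 3).
have QE p q : Q p q = V (2 * p + 1) (2 * q) - H (2 * p) (2 * q + 1) - V (2 * p - 1) (2 * q) + H (2 * p) (2 * q - 1).
  rewrite /Q /sq !ssum_rev /V /H.
  congr (_ - _ - _ + _); congr ssum; by field.
have -> : sq n.+1 F c e = V 3 (-2) + V 3 0 + V 3 2 - (H (-2) 3 + H 0 3 + H 2 3) - (V (-3) (-2) + V (-3) 0 + V (-3) 2) + (H (-2) (-3) + H 0 (-3) + H 2 (-3)).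
  rewrite /sq !ssum_rev /= /V /H.
  by congr (_ - _ - _ + _); congr (_ + _ + _); congr ssum; by field.
rewrite !QE.
have a1 : 2 * (-1) + 1 = -1 :> C by ring.
have a2 : 2 * (-1) - 1 = -3 :> C by ring.
have a3 : 2 * (-1) = -2 :> C by ring.
have b1 : 2 * 0 + 1 = 1 :> C by ring.
have b2 : 2 * 0 - 1 = -1 :> C by ring.
have b3 : 2 * 0 = 0 :> C by ring.
have c1 : 2 * 1 + 1 = 3 :> C by ring.
have c2 : 2 * 1 - 1 = 1 :> C by ring.
have c3 : 2 * 1 = 2 :> C by ring.
rewrite !(a1, a2, b1, b2, c1, c2) !(a3, b3, c3).
ring.
Qed.

End Contour.

(** * Goursat's lemma for contour sums *)

Section Goursat.
Context {R : realType}.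
Local Notation C := (R[i]).
Local Notation I := ('i%C : C).

Lemma leq_sum9_left N1 N2 N3 N4 N5 N6 N7 N8 N9 n :
  (N1 + N2 + N3 + N4 + N5 + N6 + N7 + N8 + N9 <= n)%N ->
  [/\ (N1 <= n)%N, (N2 <= n)%N, (N3 <= n)%N, (N4 <= n)%N & (N5 <= n)%N].
Proof. by move=> h; split; lia. Qed.
Lemma leq_sum9_right N1 N2 N3 N4 N5 N6 N7 N8 N9 n :
  (N1 + N2 + N3 + N4 + N5 + N6 + N7 + N8 + N9 <= n)%N ->
  [/\ (N6 <= n)%N, (N7 <= n)%N, (N8 <= n)%N & (N9 <= n)%N].
Proof. by move=> h; split; lia. Qed.

Lemma cabs_xy (x y : R) : cabs (x%:C + I * y%:C) <= `|x| + `|y|.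
Proof. by apply: le_trans (cabsD _ _) _; rewrite cabsM cabsi mul1r !cabsR. Qed.
Lemma cabs_xy_ge (x y : R) : `|x| <= cabs (x%:C + I * y%:C) /\ `|y| <= cabs (x%:C + I * y%:C).
Proof.
have := Re_cabs (x%:C + I * y%:C); have := Im_cabs (x%:C + I * y%:C).
by rewrite /= !mul0r !mul1r ?mulr0 ?subr0 ?addr0 ?add0r.
Qed.

(** If the sums over a square are not eventually small in comparison with its
    area, the same holds for one of the nine subsquares; around the limit
    point of a nested sequence of such squares F is affine up to a small
    error, and the affine part contributes nothing. *)
Lemma goursat (F : C -> C) (c e : C) : 0 < cabs e ->
  (forall x y : R, `|x| <= 1 -> `|y| <= 1 -> exists w, cdiff F (c + (x%:C + I * y%:C) * e) w) ->
  forall d : R, 0 < d -> exists N, forall n, (N <= n)%N -> cabs (sq n F c e) <= d * cabs e ^+ 2.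
Proof.
move=> e0 H d d0; apply: contrapT => Hn.
pose good x y (s : R) := exists N, forall n, (N <= n)%N ->
   cabs (sq n F (c + (x%:C + I * y%:C) * e) (s%:C * e)) <= d * (s * cabs e) ^+ 2.
have [||x [y [hx hy hB]]] := @trisection _ (fun x y s => s > 0 /\ ~ good x y s).
- split => // -[N hN]; apply: Hn; exists N => n /hN.
  by rewrite !rc0 mulr0 addr0 mul0r addr0 rc1 !mul1r.
- move=> x y s [s0 Bx]; apply: contrapT => hn; apply: Bx.
  have Hg p q : third p -> third q -> good (x + 2 / 3 * p * s) (y + 2 / 3 * q * s) (s / 3).
    move=> hp hq; apply: contrapT => h; apply: hn; exists p, q; split => //.
    by split => //; rewrite divr_gt0.
  have tm : third (-1 : R) by left.
  have t0 : third (0 : R) by right; left.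
  have t1 : third (1 : R) by right; right.
  have QE n (p q : R) : sq n F (c + ((x + 2 / 3 * p * s)%:C + I * (y + 2 / 3 * q * s)%:C) * e) ((s / 3)%:C * e)
     = sq n F (c + (x%:C + I * y%:C) * e + 2 / 3 * (p%:C + I * q%:C) * (s%:C * e)) (s%:C * e / 3).
    by congr (sq n F _ _); rewrite ?rcD !rcM rcV !rc_nat; ring.
  have [N1 h1] := Hg _ _ tm tm; have [N2 h2] := Hg _ _ t0 tm; have [N3 h3] := Hg _ _ t1 tm.
  have [N4 h4] := Hg _ _ tm t0; have [N5 h5] := Hg _ _ t0 t0; have [N6 h6] := Hg _ _ t1 t0.
  have [N7 h7] := Hg _ _ tm t1; have [N8 h8] := Hg _ _ t0 t1; have [N9 h9] := Hg _ _ t1 t1.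
  (* a bound above all nine thresholds, and one step more for the subdivision *)
  exists (N1 + N2 + N3 + N4 + N5 + N6 + N7 + N8 + N9).+2 => -[//|n] hN; rewrite sq_subdivision.
  have [m1 m2 m3 m4 m5] := leq_sum9_left (ltnW hN); have [m6 m7 m8 m9] := leq_sum9_right (ltnW hN).
  have {m1}h1 := h1 n m1; have {m2}h2 := h2 n m2; have {m3}h3 := h3 n m3.
  have {m4}h4 := h4 n m4; have {m5}h5 := h5 n m5; have {m6}h6 := h6 n m6.
  have {m7}h7 := h7 n m7; have {m8}h8 := h8 n m8; have {m9}h9 := h9 n m9.
  rewrite !QE ?rcN ?rc1 ?rc0 in h1 h2 h3 h4 h5 h6 h7 h8 h9.
  have -> : d * (s * cabs e) ^+ 2 = d * (s / 3 * cabs e) ^+ 2 + d * (s / 3 * cabs e) ^+ 2 + d * (s / 3 * cabs e) ^+ 2 + d * (s / 3 * cabs e) ^+ 2 + d * (s / 3 * cabs e) ^+ 2 + d * (s / 3 * cabs e) ^+ 2 + d * (s / 3 * cabs e) ^+ 2 + d * (s / 3 * cabs e) ^+ 2 + d * (s / 3 * cabs e) ^+ 2 by field.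
  do 8!(apply: le_trans (cabsD _ _) _; apply: lerD => //).
have [w Hw] := H x y hx hy; set z := c + _ * e in Hw.
(* 32 = 8 * 4: 8 from sq_bound, and 4 s |e| bounds the distance from z to the
   small square *)
have [|r r0 hr] := Hw (d / 32); first by rewrite divr_gt0.
have [n hn] : exists n, 3^-1 ^+ n < r / (4 * cabs e) by apply: pow3_small; rewrite divr_gt0// mulr_gt0.
have [x' [y' [[s0 nG] hxx hyy]]] := hB n; set s := 3^-1 ^+ n in s0 hn nG hxx hyy.
apply: nG; exists 0%N => m _; set c' := c + _ * e.
have se : 4 * s * cabs e < r by move: hn; rewrite ltr_pdivlMr ?mulr_gt0//; lra.
pose E u := F u - F z - w * (u - z).
have -> : F = (fun u => (w * u + (F z - w * z)) + E u) by apply/funext => u; rewrite /E; ring.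
rewrite sqD sq_affine add0r.
have -> : d * (s * cabs e) ^+ 2 = 8 * (d / 32 * (4 * s * cabs e)) * cabs (s%:C * e).
  by rewrite cabsM cabsR ger0_norm ?(ltW s0)//; field.
apply: sq_bound => a b hab.
set u := c' + _.
have uz : u - z = ((x' + a * s - x)%:C + I * (y' + b * s - y)%:C) * e.
  by rewrite /u /c' /z !rcD !rcN !rcM; ring.
have nuz : cabs (u - z) <= 4 * s * cabs e.
  rewrite uz cabsM ler_wpM2r ?cabs_ge0//; apply: le_trans (cabs_xy _ _) _.
  have hab' : `|a| <= 1 /\ `|b| <= 1 by case: hab => -[-> ->].
  have aux (p q t : R) : `|t| <= 1 -> `|p - q| <= s -> `|q + t * s - p| <= 2 * s.
    move=> ht; rewrite !ler_norml => /andP[h1 h2].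
    have : `|t * s| <= s by rewrite normrM [ `|s|]ger0_norm ?ler_piMl// ltW.
    by rewrite ler_norml => /andP[]; lra.
  have := aux _ _ _ hab'.1 hxx; have := aux _ _ _ hab'.2 hyy; lra.
rewrite /E; have := hr (u - z) (le_lt_trans nuz se); have -> : z + (u - z) = u by ring.
move=> h.
by apply: le_trans h _; rewrite ler_wpM2l// divr_ge0// ltW.
Qed.

(** The differential form dz / z is invariant under scaling, and midpoint sums
    are compatible with scaling. *)
Lemma ssum_inv_scale n (u m d : C) : u != 0 -> ssum n (fun z => z^-1) (u * m) (u * d) = ssum n (fun z => z^-1) m d.
Proof.
move=> u0; elim: n m d => [|n ih] m d /=.
  rewrite invfM; move: (m^-1) => m'.
  by transitivity ((u * u^-1) * (2 * d * m')); [ring|rewrite mulfV// mul1r].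
by rewrite -(ih (m - 2 / 3 * d)) -(ih m) -(ih (m + 2 / 3 * d)); congr (_ + _ + _); congr ssum; ring.
Qed.

Lemma ssum_inv2_scale n (u m d : C) : u != 0 ->
  ssum n (fun z => z^-1 * z^-1) (u * m) (u * d) = u^-1 * ssum n (fun z => z^-1 * z^-1) m d.
Proof.
move=> u0; elim: n m d => [|n ih] m d /=.
  rewrite invfM; move: (m^-1) => m'.
  by transitivity ((u * u^-1) * (u^-1 * (2 * d * (m' * m')))); [ring|rewrite mulfV// mul1r].
by rewrite !mulrDr -(ih (m - 2 / 3 * d)) -(ih m) -(ih (m + 2 / 3 * d)); congr (_ + _ + _); congr ssum; ring.
Qed.

Lemma CI0 : I != 0.
Proof. by apply/eqP => h; have := @cabsi R; rewrite h /cabs normr0 /=; apply/eqP; rewrite eq_sym oner_eq0. Qed.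
Lemma CIV : I^-1 = - I.
Proof. by apply: (mulfI CI0); rewrite mulfV ?CI0// mulrN Ci2 opprK. Qed.

(** The four sides are obtained from one another by multiplication by the
    powers of i, under which dz / z^2 is multiplied by the powers of -i; these
    add up to 0. *)
Lemma sq_inv2 n (e : C) : sq n (fun z => z^-1 * z^-1) 0 e = 0.
Proof.
have N1 : -1 != 0 :> C by rewrite oppr_eq0 oner_eq0.
have NI : - I != 0 by rewrite oppr_eq0 CI0.
have IIe : I * (I * e) = - e by rewrite mulrA Ci2 mulN1r.
rewrite /sq !add0r; set f := fun z : C => z^-1 * z^-1.
have -> : ssum n f (I * e) (- e) = I^-1 * ssum n f e (I * e).
  by rewrite -(ssum_inv2_scale _ _ _ CI0) IIe.
have -> : ssum n f (- e) (- (I * e)) = (-1)^-1 * ssum n f e (I * e).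
  by rewrite -(ssum_inv2_scale _ _ _ N1) !mulN1r.
have -> : ssum n f (- (I * e)) e = (- I)^-1 * ssum n f e (I * e).
  by rewrite -(ssum_inv2_scale _ _ _ NI) !mulNr IIe opprK.
by rewrite !invrN CIV invr1; ring.
Qed.

(** The same rotations leave dz / z invariant, so that the four sides
    contribute equally. *)
Lemma sq_inv n (e : C) : e != 0 -> sq n (fun z => z^-1) 0 e = 4 * ssum n (fun z => z^-1) 1 I.
Proof.
move=> e0.
have N1 : -1 != 0 :> C by rewrite oppr_eq0 oner_eq0.
have NI : - I != 0 by rewrite oppr_eq0 CI0.
have IIe : I * (I * e) = - e by rewrite mulrA Ci2 mulN1r.
rewrite /sq !add0r; set f := fun z : C => z^-1.
have -> : ssum n f (I * e) (- e) = ssum n f e (I * e).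
  by rewrite -[RHS](ssum_inv_scale _ _ _ CI0) IIe.
have -> : ssum n f (- e) (- (I * e)) = ssum n f e (I * e).
  by rewrite -[RHS](ssum_inv_scale _ _ _ N1) !mulN1r.
have -> : ssum n f (- (I * e)) e = ssum n f e (I * e).
  by rewrite -[RHS](ssum_inv_scale _ _ _ NI) !mulNr IIe opprK.
have -> : ssum n f e (I * e) = ssum n f 1 I.
  by rewrite -[RHS](ssum_inv_scale _ _ _ e0) mulr1 mulrC.
by ring.
Qed.

(** On the side 1 + i y the imaginary part of dz / z is dy / (1 + y^2), which
    is at least dy / 2. *)
Lemma ssum_inv_ge n (y s : R) : 0 <= s -> `|y| + s <= 1 ->
  s <= complex.Im (ssum n (fun z => z^-1) (1 + I * y%:C) (I * s%:C)).
Proof.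
elim: n y s => [|n ih] y s s0 ys.
  have y1 : y ^+ 2 <= 1.
    by rewrite -real_normK ?num_real// expr_le1//; lra.
  have D0 : 1 + y ^+ 2 != 0 by rewrite gt_eqF// ltr_pwDl// sqr_ge0.
  have -> : ssum 0 (fun z => z^-1) (1 + I * y%:C) (I * s%:C) = (2 * s / (1 + y ^+ 2))%:C * (I + y%:C).
    rewrite /=; have N0 : 1 + I * y%:C != 0.
      apply/eqP => /(congr1 (@complex.Re R)); rewrite /= mul0r mulr0 subr0 addr0.
      by apply/eqP; rewrite oner_eq0.
    apply: (mulIf N0); rewrite divfK//.
    have -> : (2 * s / (1 + y ^+ 2))%:C * (I + y%:C) * (1 + I * y%:C) = (2 * s / (1 + y ^+ 2))%:C * (I * (1 + y%:C * y%:C) + (1 + I * I) * y%:C) by ring.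
    have K2 : (2 * s / (1 + y ^+ 2))%:C * (1 + y%:C * y%:C) = 2 * s%:C.
      have -> : 1 + y%:C * y%:C = (1 + y ^+ 2)%:C by rewrite rcD expr2 rcM.
      by rewrite -rcM divfK// rcM rc_nat.
    by rewrite Ci2 subrr mul0r addr0 [RHS]mulrCA K2; ring.
  rewrite /= mul0r !addr0 mulr1.
  rewrite ler_pdivlMr ?ltr_pwDl ?sqr_ge0//; nra.
rewrite /= !raddfD /=.
rewrite [X in X <= _](_ : s = s / 3 + s / 3 + s / 3); last by field.
have aux (k : R) : `|k| <= 2 -> s / 3 <= complex.Im (ssum n (fun z => z^-1) (1 + I * (y + k / 3 * s)%:C) (I * (s / 3)%:C)).
  move=> hk; apply: ih; first by rewrite divr_ge0.
  have : `|k / 3 * s| <= 2 / 3 * s.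
    by rewrite 2!normrM [ `|s|]ger0_norm// [ `|3^-1|]ger0_norm// ler_wpM2r// ler_wpM2r.
  by have := ler_normD y (k / 3 * s); lra.
apply: lerD; first apply: lerD.
- have := @aux (-2); rewrite normrN normr_nat lexx => /(_ isT); congr (_ <= complex.Im (ssum _ _ _ _)).
    by rewrite rcD !rcM rcN !rcV !rc_nat; ring.
  by rewrite rcM rcV rc_nat; ring.
- have := @aux 0; rewrite normr0 => /(_ _); rewrite ler0n => /(_ isT); congr (_ <= complex.Im (ssum _ _ _ _)).
    by rewrite mul0r mul0r addr0.
  by rewrite rcM rcV rc_nat; ring.
- have := @aux 2; rewrite normr_nat lexx => /(_ isT); congr (_ <= complex.Im (ssum _ _ _ _)).
    by rewrite rcD !rcM !rcV !rc_nat; ring.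
  by rewrite rcM rcV rc_nat; ring.
Qed.

(** The integral of dz / z around the origin is 2 pi i; a lower bound for the
    modulus that is uniform in n is all that Cauchy's estimate requires. *)
Lemma sq_inv_ge n (e : C) : e != 0 -> 4 <= cabs (sq n (fun z => z^-1) 0 e).
Proof.
move=> e0; rewrite sq_inv// cabsM -rc_nat cabsR normr_nat ler_peMr//.
apply: le_trans (Im_cabs _); apply: le_trans (ler_norm _).
have := @ssum_inv_ge n 0 1 ler01; rewrite normr0 add0r lexx => /(_ isT).
by rewrite rc0 rc1 mulr0 addr0 mulr1.
Qed.

End Goursat.

(** * Cauchy's estimate *)

Section CauchyBound.
Context {R : realType}.
Local Notation C := (R[i]).
Local Notation I := ('i%C : C).

Lemma cabs_gt0 (e : C) : (0 < cabs e) = (e != 0).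
Proof.
rewrite lt_neqAle cabs_ge0 andbT eq_sym; apply/idP/idP; apply: contra => /eqP.
  by move=> ->; rewrite /cabs normr0.
by move/cabs_eq0 => ->.
Qed.

Lemma cabs_nat n : cabs (n%:R : C) = n%:R :> R.
Proof. by rewrite -rc_nat cabsR normr_nat. Qed.

(** Deformation of the contour across the region where F is differentiable: of
    the nine subsquares, the eight which avoid the origin contribute little by
    goursat, and the remaining one is the original square shrunk by a factor
    3. *)
Lemma sq_shrink (F : C -> C) (r : R) :
  (forall z, z != 0 -> cabs z <= 2 * r -> exists w, cdiff F z w) ->
  forall k (e : C), e != 0 -> cabs e <= r -> forall d : R, 0 < d -> exists N, forall n, (N <= n)%N ->
   cabs (sq (n + k) F 0 e - sq n F 0 (e / 3 ^+ k)) <= d.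
Proof.
move=> H; elim => [|k ih] e e0 er d d0.
  exists 0%N => n _; rewrite addn0 expr0 divr1 subrr /cabs normr0; exact: ltW.
have e30 : e / 3 != 0 by rewrite mulf_neq0.
have ce : cabs (e / 3) = cabs e / 3 by rewrite cabsM cabsV cabs_nat.
have e3r : cabs (e / 3) <= r by rewrite ce; have := cabs_ge0 e; lra.
have [|N hN] := ih _ e30 e3r (d / 2); first by rewrite divr_gt0.
pose d' := d / 16 / cabs (e / 3) ^+ 2.
have d'0 : 0 < d' by rewrite !divr_gt0// exprn_gt0// cabs_gt0.
(* the eight subsquares other than the central one *)
have G (p q : R) : third p -> third q -> (p != 0) || (q != 0) -> exists N, forall n, (N <= n)%N ->
    cabs (sq n F (0 + 2 / 3 * (p%:C + I * q%:C) * e) (e / 3)) <= d / 16.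
  move=> hp hq pq.
  have [|x y hx hy|N' hN'] := @goursat R F (0 + 2 / 3 * (p%:C + I * q%:C) * e) (e / 3) _ _ d' d'0.
  - by rewrite cabs_gt0.
  - have -> : 0 + 2 / 3 * (p%:C + I * q%:C) * e + (x%:C + I * y%:C) * (e / 3) = ((2 * p + x)%:C + I * (2 * q + y)%:C) * (e / 3).
      by rewrite !rcD !rcM rc_nat; field.
    have ap (a b : R) : third a -> `|b| <= 1 -> `|2 * a + b| <= 3.
      by move=> hh; rewrite !ler_norml => /andP[]; case: hh => [->|[->|->]]; lra.
    have ap0 (a b : R) : third a -> a != 0 -> `|b| <= 1 -> 2 * a + b != 0.
      move=> hh p0; rewrite ler_norml => /andP[h1 h2]; case: hh => [->|[pe|->]].
      + by rewrite lt_eqF//; lra.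
      + by rewrite pe eqxx in p0.
      + by rewrite gt_eqF//; lra.
    apply: H.
      rewrite mulf_neq0// -cabs_gt0; have [h1 h2] := cabs_xy_ge (2 * p + x) (2 * q + y).
      case/orP: pq => h0.
        by apply: lt_le_trans h1; rewrite normr_gt0; exact: ap0.
      by apply: lt_le_trans h2; rewrite normr_gt0; exact: ap0.
    rewrite cabsM ce; have h := cabs_xy (2 * p + x) (2 * q + y).
    have h6 : cabs ((2 * p + x)%:C + I * (2 * q + y)%:C) <= 6.
      by apply: le_trans h _; have := ap _ _ hp hx; have := ap _ _ hq hy; lra.
    apply: (@le_trans _ _ (6 * (cabs e / 3))).
      by rewrite ler_wpM2r// divr_ge0// cabs_ge0.
    by rewrite mulrCA; lra.
  - exists N' => n /hN'; rewrite /d' divfK//.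
    by rewrite gt_eqF// exprn_gt0// cabs_gt0.
have tm : third (-1 : R) by left.
have t0 : third (0 : R) by right; left.
have t1 : third (1 : R) by right; right.
have n1 : (-1 : R) != 0 by rewrite oppr_eq0 oner_eq0.
have o1 : (1 : R) != 0 by rewrite oner_eq0.
have [|N1 h1] := G _ _ tm tm; first by rewrite n1.
have [|N2 h2] := G _ _ t0 tm; first by rewrite n1 orbT.
have [|N3 h3] := G _ _ t1 tm; first by rewrite n1 orbT.
have [|N4 h4] := G _ _ tm t0; first by rewrite n1.
have [|N6 h6] := G _ _ t1 t0; first by rewrite o1.
have [|N7 h7] := G _ _ tm t1; first by rewrite n1.
have [|N8 h8] := G _ _ t0 t1; first by rewrite o1 orbT.
have [|N9 h9] := G _ _ t1 t1; first by rewrite o1.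
exists (N + N1 + N2 + N3 + N4 + N6 + N7 + N8 + N9)%N => n hn.
rewrite addnS exprS invfM mulrA.
have [m0 m1 m2 m3 m4] := leq_sum9_left hn; have [m6 m7 m8 m9] := leq_sum9_right hn.
have {m0}hN := hN n m0; have {}h1 := h1 (n + k)%N (leq_trans m1 (leq_addr _ _)).
have {}h2 := h2 (n + k)%N (leq_trans m2 (leq_addr _ _)).
have {}h3 := h3 (n + k)%N (leq_trans m3 (leq_addr _ _)).
have {}h4 := h4 (n + k)%N (leq_trans m4 (leq_addr _ _)).
have {}h6 := h6 (n + k)%N (leq_trans m6 (leq_addr _ _)).
have {}h7 := h7 (n + k)%N (leq_trans m7 (leq_addr _ _)).
have {}h8 := h8 (n + k)%N (leq_trans m8 (leq_addr _ _)).
have {}h9 := h9 (n + k)%N (leq_trans m9 (leq_addr _ _)).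
rewrite sq_subdivision; rewrite ?rcN ?rc1 ?rc0 in h1 h2 h3 h4 h6 h7 h8 h9.
have -> : 0 + 2 / 3 * (0 + I * 0) * e = 0 by ring.
move: h1 h2 h3 h4 h6 h7 h8 h9 hN.
set a1 := sq _ _ _ _; set a2 := sq _ _ _ _; set a3 := sq _ _ _ _; set a4 := sq _ _ _ _.
set a6 := sq _ _ _ _; set a7 := sq _ _ _ _; set a8 := sq _ _ _ _; set a9 := sq _ _ _ _.
set a5 := sq _ F 0 _; set b := sq _ F 0 _ => h1 h2 h3 h4 h6 h7 h8 h9 hN.
have -> : a1 + a2 + a3 + a4 + a5 + a6 + a7 + a8 + a9 - b = (a5 - b) + a1 + a2 + a3 + a4 + a6 + a7 + a8 + a9 by ring.
have -> : d = d / 2 + d / 16 + d / 16 + d / 16 + d / 16 + d / 16 + d / 16 + d / 16 + d / 16 by field.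
by do 8!(apply: le_trans (cabsD _ _) _; apply: lerD => //).
Qed.

(** Apply sq_shrink to f z / z^2. Over a tiny square around 0, f z is f 0 + w
    z up to a small error: the term in 1 / z^2 contributes nothing and the
    term in 1 / z contributes w times a number of modulus at least 4. Over the
    square of half-side r the function is at most B / r^2. *)
Lemma cauchy_bound (f : C -> C) (w : C) (r B : R) : 0 < r ->
  (forall z, cabs z <= 2 * r -> differentiable (f : C^o -> C^o) (z : C^o) /\ cabs (f z) <= B) ->
  cdiff f 0 w -> cabs w <= 2 * B / r.
Proof.
move=> r0 H Hw.
have B0 : 0 <= B.
  have [|_] := H 0; first by rewrite /cabs normr0 mulr_ge0// ltW.
  by apply: le_trans; exact: cabs_ge0.
suff main : forall eps : R, 0 < eps -> 4 * cabs w <= 8 * B / r + eps.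
  by rewrite -(@ler_pM2l _ 4)// mulrA mulrA -natrM; apply/ler_addgt0Pr.
(* eps is spent on the deformation (one ninth) and on the remainder G (eight
   ninths) *)
move=> eps eps0; pose e9 := eps / 9; have e90 : 0 < e9 by rewrite divr_gt0.
pose F z := z^-1 * z^-1 * f z.
have DF z : z != 0 -> cabs z <= 2 * r -> exists v, cdiff F z v.
  move=> z0 zr; eexists; apply: differentiable_cdiff.
  have D1 : differentiable (fun z : C^o => z^-1 : C^o) (z : C^o).
    by apply: differentiableV => //; exact: z0.
  have D2 : differentiable (f : C^o -> C^o) (z : C^o) by have [] := H z zr.
  exact: (differentiableM (differentiableM D1 D1) D2).
have rC0 : (r%:C : C) != 0 by rewrite -cabs_gt0 cabsR gtr0_norm.
have cr : cabs (r%:C : C) = r by rewrite cabsR gtr0_norm.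
have [d d0 hd] := Hw e9 e90.
have [k hk] : exists k, 3^-1 ^+ k < d / (4 * r) by apply: pow3_small; rewrite divr_gt0// mulr_gt0.
have [|N hN] := sq_shrink DF k rC0 _ e90; first by rewrite cr.
have {hN} := hN N (leqnn N); set e := (r%:C : C) / 3 ^+ k => hS.
have ce : cabs e = r * 3^-1 ^+ k.
  by rewrite cabsM cr cabsV exprVn -natrX cabs_nat natrX.
have ed : 4 * cabs e < d by move: hk; rewrite ltr_pdivlMr ?mulr_gt0// ce; lra.
have e0 : e != 0 by rewrite -cabs_gt0 ce mulr_gt0// exprn_gt0// invr_gt0.
pose G z := z^-1 * z^-1 * (f z - f 0 - w * z).
have FE : F = (fun z => f 0 * (z^-1 * z^-1) + (w * z^-1 + G z)).
  apply/funext => z; rewrite /F /G; have [->|z0] := eqVneq z 0; last by field.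
  by rewrite invr0; ring.
have E1 : sq N F 0 e = w * sq N (fun z => z^-1) 0 e + sq N G 0 e.
  by rewrite FE sqD sqZ sq_inv2 mulr0 add0r sqD sqZ.
have sqr (x y : R) : on_square x y -> 1 <= cabs (x%:C + I * y%:C) /\ cabs (x%:C + I * y%:C) <= 2.
  move=> h; have [h1 h2] := cabs_xy_ge x y; have h3 := cabs_xy x y.
  by case: h => -[a b]; rewrite ?a ?b in h1 h2 h3; split; lra.
have bG : cabs (sq N G 0 e) <= 8 * e9.
  have -> : 8 * e9 = 8 * (e9 / cabs e) * cabs e by rewrite -mulrA divfK// gt_eqF// cabs_gt0.
  apply: sq_bound => x y /sqr[h1 h2]; rewrite add0r; set z := _ * e.
  have zge : cabs e <= cabs z by rewrite /z cabsM ler_peMl// cabs_ge0.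
  have zle : cabs z < d.
    apply: le_lt_trans ed; rewrite /z cabsM ler_wpM2r ?cabs_ge0//; lra.
  have z0 : 0 < cabs z by apply: lt_le_trans zge; rewrite cabs_gt0.
  rewrite /G 2!cabsM cabsV; have := hd z zle; rewrite add0r => h.
  apply: (@le_trans _ _ ((cabs z)^-1 / cabs z * (e9 * cabs z))).
    by rewrite ler_wpM2l// mulr_ge0// invr_ge0 ltW.
  have -> : (cabs z)^-1 / cabs z * (e9 * cabs z) = e9 / cabs z by field; rewrite gt_eqF.
  by rewrite ler_wpM2l ?(ltW e90)// lef_pV2// posrE// cabs_gt0.
have bF : cabs (sq (N + k) F 0 r%:C) <= 8 * B / r.
  have -> : 8 * B / r = 8 * (r^-1 * r^-1 * B) * cabs (r%:C : C) by rewrite cr; field; rewrite gt_eqF.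
  apply: sq_bound => x y /sqr[h1 h2]; rewrite add0r; set z := _ * _.
  have zr : r <= cabs z by rewrite /z cabsM cr ler_peMl// ltW.
  have zr2 : cabs z <= 2 * r by rewrite /z cabsM cr ler_wpM2r// ltW.
  have z0 : 0 < cabs z by apply: lt_le_trans zr.
  rewrite /F 2!cabsM cabsV.
  have vr : (cabs z)^-1 <= r^-1 by rewrite lef_pV2// posrE.
  apply: ler_pM; rewrite ?mulr_ge0 ?cabs_ge0 ?invr_ge0 ?(ltW z0)//; last by have [] := H z zr2.
  by apply: ler_pM; rewrite ?invr_ge0 ?(ltW z0).
have := sq_inv_ge N e0; move: E1 hS; set S := sq _ (fun z => z^-1) _ _ => E1 hS S4.
have w4 : 4 * cabs w <= cabs (w * S) by rewrite cabsM mulrC ler_wpM2l ?cabs_ge0.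
apply: le_trans w4 _.
have -> : w * S = sq (N + k) F 0 r%:C - (sq (N + k) F 0 r%:C - sq N F 0 e) - sq N G 0 e by rewrite E1; ring.
apply: le_trans (cabsD _ _) _; apply: le_trans (lerD (cabsD _ _) (lexx _)) _.
rewrite !cabsN; have : eps = 9 * e9 by rewrite /e9; field.
lra.
Qed.

End CauchyBound.

(** * Bounded holomorphic functions on a ball *)

Section ScalarEstimates.
Context {R : realType}.
Local Notation C := (R[i]).
Context {V : normedModType C}.
Implicit Types (phi : V -> C^o) (u v w h : V).

Lemma is_diff_line u h (z : C^o) : is_diff z (fun t : C^o => u + t *: h) (fun t : C^o => t *: h).
Proof.
have -> : (fun t : C^o => u + t *: h) = cst u + (fun t : C^o => t *: h) by apply/funext.
by apply: is_diff_eq; rewrite add0r.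
Qed.

Lemma differentiable_line phi u h (z : C^o) : differentiable phi (u + z *: h) ->
  differentiable (fun t : C^o => phi (u + t *: h)) z.
Proof.
move=> D; have L := is_diff_line u h z.
exact: (@differentiable_comp _ _ _ _ (fun t : C^o => u + t *: h) phi z).
Qed.

Lemma cdiff_line phi u h (z : C) : differentiable phi (u + z *: h) ->
  cdiff (fun t : C => phi (u + t *: h)) z ('d phi (u + z *: h) h).
Proof.
move=> D e e0; pose k := nm h + 1; have k0 : 0 < k by rewrite ltr_wpDl ?nm_ge0.
(* k = nm h + 1 rather than nm h, which may vanish *)
have [|d d0 hd] := diffRE D (e := e / k); first by rewrite divr_gt0.
exists (d / k); first by rewrite divr_gt0.
move=> t; rewrite ltr_pdivlMr// => ht.
have tk : nm (t *: h) <= cabs t * k by rewrite nmZ ler_wpM2l ?cabs_ge0// lerDl.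
have := hd (t *: h) (le_lt_trans tk ht); rewrite linearZ scalerDl addrA => H.
apply: le_trans (_ : e / k * (cabs t * k) <= _).
  rewrite mulrC; apply: le_trans H _.
  by rewrite ler_wpM2l// divr_ge0 ?ltW.
by rewrite mulrACA mulVf ?mulr1 ?gt_eqF// mulrC.
Qed.

Definition bounded_holo (phi : V -> C^o) (w0 : V) (r B : R) :=
  0 < r /\ forall w, nm (w - w0) < r -> differentiable phi w /\ cabs (phi w) <= B.

Section Ball.
Variables (phi : V -> C^o) (w0 : V) (r B : R).

(** Cauchy's estimate on the complex line through w in the direction h. *)
Lemma diff_bound w h : bounded_holo phi w0 r B -> nm (w - w0) < r / 2 -> cabs ('d phi w h) <= 16 * B / r * nm h.
Proof.
move=> [r0 H] wr; have [hz|hn] := eqVneq (nm h) 0.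
  by rewrite (nm_eq0 hz) linear0 /cabs normr0 nm0 mulr0.
have h0 : 0 < nm h by rewrite lt_neqAle nm_ge0 eq_sym hn.
(* the complex disc of radius r / (4 nm h) in the direction h stays in the
   ball of radius r around w0 *)
have -> : 16 * B / r * nm h = 2 * B / (r / (8 * nm h)).
  by field; rewrite !gt_eqF.
apply: (@cauchy_bound R (fun t : C => phi (w + t *: h))) => [|z hz|].
- by rewrite divr_gt0// mulr_gt0.
- have hb : nm (w + z *: h - w0) < r.
    rewrite addrAC; apply: nm_ltD; rewrite nmZ.
    have : cabs z * nm h <= r / 4.
      have := ler_wpM2r (nm_ge0 h) hz; have -> : 2 * (r / (8 * nm h)) * nm h = r / 4 by field.
      by [].
    by lra.
  have [D b] := H _ hb; split => //; exact: differentiable_line.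
- have := @cdiff_line phi w h 0; rewrite scale0r addr0; apply.
  have wr' : nm (w - w0) < r by lra.
  by have [] := H _ wr'.
Qed.

Lemma B_ge0 : bounded_holo phi w0 r B -> 0 <= B.
Proof. by move=> [r0 H]; have [|_] := @H w0; [rewrite subrr nm0|apply: le_trans; exact: cabs_ge0]. Qed.

Lemma convex_ball (s t : R) u v : nm (u - w0) < s -> nm (v - w0) < s -> 0 <= t <= 1 ->
  nm (v + t%:C *: (u - v) - w0) < s.
Proof.
move=> hu hv /andP[t0 t1].
have -> : v + t%:C *: (u - v) - w0 = t%:C *: (u - w0) + (1 - t)%:C *: (v - w0).
  rewrite rcD rcN rc1 scalerBl scale1r addrCA -scalerBr opprB addrA subrK.
  by rewrite addrAC.
apply: nm_ltD; rewrite !nmZ !cabsR ger0_norm// ger0_norm ?subr_ge0//.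
have [->|tn0] := eqVneq t 0; first by rewrite mul0r add0r subr0 mul1r.
have : t * nm (u - w0) < t * s by rewrite ltr_pM2l// lt_neqAle t0 eq_sym tn0.
have : (1 - t) * nm (v - w0) <= (1 - t) * s by rewrite ler_wpM2l ?subr_ge0// ltW.
lra.
Qed.

(** The mean value inequality for f minus a linear function: K = 0 gives
    lipschitz_ball, and a value of the differential at a fixed point as K
    gives strict_estimate. *)
Lemma mean_value_ball (f : V -> C^o) (s L : R) (K : C) u v :
  nm (u - w0) < s -> nm (v - w0) < s ->
  (forall w, nm (w - w0) < s -> differentiable f w /\ cabs ('d f w (u - v) - K) <= L) ->
  cabs (f u - f v - K) <= L.
Proof.
move=> hu hv Hf.
(* the segment from 0 to 1, of midpoint 1/2 and half-length 1/2 *)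
have := @mean_value R (fun t : C => f (v + t *: (u - v)) - t * K) (2^-1) (2^-1) L.
have -> : 2^-1 + 2^-1 = 1 :> C by field.
have -> : 2 * cabs (2^-1 : C) = 1 :> R by rewrite cabsV cabs_nat mulfV.
rewrite subrr scale1r scale0r addr0 addrCA subrr addr0 mul1r mul0r subr0 mulr1.
rewrite addrAC; apply => x hx.
have xt : 0 <= (1 + x) / 2 <= 1 by move: hx; rewrite ler_norml => /andP[]; lra.
have -> : 2^-1 + x%:C * 2^-1 = ((1 + x) / 2)%:C :> C by rewrite rcM rcV rcD rc_nat; ring.
have [D b] := Hf _ (convex_ball hu hv xt).
exists ('d f (v + ((1 + x) / 2)%:C *: (u - v)) (u - v) - K) => //.
move=> e e0; have [d d0 hd] := cdiff_line D e0; exists d => // h hh.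
have := hd h hh; congr (cabs _ <= _); ring.
Qed.

Lemma lipschitz_ball u v : bounded_holo phi w0 r B -> nm (u - w0) < r / 2 -> nm (v - w0) < r / 2 ->
  cabs (phi u - phi v) <= 16 * B / r * nm (u - v).
Proof.
move=> rH hu hv; have [r0 H] := rH; rewrite -[X in cabs X]subr0; apply: (mean_value_ball hu hv) => w hw.
have hw' : nm (w - w0) < r by lra.
by split; [have [] := H _ hw'|rewrite subr0; exact: diff_bound].
Qed.

End Ball.

Lemma diff_shift phi c w : differentiable phi (w + c) ->
  differentiable (fun x => phi (x + c)) w /\ 'd (fun x => phi (x + c)) w = 'd phi (w + c) :> (V -> C^o).
Proof.
move=> D.
have S : is_diff w (fun x : V => x + c) id.
  have -> : (fun x : V => x + c) = id + cst c by apply/funext.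
  by apply: is_diff_eq; rewrite addr0.
split; first exact: (@differentiable_comp _ _ _ _ (fun x => x + c) phi w).
rewrite (@diff_comp _ _ _ _ (fun x => x + c) phi w)//.
by apply/funext => h /=; rewrite (diff_val (is_diff_def := S)).
Qed.

Lemma diff_subE (f g : V -> C^o) w : differentiable f w -> differentiable g w ->
  forall h, 'd (fun x => f x - g x : C^o) w h = 'd f w h - 'd g w h.
Proof.
move=> Df Dg h; have := diffB Df Dg.
by move=> /(congr1 (fun k : V -> C^o => k h)).
Qed.

Lemma diff_increment phi c w : differentiable phi (w + c) -> differentiable phi w ->
  forall h, 'd (fun x => phi (x + c) - phi x : C^o) w h = 'd phi (w + c) h - 'd phi w h.
Proof.
move=> D D1 h; have [D2 E] := diff_shift D.
apply: etrans (diff_subE D2 D1 h) _.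
exact: (congr1 (fun z : C^o => z - 'd phi w h) (congr1 (fun k : V -> C^o => k h) E)).
Qed.

Section StrictEstimate.
Variables (phi : V -> C^o) (w0 : V) (r B : R).

(** This replaces a bound for the second derivative. The increment x |-> phi
    (x + c) - phi x is itself bounded and holomorphic, with a bound
    proportional to the norm of c; Cauchy's estimate for the increment
    compares the differentials of phi at two points. *)
Lemma diff_lipschitz w w' h : bounded_holo phi w0 r B -> nm (w - w0) < r / 8 -> nm (w' - w0) < r / 8 ->
  cabs ('d phi w' h - 'd phi w h) <= 1024 * B / r ^+ 2 * nm (w' - w) * nm h.
Proof.
move=> rH hw hw'; have [r0 H] := rH.
pose g x := (phi (x + (w' - w)) - phi x : C^o).
have r40 : 0 < r / 4 by rewrite divr_gt0.
have Hg : bounded_holo g w (r / 4) (16 * B / r * nm (w' - w)).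
  split; first exact: r40.
  move=> x hx.
  have b1 : nm (x - w0) < r / 2.
    have -> : x - w0 = (x - w) + (w - w0) by rewrite addrA subrK.
    by apply: nm_ltD; lra.
  have b2'  : r / 2 < r by lra.
  have b2 : nm (x + (w' - w) - w0) < r / 2.
    have -> : x + (w' - w) - w0 = (x - w) + (w' - w0) by rewrite !addrA [x - w + w']addrAC.
    by apply: nm_ltD; lra.
  split.
    apply: differentiableB.
      by apply: (diff_shift _).1; have [] : differentiable phi (x + (w' - w)) /\ _ := H _ (lt_trans b2 b2').
    by have [] := H _ (lt_trans b1 b2').
  rewrite /g; have := lipschitz_ball rH b2 b1.
  by rewrite addrAC subrr add0r.
have hww : nm (w - w) < r / 4 / 2 by rewrite subrr nm0 !divr_gt0.
have hb : cabs ('d (fun x => phi (x + (w' - w)) - phi x : C^o) w h) <= _ := diff_bound h Hg hww.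
have r8 : r / 8 < r by lra.
have D1 : differentiable phi w by have [] := H _ (lt_trans hw r8).
have D2 : differentiable phi (w + (w' - w)) by rewrite addrC subrK; have [] := H _ (lt_trans hw' r8).
have E := diff_increment D2 D1 h.
rewrite E in hb; have ww : w + (w' - w) = w' by rewrite addrC subrK.
rewrite ww in hb; apply: le_trans hb _.
by rewrite le_eqVlt; apply/orP; left; apply/eqP; field; rewrite gt_eqF.
Qed.

(** The constant depends on phi through r and B only. Hence the estimate is
    uniform over families with a common bound, which is what
    differentiable_fvec uses. *)
Lemma strict_estimate (d : R) u u' v : bounded_holo phi w0 r B -> d <= r / 8 ->
  nm (u - w0) < d -> nm (u' - w0) < d -> nm (v - w0) < d ->
  cabs (phi u - phi u' - 'd phi v (u - u')) <= 2048 * B / r ^+ 2 * d * nm (u - u').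
Proof.
move=> rH dr hu hu' hv; have [r0 H] := rH; apply: (mean_value_ball hu hu') => w hw; split.
  have hwr : nm (w - w0) < r by lra.
  by have [] := H _ hwr.
have [hv' hw'] : nm (v - w0) < r / 8 /\ nm (w - w0) < r / 8 by split; lra.
apply: le_trans (diff_lipschitz _ rH hv' hw') _.
have hwv : nm (w - v) <= 2 * d.
  have -> : w - v = (w - w0) + - (v - w0) by rewrite opprB addrA subrK.
  by apply: le_trans (nmD _ _) _; rewrite nmN; lra.
have -> : 2048 * B / r ^+ 2 * d = 1024 * B / r ^+ 2 * (2 * d) by ring.
apply: ler_wpM2r; first exact: nm_ge0.
apply: ler_wpM2l hwv; apply: divr_ge0; last exact: sqr_ge0.
by apply: mulr_ge0; [exact: ler0n|exact: B_ge0 rH].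
Qed.

End StrictEstimate.
End ScalarEstimates.

(** * Banach spaces of bounded functions *)

(** The data of a linear space of bounded functions that contains its uniform
    limits, hence is complete for the sup norm. *)
Record fspace (R : realType) (X : Type) := FSpace {
  fs_mem : (X -> R[i]) -> Prop ;
  fs_bounded : forall f, fs_mem f -> exists K : R, forall x, cabs (f x) <= K ;
  fs_zero : fs_mem (fun=> 0) ;
  fs_linear : forall (a : R[i]) f g, fs_mem f -> fs_mem g -> fs_mem (fun x => a * f x + g x) ;
  fs_closed : forall f, (forall e : R, 0 < e ->
    exists2 g, fs_mem g & forall x, cabs (f x - g x) <= e) -> fs_mem f
}.

Record fvec (R : realType) (X : Type) (V : fspace R X) := FVec {
  fval :> X -> R[i] ;
  fvalP : fs_mem V fval
}.

Section FunctionSpace.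
Context {R : realType} {X : Type} (V : fspace R X).
Local Notation C := (R[i]).
Local Notation E := (fvec V).
Implicit Types f g : E.

HB.instance Definition _ := gen_eqMixin E.
HB.instance Definition _ := gen_choiceMixin E.

Lemma fvec_ext f g : (forall x, f x = g x) -> f = g.
Proof.
case: f g => [f fP] [g gP] /= fg.
have e : f = g by apply/funext.
by case: _ / e gP => gP; congr FVec; exact: Prop_irrelevance.
Qed.

Definition fzero : E := FVec (fs_zero V).

Lemma fadd_subproof f g : fs_mem V (fun x => f x + g x).
Proof.
have := fs_linear 1 (fvalP f) (fvalP g).
by congr (fs_mem V _); apply/funext => x; rewrite mul1r.
Qed.
Definition fadd f g : E := FVec (fadd_subproof f g).

Lemma fscale_subproof (a : C) f : fs_mem V (fun x => a * f x).
Proof.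
have := fs_linear a (fvalP f) (fs_zero V).
by congr (fs_mem V _); apply/funext => x; rewrite addr0.
Qed.
Definition fscale a f : E := FVec (fscale_subproof a f).
Definition fopp f : E := fscale (-1) f.

Lemma faddA : associative fadd.
Proof. by move=> f g h; apply: fvec_ext => x /=; rewrite addrA. Qed.
Lemma faddC : commutative fadd.
Proof. by move=> f g; apply: fvec_ext => x /=; rewrite addrC. Qed.
Lemma fadd0 : left_id fzero fadd.
Proof. by move=> f; apply: fvec_ext => x /=; rewrite add0r. Qed.
Lemma faddN : left_inverse fzero fopp fadd.
Proof. by move=> f; apply: fvec_ext => x /=; rewrite mulN1r addNr. Qed.
HB.instance Definition _ := GRing.isZmodule.Build E faddA faddC fadd0 faddN.

Lemma fscaleA (a b : C) f : fscale a (fscale b f) = fscale (a * b) f.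
Proof. by apply: fvec_ext => x /=; rewrite mulrA. Qed.
Lemma fscale1 : left_id 1 fscale.
Proof. by move=> f; apply: fvec_ext => x /=; rewrite mul1r. Qed.
Lemma fscaleDr : right_distributive fscale +%R.
Proof. by move=> a f g; apply: fvec_ext => x /=; rewrite mulrDr. Qed.
Lemma fscaleDl f : {morph fscale^~ f : a b / a + b}.
Proof. by move=> a b; apply: fvec_ext => x /=; rewrite mulrDl. Qed.
HB.instance Definition _ := GRing.Zmodule_isLmodule.Build C E fscaleA fscale1 fscaleDr fscaleDl.

(** For empty X this is sup set0 = 0, the right value on the zero space. *)
Definition fnorm f : R := sup [set cabs (f x) | x in setT].

Lemma cabs_fnorm f x : cabs (f x) <= fnorm f.
Proof.
have [K hK] := fs_bounded (fvalP f).
by apply: ub_le_sup; [exists K => _ [y _ <-]; exact: hK|exists x].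
Qed.

Lemma fnorm_le f K : 0 <= K -> (forall x, cabs (f x) <= K) -> fnorm f <= K.
Proof.
move=> K0 H; rewrite /fnorm.
have [->|/set0P ne] := eqVneq [set cabs (f x) | x in setT] set0; first by rewrite sup0.
by apply: ge_sup ne _ => _ [y _ <-].
Qed.

Lemma fnormD f g : (fnorm (f + g))%:C <= (fnorm f)%:C + (fnorm g)%:C :> C.
Proof.
have ge0 h : 0 <= fnorm h.
  have [[x]|nX] := pselect (inhabited X).
    by apply: le_trans (cabs_fnorm h x); exact: cabs_ge0.
  rewrite /fnorm; have -> : [set cabs (h x) | x in setT] = set0; last by rewrite sup0.
  by apply/seteqP; split => // r [x _ _]; apply: nX; exists.
rewrite -rcD lecR; apply: fnorm_le => [|x]; first by rewrite addr_ge0.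
by apply: le_trans (cabsD _ _) _; rewrite lerD// cabs_fnorm.
Qed.

Lemma fnormZ (a : C) f : (fnorm (a *: f))%:C = `|a| * (fnorm f)%:C :> C.
Proof.
rewrite cabsE -rcM; congr (_%:C); rewrite {1}/fnorm.
have -> : [set cabs ((a *: f) x) | x in setT] = [set cabs a * cabs (f x) | x in setT].
  by apply/seteqP; split => _ [x _ <-]; exists x => //; rewrite -cabsM.
have [a0|a0] := eqVneq (cabs a) 0.
  rewrite a0 mul0r.
  have [->|/set0P[y0 [x _ _]]] := eqVneq [set 0 * cabs (f x) | x in setT] set0; first by rewrite sup0.
  have -> : [set 0 * cabs (f x) | x in setT] = [set 0]; last by rewrite sup1.
  apply/seteqP; split => [_ [y _ <-]|r ->]; first by rewrite mul0r.
  by exists x; rewrite ?mul0r.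
have {}a0 : 0 < cabs a by rewrite lt_neqAle cabs_ge0 eq_sym a0.
have [[x0]|nX] := pselect (inhabited X); last first.
  have E0 (h : X -> R) : [set h x | x in setT] = set0.
    by apply/seteqP; split => // r [x _ _]; apply: nX; exists.
  by rewrite /fnorm !E0 !sup0 mulr0.
apply/eqP; rewrite eq_le; apply/andP; split.
  apply: ge_sup; first by exists (cabs a * cabs (f x0)), x0.
  by move=> _ [x _ <-]; rewrite ler_pM2l// cabs_fnorm.
rewrite -ler_pdivlMl//; apply: ge_sup; first by exists (cabs (f x0)), x0.
move=> _ [x _ <-]; rewrite ler_pdivlMl//; apply: ub_le_sup; last by exists x.
exists (cabs a * fnorm f) => _ [y _ <-]; by rewrite ler_pM2l// cabs_fnorm.
Qed.

Lemma fnorm0_eq0 f : (fnorm f)%:C = 0 :> C -> f = 0.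
Proof.
move=> /complexI f0; apply: fvec_ext => x; apply: cabs_eq0.
by apply/eqP; rewrite eq_le cabs_ge0 andbT -f0 cabs_fnorm.
Qed.

HB.instance Definition _ := Lmodule_isNormed.Build C E fnormD fnormZ fnorm0_eq0.

Lemma fvalB f g x : (f - g) x = f x - g x.
Proof. by rewrite /GRing.opp/= mulN1r. Qed.
Lemma fvalD f g x : (f + g) x = f x + g x.
Proof. by []. Qed.
Lemma fvalZ (a : C) f x : (a *: f) x = a * f x.
Proof. by []. Qed.

Lemma cabs_fval f x : cabs (f x) <= nm f.
Proof. exact: cabs_fnorm. Qed.

Lemma nm_fvec_le f (K : R) : 0 <= K -> (forall x, cabs (f x) <= K) -> nm f <= K.
Proof. exact: fnorm_le. Qed.

Lemma cauchy_limit_real (F : set_system E) (FF : ProperFilter F) (p : E -> R) :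
  (forall e : R, 0 < e -> exists r, F [set h | `|p h - r| < e]) ->
  exists l, forall e : R, 0 < e -> F [set h | `|p h - l| < e].
Proof.
move=> H; have /cauchy_cvg : cauchy (p @ F).
  apply: cauchy_exP => e e0; have [r hr] := H e e0; exists r.
  by rewrite /fmapE /=; apply: filterS hr => h /=; rewrite /ball/= distrC.
move=> /cvg_ex[l hl]; exists l => e e0.
move/cvgrPdist_lt: hl => /(_ e e0); apply: filterS => h /=; by rewrite distrC.
Qed.

(** A Cauchy filter converges at every point; uniformity of the Cauchy
    condition makes the pointwise limit a uniform one, so that fs_closed
    applies to it. *)
Lemma fvec_complete (F : set_system E) : ProperFilter F -> cauchy F -> cvg F.
Proof.
move=> FF /cauchyP Fc.
have H (e : R) : 0 < e -> exists g : E, F [set h | nm (h - g) < e].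
  move=> e0; have [g hg] := Fc e%:C ltac:(by rewrite ltcR).
  by exists g; apply: filterS hg => h /ballR; rewrite nmB.
have Hre x : exists l, forall e : R, 0 < e -> F [set h : E | `|complex.Re (h x) - l| < e].
  apply: cauchy_limit_real => e e0; have [g hg] := H e e0; exists (complex.Re (g x)).
  apply: filterS hg => h /=; apply: le_lt_trans.
  rewrite -raddfB; apply: le_trans (Re_cabs _) _.
  by rewrite -fvalB cabs_fval.
have Him x : exists l, forall e : R, 0 < e -> F [set h : E | `|complex.Im (h x) - l| < e].
  apply: cauchy_limit_real => e e0; have [g hg] := H e e0; exists (complex.Im (g x)).
  apply: filterS hg => h /=; apply: le_lt_trans.
  rewrite -raddfB; apply: le_trans (Im_cabs _) _.
  by rewrite -fvalB cabs_fval.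
have [p hp] := choice Hre; have [q hq] := choice Him.
pose f x := p x +i* q x.
have fg (e : R) g : 0 < e -> F [set h | nm (h - g) < e] -> forall x, cabs (f x - g x) <= 4 * e.
  move=> e0 hg x.
  have [h [[/= h1 h2] h3]] := filter_ex (filterI (filterI (hp x e e0) (hq x e e0)) hg).
  have -> : f x - g x = (f x - h x) + (h x - g x) by ring.
  apply: le_trans (cabsD _ _) _.
  have : cabs (h x - g x) <= nm (h - g) by rewrite -fvalB cabs_fval.
  have := cabs_ReIm (f x - h x); rewrite !raddfB /= distrC [ `|q x - _|]distrC.
  move: h1 h2 h3 => /=; lra.
have fP : fs_mem V f.
  apply: fs_closed => e e0; have [|g hg] := H (e / 4); first by rewrite divr_gt0.
  exists g; first exact: fvalP.
  have e40 : 0 < e / 4 by rewrite divr_gt0.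
  by move=> x; apply: le_trans (fg _ _ e40 hg x) _; rewrite mulrC divfK.
apply/cvg_ex; exists (FVec fP : E) => P /nbhsR[e e0 he].
have e80 : 0 < e / 8 by rewrite divr_gt0.
have [g hg] := H (e / 8) e80.
apply: filterS (hg) => h /= hh; apply: he.
have -> : h - FVec fP = (h - g) + (g - FVec fP) by rewrite addrA subrK.
have : nm (g - FVec fP) <= 4 * (e / 8).
  rewrite nmB; apply: nm_fvec_le => [|x]; first by rewrite mulr_ge0// ltW.
  by rewrite fvalB; exact: fg.
by move=> ?; apply: nm_ltD; lra.
Qed.

HB.instance Definition _ := Uniform_isComplete.Build E fvec_complete.

End FunctionSpace.

(** * Holomorphic maps into a function space *)

Section IntoFunctionSpace.
Context {R : realType} {X : Type} {E : normedModType R[i]} {V : fspace R X}.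
Local Notation C := (R[i]).

(** At each x the error of the linear approximation is bounded by
    strict_estimate with a constant that does not depend on x, so that the
    pointwise differentials assemble into a differential for the sup norm. *)
Lemma differentiable_fvec (T : E -> fvec V) (w0 : E) (r B : R) : 0 < r ->
  (forall w, nm (w - w0) < r -> nm (T w) <= B) ->
  (forall w x, nm (w - w0) < r -> differentiable (fun w => T w x : C^o) w) ->
  differentiable T w0.
Proof.
move=> r0 bT dT.
have bh x : bounded_holo (fun w => T w x : C^o) w0 r B.
  split => // w hw; split; first exact: dT.
  exact: le_trans (cabs_fval _ _) (bT w hw).
have ww : nm (w0 - w0) < r by rewrite subrr nm0.
have B0 : 0 <= B := le_trans (nm_ge0 _) (bT w0 ww).
pose D h x : C := 'd (fun w => T w x : C^o) w0 h.
have [K [K0 Q]] : exists K : R, 0 <= K /\ forall h x, nm h < r / 16 ->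
    cabs (T (w0 + h) x - T w0 x - D h x) <= 2 * K * nm h * nm h.
  pose K := 2048 * B / r ^+ 2; exists K.
  split=> [|h x hh]; first by apply: divr_ge0; [apply: mulr_ge0; [exact: ler0n|]|exact: sqr_ge0].
    have [hz|hn] := eqVneq (nm h) 0.
      rewrite (nm_eq0 hz) addr0 subrr /D linear0 subr0 /cabs normr0 nm0 mulr0; exact: lexx.
    have h0 : 0 < nm h by rewrite lt_neqAle nm_ge0 eq_sym hn.
    have d8 : 2 * nm h <= r / 8 by lra.
    have huu : w0 + h - w0 = h by rewrite addrAC subrr add0r.
    have hd : nm (w0 + h - w0) < 2 * nm h by rewrite huu; lra.
    have w0d : nm (w0 - w0) < 2 * nm h by rewrite subrr nm0; lra.
    have := strict_estimate (bh x) d8 hd w0d w0d.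
    rewrite huu -/K => H; apply: le_trans H _.
    by have -> : K * (2 * nm h) * nm h = 2 * K * nm h * nm h by ring.
(* the differential in the direction h is a uniform limit of difference
   quotients *)
have Dmem h : fs_mem V (D h).
  apply: fs_closed => e e0.
  pose t := Num.min (r / 16 / (nm h + 1)) (e / (2 * K * nm h * nm h + 1)).
  have nh := nm_ge0 h.
  have Kh : 0 <= 2 * K * nm h * nm h by rewrite !mulr_ge0.
  have t0 : 0 < t by rewrite lt_min !divr_gt0 ?ltr_wpDl.
  have tC0 : (t%:C : C) != 0 by rewrite -cabs_gt0 cabsR gtr0_norm.
  exists ((t%:C)^-1 *: (T (w0 + t%:C *: h) - T w0)); first exact: fvalP.
  move=> x.
  have th : nm (t%:C *: h) = t * nm h by rewrite nmZ cabsR gtr0_norm.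
  have thr : nm (t%:C *: h) < r / 16.
    rewrite th; have : t * (nm h + 1) <= r / 16 by rewrite -ler_pdivlMr ?ltr_wpDl// ge_min lexx.
    by rewrite mulrDr mulr1; lra.
  have te : t * (2 * K * nm h * nm h) <= e.
    have : t * (2 * K * nm h * nm h + 1) <= e by rewrite -ler_pdivlMr ?ltr_wpDl// ge_min lexx orbT.
    by rewrite mulrDr mulr1; lra.
  rewrite fvalZ fvalB.
  have -> : D h x - t%:C^-1 * (T (w0 + t%:C *: h) x - T w0 x) = - (t%:C^-1 * (T (w0 + t%:C *: h) x - T w0 x - D (t%:C *: h) x)).
    have -> : D (t%:C *: h) x = t%:C * D h x by rewrite /D linearZ.
    by move: (D h x) (T _ x) (T w0 x) => a b c; field.
  rewrite cabsN cabsM cabsV cabsR gtr0_norm//.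
  apply: le_trans (ler_wpM2l _ (Q _ _ thr)) _; first by rewrite invr_ge0 ltW.
  rewrite th; apply: le_trans te; rewrite le_eqVlt; apply/orP; left; apply/eqP.
  by field; rewrite gt_eqF.
(* the pointwise differentials, now as a linear map into the function space *)
pose DF h : fvec V := FVec (Dmem h).
have DFlin : linear DF.
  move=> a u v; apply: fvec_ext => x; rewrite fvalD fvalZ /= /D.
  by rewrite linearD linearZ.
pose L : {linear E -> fvec V} := HB.pack DF (GRing.isLinear.Build _ _ _ _ DF DFlin).
apply: (fun H1 H2 => (@diffR _ _ _ T w0 L (16 * B / r) H1 H2).1).
  move=> h; apply: nm_fvec_le => [|x].
    apply: mulr_ge0; last exact: nm_ge0.
    by apply: divr_ge0; [apply: mulr_ge0; [exact: ler0n|]|exact: ltW].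
  by apply: (diff_bound h (bh x)); rewrite subrr nm0 divr_gt0.
move=> e e0; exists (Num.min (r / 16) (e / (2 * K + 1))).
  by rewrite lt_min !divr_gt0// ltr_wpDl// mulr_ge0.
move=> h; rewrite lt_min => /andP[h1 h2].
apply: nm_fvec_le => [|x]; first by rewrite mulr_ge0 ?nm_ge0// ltW.
rewrite !fvalB; apply: le_trans (Q _ _ h1) _.
apply: ler_wpM2r; first exact: nm_ge0.
have : nm h * (2 * K + 1) <= e by rewrite -ler_pdivlMr ?ltr_wpDl ?mulr_ge0// ltW.
by rewrite mulrDr mulr1 [2 * K * _]mulrC; have := nm_ge0 h; lra.
Qed.

End IntoFunctionSpace.

(** * Maps between row vectors *)

Section RowVectors.
Context {R : realType}.
Local Notation C := (R[i]).

Lemma cabs_coord n (u : 'rV[C]_n) j : cabs (u ord0 j) <= nm u.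
Proof.
rewrite -lecR -cabsE -nmE.
rewrite [leRHS]mx_normE -[leLHS]nngE num_le.
exact: (le_bigmax _ _ (ord0, j)).
Qed.

Lemma nm_rV_le n (u : 'rV[C]_n) (K : R) : 0 <= K -> (forall j, cabs (u ord0 j) <= K) -> nm u <= K.
Proof.
move=> K0 H; rewrite -lecR -nmE.
have [u0|/mx_norm_neq0[[i j] /= E]] := eqVneq (mx_norm u) 0.
  by rewrite [ `|u|]u0 lecR.
by rewrite [ `|u|]E ord1 cabsE lecR.
Qed.

Lemma closed_nm_ball {V : normedModType C} (c : V) (r : R) : closed [set z | nm (z - c) <= r].
Proof.
move=> z hz /=; rewrite leNgt; apply/negP => hr.
have [y [/= h1 h2]] : [set z | nm (z - c) <= r] `&` [set y | nm (y - z) < nm (z - c) - r] !=set0.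
  by apply: hz; apply/nbhsR; exists (nm (z - c) - r) => //; rewrite subr_gt0.
have : nm (z - c) <= nm (z - y) + nm (y - c).
  by apply: le_trans (nmD _ _); rewrite addrA subrK.
by rewrite [nm (z - y)]nmB; lra.
Qed.

Lemma compact_disc (c : C) (r : R) :
  compact ([set z : C^o | cabs (z - c) <= r]).
Proof.
pose f (t : R * R) : C^o := t.1 +i* t.2.
have fc : continuous f.
  move=> t; apply/cvgR => e e0.
  have e20 : 0 < e / 2 by rewrite divr_gt0.
  have : \forall s \near t, `|t.1 - s.1| < e / 2 /\ `|t.2 - s.2| < e / 2.
    apply/nbhs_ballP; exists (e / 2) => // s [] /=; by split.
  apply: filterS => s [h1 h2].
  have := cabs_ReIm (f s - f t); rewrite !raddfB /= distrC [ `|s.2 - _|]distrC nm_cabs; lra.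
have fcl : closed [set z : C^o | cabs (z - c) <= r] := @closed_nm_ball C^o c r.
apply: (subclosed_compact fcl (B := f @` (`[complex.Re c - r, complex.Re c + r]%classic `*` `[complex.Im c - r, complex.Im c + r]%classic))).
  apply: continuous_compact; first exact: continuous_subspaceT.
  by apply: compact_setX; exact: segment_compact.
move=> z /= hz; exists (complex.Re z, complex.Im z) => /=; last by case: (z).
have h1 := le_trans (Re_cabs _) hz; have h2 := le_trans (Im_cabs _) hz.
move: h1 h2; rewrite !raddfB /= !ler_norml !in_itv /= => /andP[? ?] /andP[? ?].
by split; apply/andP; split; lra.
Qed.

Lemma compact_closed_ball n (c : 'rV[C]_n) (r : R) : 0 <= r ->
  @compact ('rV[C]_n : normedModType C) [set u | nm (u - c) <= r].
Proof.
move=> r0.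
have -> : [set u : 'rV[C]_n | nm (u - c) <= r] = [set u : 'rV[C]_n | forall j, [set z : C^o | cabs (z - c ord0 j) <= r] (u ord0 j)].
  apply/seteqP; split => u /=.
    by move=> h j; apply: le_trans h; have := cabs_coord (u - c) j; rewrite !mxE.
  by move=> h; apply: nm_rV_le => // j; rewrite !mxE.
have H := @rV_compact C^o n (fun j => [set z : C^o | cabs (z - c ord0 j) <= r]) (fun j => @compact_disc (c ord0 j) r).
refine H.
Qed.

(** u |-> u - G u + t contracts by a factor 3. Its iterates stay in a closed
    ball, which is compact, and any cluster point of theirs is a fixed point
    because consecutive iterates come together. *)
Lemma contraction_solve n (G : 'rV[C]_n -> 'rV[C]_n) (u0 t : 'rV[C]_n) (r : R) : 0 <= r ->
  (forall u v, nm (u - u0) <= r -> nm (v - u0) <= r ->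
     nm (G u - G v - (u - v)) <= 3^-1 * nm (u - v)) ->
  nm (t - G u0) <= r / 2 -> exists2 u, nm (u - u0) <= r & G u = t.
Proof.
move=> r0 HG ht; pose P u := u - G u + t.
have PP u v : P u - P v = - (G u - G v - (u - v)).
  by apply/rowP => j; rewrite !mxE; ring.
have cP u v : nm (u - u0) <= r -> nm (v - u0) <= r -> nm (P u - P v) <= 3^-1 * nm (u - v).
  by move=> hu hv; rewrite PP nmN HG.
have u0r : nm (u0 - u0) <= r by rewrite subrr nm0.
have P0 : nm (P u0 - u0) <= r / 2 
  by have -> : P u0 - u0 = t - G u0 by apply/rowP => j; rewrite !mxE; ring.
have Pr u : nm (u - u0) <= r -> nm (P u - u0) <= r.
  move=> hu; have -> : P u - u0 = (P u - P u0) + (P u0 - u0) by rewrite addrA subrK.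
  by apply: le_trans (nmD _ _) _; have := cP _ _ hu u0r; lra.
pose U k := iter k P u0.
have Ur k : nm (U k - u0) <= r by elim: k => //= k ih; exact: Pr.
have Us k : nm (U k.+1 - U k) <= 3^-1 ^+ k * r.
  elim: k => [|k ih]; first by rewrite expr0 mul1r /=; lra.
  apply: le_trans (cP _ _ (Ur k.+1) (Ur k)) _.
  by rewrite exprS -mulrA ler_wpM2l.
have [|p [pr pc]] := @compact_closed_ball n u0 r r0 (U @ \oo) _.
  by exists 0%N => // k _; exact: Ur.
exists p => //.
suff Pp : P p = p.
  by have -> : G p = t + p - P p; [apply/rowP => j; rewrite !mxE; ring|rewrite Pp addrK].
apply/eqP; rewrite -subr_eq0; apply/eqP/nm_eq0/eqP; rewrite eq_le nm_ge0 andbT.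
apply/ler_addgt0Pr => e e0; rewrite add0r.
(* far iterates U k are close both to the cluster point p and to U k.+1 *)
have [N hN] : exists N, 3^-1 ^+ N < e / 2 / (r + 1) by apply: pow3_small; rewrite !divr_gt0// ltr_wpDl.
have [q [/= [k [hk hkr]] hq]] : (fun q => exists k, q = U k /\ nm (U k.+1 - U k) <= e / 2) `&` [set q | nm (q - p) < e / 4] !=set0.
  apply: pc; last by apply/nbhsR; exists (e / 4) => //; rewrite divr_gt0.
  exists N => // k /= hk; exists k; split => //; apply: le_trans (Us k) _.
  have : 3^-1 ^+ N * (r + 1) <= e / 2 by rewrite -ler_pdivlMr ?ltr_wpDl// ltW.
  have : 3^-1 ^+ k <= 3^-1 ^+ N :> R by apply: ler_wiXn2l => //; rewrite invf_le1// ler1n.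
  have : 0 <= 3^-1 ^+ k :> R by rewrite exprn_ge0// invr_ge0.
  by nra.
subst q.
have -> : P p - p = (P p - P (U k)) + (P (U k) - U k) + (U k - p) by rewrite !subrKA.
apply: le_trans (nmD _ _) _; apply: le_trans (lerD (nmD _ _) (lexx _)) _.
have := cP _ _ pr (Ur k); rewrite [nm (p - _)]nmB.
move: hkr hq => /=; have := nm_ge0 (U k - p); lra.
Qed.

Lemma diff_comp_linear (E V W : normedModType C) (L : {linear V -> W}) (f : E -> V) w :
  continuous L -> differentiable f w ->
  differentiable (L \o f) w /\ forall h, 'd (L \o f) w h = L ('d f w h).
Proof.
move=> Lc D; have DL : differentiable L (f w) by exact: linear_differentiable.
split; first exact: differentiable_comp.
by move=> h; rewrite (diff_comp D DL) /= (diff_lin _ Lc).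
Qed.

Lemma diff_coord (E : normedModType C) n (f : E -> 'rV[C]_n) w j : differentiable f w ->
  differentiable (fun x => f x ord0 j : C^o) w /\
  forall h, 'd (fun x => f x ord0 j : C^o) w h = 'd f w h ord0 j.
Proof.
move=> D.
pose g (x : 'rV[C]_n) : C^o := x ord0 j.
have glin : linear g by move=> a u v; rewrite /g !mxE.
pose W := 'rV[C]_n : normedModType C; pose Co := C^o : normedModType C.
pose L : {linear W -> Co} := HB.pack g (GRing.isLinear.Build _ _ _ _ g glin).
have Lc : continuous (L : W -> Co).
  exact: (@coord_continuous C 1 n ord0 j).
exact: (@diff_comp_linear E W Co L f w Lc D).
Qed.

Lemma near_bounded_holo (E : normedModType C) n (f : E -> 'rV[C]_n) w0 :
  (\forall w \near w0, differentiable f w) ->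
  exists r B : R, forall j, bounded_holo (fun x => f x ord0 j : C^o) w0 r B.
Proof.
move=> D; have fc := differentiable_continuous (nbhs_singleton D).
have /nbhsR[r r0 hr] : \forall w \near w0, differentiable f w /\ nm (f w - f w0) < 1.
  by apply: filterI D _; move/cvgR: fc; exact.
exists r, (nm (f w0) + 1) => j; split => // w /hr[Dw bw]; split; first exact: (diff_coord j Dw).1.
apply: le_trans (cabs_coord _ _) _.
have -> : f w = f w0 + (f w - f w0) by rewrite addrC subrK.
by apply: le_trans (nmD _ _) _; rewrite lerD2l ltW.
Qed.

(** Strict differentiability, locally uniform in the point v where the
    differential is taken; like every regularity property beyond
    differentiability, it comes from Cauchy's estimate, applied to each
    coordinate. *)
Lemma strict_differentiable (E : normedModType C) n (f : E -> 'rV[C]_n) w0 :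
  (\forall w \near w0, differentiable f w) ->
  forall e : R, 0 < e -> exists2 d : R, 0 < d & forall u u' v,
    nm (u - w0) < d -> nm (u' - w0) < d -> nm (v - w0) < d ->
    nm (f u - f u' - 'd f v (u - u')) <= e * nm (u - u').
Proof.
move=> D e e0; have [r [B H]] := near_bounded_holo D.
have /nbhsR[r1 r10 hr1] := D.
have [n0|n0] := posnP n.
  exists 1 => // u u' v _ _ _; apply: nm_rV_le; first by rewrite mulr_ge0 ?nm_ge0// ltW.
  by move=> j; have := ltn_ord j; rewrite {2}n0.
have [r0 _] := H (Ordinal n0); have B0 := B_ge0 (H (Ordinal n0)).
have [K K0 SE] : exists2 K : R, 0 <= K & forall d j u u' v, d <= r / 8 ->
   nm (u - w0) < d -> nm (u' - w0) < d -> nm (v - w0) < d ->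
   cabs (f u ord0 j - f u' ord0 j - 'd (fun x => f x ord0 j : C^o) v (u - u')) <= K * d * nm (u - u').
  exists (2048 * B / r ^+ 2).
    by apply: divr_ge0; [apply: mulr_ge0; [exact: ler0n|]|exact: sqr_ge0].
  by move=> d j u u' v; exact: (strict_estimate (H j)).
pose d := Num.min r1 (Num.min (r / 8) (e / (K + 1))).
have d0 : 0 < d by rewrite !lt_min r10 !divr_gt0// ltr_wpDl.
have dr1 : d <= r1 by rewrite ge_min lexx.
have dr8 : d <= r / 8 by rewrite !ge_min lexx orbT.
have dK : K * d <= e.
  have : d * (K + 1) <= e by rewrite -ler_pdivlMr ?ltr_wpDl// !ge_min lexx !orbT.
  by rewrite mulrDr mulr1 [K * _]mulrC; lra.
exists d => // u u' v hu hu' hv; apply: nm_rV_le => [|j].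
  by rewrite mulr_ge0 ?nm_ge0// ltW.
have Dv : differentiable f v by apply: hr1; exact: lt_le_trans dr1.
have := SE _ j _ _ _ dr8 hu hu' hv; rewrite (diff_coord j Dv).2 !mxE => h.
by apply: le_trans h _; rewrite ler_wpM2r ?nm_ge0.
Qed.

Lemma continuous_diff (E : normedModType C) n (f : E -> 'rV[C]_n) w0 :
  (\forall w \near w0, differentiable f w) ->
  forall e : R, 0 < e -> exists2 d : R, 0 < d & forall v h,
    nm (v - w0) < d -> nm ('d f v h - 'd f w0 h) <= e * nm h.
Proof.
move=> D e e0; have e20 : 0 < e / 2 by rewrite divr_gt0.
have [d d0 hd] := strict_differentiable D e20.
exists d => // v h hv.
(* both differentials are compared with the same small increment t h *)
pose t : R := d / 2 / (nm h + 1).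
have t0 : 0 < t by rewrite !divr_gt0// ltr_wpDl ?nm_ge0.
have th : nm (t%:C *: h) < d.
  rewrite nmZ cabsR gtr0_norm//.
  have : t * (nm h + 1) = d / 2 by rewrite divfK// gt_eqF// ltr_wpDl ?nm_ge0.
  by rewrite mulrDr mulr1; lra.
have w0d : nm (w0 - w0) < d by rewrite subrr nm0.
have ud : nm (w0 + t%:C *: h - w0) < d by rewrite addrAC subrr add0r.
have h1 := hd _ _ _ ud w0d hv; have h2 := hd _ _ _ ud w0d w0d.
have E1 : w0 + t%:C *: h - w0 = t%:C *: h by rewrite addrAC subrr add0r.
rewrite E1 in h1 h2; rewrite -(ler_pM2l t0).
have tn : nm (t%:C *: h) = t * nm h by rewrite nmZ cabsR gtr0_norm.
have -> : t * nm ('d f v h - 'd f w0 h) = nm (t%:C *: ('d f v h - 'd f w0 h)).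
  by rewrite nmZ cabsR gtr0_norm.
rewrite scalerBr -[_ *: 'd f v h]linearZ_LR -[_ *: 'd f w0 h]linearZ_LR.
rewrite tn in h1 h2; set A := _ - f w0 in h1 h2.
have -> : 'd f v (t%:C *: h) - 'd f w0 (t%:C *: h) = (A - 'd f w0 (t%:C *: h)) - (A - 'd f v (t%:C *: h)).
  by rewrite opprB [RHS]addrC subrKA.
apply: le_trans (nmD _ _) _; rewrite nmN.
have -> : t * (e * nm h) = e / 2 * (t * nm h) + e / 2 * (t * nm h) by field.
by apply: lerD; [exact: h2|exact: h1].
Qed.

End RowVectors.

(** * Charts and the tangent cocycle *)

Section Germs.
Context {R : realType} {V W : normedModType R[i]}.

Lemma near_diff (f g : V -> W) (x : V) : (\forall y \near x, f y = g y) ->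
  differentiable f x -> differentiable g x /\ ('d g x = 'd f x :> (V -> W)).
Proof.
move=> fg D; have [K K0 hK] := diff_bd D.
apply: (@diffR _ _ _ g x ('d f x) K) => // e e0.
have [d d0 hd] := diffRE D e0; have /nbhsR[d' d'0 hd'] := fg.
exists (Num.min d d'); first by rewrite lt_min d0.
move=> h; rewrite lt_min => /andP[h1 h2].
rewrite -(hd' x); last by rewrite subrr nm0.
rewrite -(hd' (x + h)); last by rewrite addrAC subrr add0r.
exact: hd.
Qed.

End Germs.

Lemma near_diff_comp {R : realType} {U V W : normedModType R[i]}
    (f : U -> V) (g : V -> W) (h : U -> W) (x : U) (y : V) :
  f x = y -> (\forall u \near x, g (f u) = h u) ->
  differentiable f x -> differentiable g y ->
  differentiable h x /\ forall t, 'd h x t = 'd g y ('d f x t).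
Proof.
move=> <- N Df Dg; have [Dh E] := near_diff N (differentiable_comp Df Dg).
split; first exact: Dh.
move=> t; apply: etrans (congr1 (fun k : U -> W => k t) E) _.
exact: (congr1 (fun k : U -> W => k t) (diff_comp Df Dg)).
Qed.

Lemma near_diff_id {R : realType} {V : normedModType R[i]} (h : V -> V) (x : V) :
  (\forall u \near x, u = h u) -> forall t, 'd h x t = t.
Proof.
move=> N t; have Di : differentiable (id : V -> V) x by exact: (@ex_diff _ _ _ _ _ _ _ (is_diff_id _)).
by have [_ ->] := near_diff N Di; rewrite diff_val.
Qed.

Section Charts.
Context {R : realType} (M : complex_manifold R).
Local Notation C := R[i].
Local Notation dim := (@Defs.dim R M).
Local Notation transition := (@Defs.transition R M).
Local Notation dom := (Defs.dom (atlas M)).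
Local Notation coord := (Defs.coord (atlas M)).
Local Notation param := (Defs.param (atlas M)).
Local Notation E k := ('rV[C]_(dim k) : normedModType C).
Implicit Types (k l m : chart M) (x y : M).

Lemma near_dom k x : dom k x -> \forall y \near x, dom k y.
Proof. by move=> h; apply: open_nbhs_nbhs; split => //; exact: dom_open. Qed.

Lemma near_img k x : dom k x -> \forall u \near (coord k x : E k), (coord k @` dom k) u.
Proof. by move=> h; apply: open_nbhs_nbhs; split; [exact: (@img_open R M (chart M) _ (atlas M) k)|exists x]. Qed.

Lemma param_coord k x : dom k x -> param k (coord k x) = x.
Proof. exact: coordK. Qed.

Lemma coord_cvg k x : dom k x -> (coord k y : E k) @[y --> x] --> (coord k x : E k).
Proof.
move=> h; have := @Defs.coord_continuous R M (chart M) _ (atlas M) k.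
rewrite continuous_open_subspace; last exact: dom_open.
by apply; rewrite inE.
Qed.

Lemma param_cvg k x : dom k x -> param k u @[u --> (coord k x : E k)] --> x.
Proof.
move=> h; have := @Defs.param_continuous R M (chart M) _ (atlas M) k.
rewrite continuous_open_subspace; last exact: (@img_open R M (chart M) _ (atlas M) k).
move=> /(_ (coord k x)); rewrite inE => /(_ _)/=; rewrite /continuous_at param_coord//; apply.
by exists x.
Qed.

Lemma paramK k u : (coord k @` dom k) u -> dom k (param k u) /\ coord k (param k u) = u.
Proof. by move=> [x hx <-]; rewrite param_coord. Qed.

Lemma near_tau k l x : dom k x -> dom l x ->
  \forall u \near (coord k x : E k), differentiable (coord l \o param k : E k -> E l) u.
Proof.
move=> hk hl.
have h1 : \forall u \near (coord k x : E k), dom l (param k u).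
  by apply: (param_cvg hk); exact: near_dom.
apply: filterS (filterI (near_img hk) h1) => u [hu hlu].
have [hk' E] := paramK hu.
by apply: (@transition_holomorphic R M (chart M) _ (atlas M) k l); exists (param k u).
Qed.

Lemma tau_diff k l x : dom k x -> dom l x ->
  differentiable (coord l \o param k : E k -> E l) (coord k x).
Proof. by move=> hk hl; exact: (nbhs_singleton (near_tau hk hl)). Qed.

Lemma near_param_dom k l x : dom k x -> dom l x ->
  \forall u \near (coord k x : E k), dom k (param k u) /\ dom l (param k u) /\ coord k (param k u) = u.
Proof.
move=> hk hl; have h1 : \forall u \near (coord k x : E k), dom l (param k u).
  by apply: (param_cvg hk); exact: near_dom.
apply: filterS (filterI (near_img hk) h1) => u [hu hlu].
by have [hk' E] := paramK hu.
Qed.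

Lemma transition_cocycle k l m x t : dom k x -> dom l x -> dom m x ->
  transition l m x (transition k l x t) = transition k m x t.
Proof.
move=> hk hl hm; apply/esym.
apply: (near_diff_comp (y := coord l x) _ _ (tau_diff hk hl) (tau_diff hl hm)).2.
  by rewrite /= param_coord.
by apply: filterS (near_param_dom hk hl) => u [h1 [h2 h3]] /=; rewrite param_coord.
Qed.

Lemma transition_id k x t : dom k x -> transition k k x t = t.
Proof.
move=> hk; apply: near_diff_id.
by apply: filterS (near_param_dom hk hk) => u [h1 [h2 h3]].
Qed.

Lemma transitionB k l x t t' :
  transition k l x (t - t') = transition k l x t - transition k l x t'.
Proof. exact: linearB. Qed.

Lemma transition0 k l x : transition k l x 0 = 0.
Proof. exact: linear0. Qed.

Lemma transitionZ k l x (a : C) t : transition k l x (a *: t) = a *: transition k l x t.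
Proof. exact: linearZ_LR. Qed.

Lemma transition_sum k l x (I : finType) (F : I -> 'rV[C]_(dim k)) :
  transition k l x (\sum_i F i) = \sum_i transition k l x (F i).
Proof. exact: linear_sum. Qed.

Lemma transition_bounded k l x : dom k x -> dom l x ->
  exists2 L : R, 0 < L & \forall y \near x, forall t, nm (transition k l y t : E l) <= L * nm (t : E k).
Proof.
(* near x the differentials are within 1 of the one at x *)
move=> hk hl; have [L L0 hL] := diff_bd (tau_diff hk hl).
have [d d0 hd] := continuous_diff (near_tau hk hl) ltr01.
exists (L + 1); first by rewrite addr_gt0.
have : \forall y \near x, nm ((coord k y : E k) - coord k x) < d by move/cvgR: (coord_cvg hk); exact.
apply: filterS => y hy t.
have h : nm ((transition k l y t : E l) - transition k l x t) <= nm (t : E k).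
  by have := hd _ t hy; rewrite mul1r.
rewrite -[transition k l y t](subrK (transition k l x t)) addrC.
by apply: le_trans (nmD _ _) _; rewrite mulrDl mul1r; apply: lerD; [exact: hL|exact: h].
Qed.

(** The vector is handled by a bound for the differentials near x, and the
    base point by the continuity of the differential. *)
Lemma transition_cvg k l x {T} {F : set_system T} {FF : Filter F} (p : T -> M) (v : T -> 'rV[C]_(dim k)) (v0 : 'rV[C]_(dim k)) :
  dom k x -> dom l x -> p @ F --> x -> (v t : E k) @[t --> F] --> (v0 : E k) ->
  (transition k l (p t) (v t) : E l) @[t --> F] --> (transition k l x v0 : E l).
Proof.
move=> hk hl hp /cvgR hv; apply/cvgR => e e0.
have [L L0 hL] := transition_bounded hk hl.
pose e1 := e / 2 / L; pose e2 := e / 2 / (nm (v0 : E k) + 1).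
have e10 : 0 < e1 by rewrite !divr_gt0.
have k0 : 0 < nm (v0 : E k) + 1 by rewrite ltr_wpDl ?nm_ge0.
have e20 : 0 < e2 by rewrite !divr_gt0.
have [d d0 hd] := continuous_diff (near_tau hk hl) e20.
have N : \forall y \near x, nm ((coord k y : E k) - coord k x) < d by move/cvgR: (coord_cvg hk); exact.
have NL : \forall y \near x, nm ((coord k y : E k) - coord k x) < d /\ forall t, nm (transition k l y t : E l) <= L * nm (t : E k).
  exact: filterI N hL.
have N1 : F [set t | _] := hp _ NL.
have N2 : F [set t | nm ((v t : E k) - v0) < e1] := hv _ e10.
suff : F [set t | nm ((transition k l (p t) (v t) : E l) - transition k l x v0) < e] by [].
apply: filterS (filterI N1 N2) => t [/= [h1 h2] h3].
have -> : (transition k l (p t) (v t) : E l) - transition k l x v0 =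
  transition k l (p t) (v t - v0) + (transition k l (p t) v0 - transition k l x v0).
  by rewrite transitionB subrKA.
apply: nm_ltD; have b1 := h2 (v t - v0).
have b3 : nm ((transition k l (p t) v0 : E l) - transition k l x v0) <= e2 * nm (v0 : E k) := hd _ v0 h1.
have b2 : L * nm ((v t : E k) - v0) < e / 2 by move: h3; rewrite ltr_pdivlMr// mulrC.
have b4 : e2 * nm (v0 : E k) <= e / 2.
  rewrite -[leRHS](@divfK _ (nm (v0 : E k) + 1)) ?gt_eqF// -/e2.
  by rewrite ler_wpM2l ?(ltW e20)// lerDl.
apply: le_lt_trans (lerD b1 b3) _; rewrite [ltRHS]splitr; exact: ltr_leD b2 b4.
Qed.

End Charts.

(** * Balls in charts and hat functions *)

Lemma nm_dist {R : realType} {V : normedModType R[i]} (u v : V) :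
  `|nm u - nm v| <= nm (u - v).
Proof.
have h1 : nm u <= nm (u - v) + nm v by rewrite -{1}(subrK v u); exact: nmD.
have h2 : nm v <= nm (u - v) + nm u by rewrite nmB -{1}(subrK u v); exact: nmD.
by rewrite ler_norml; apply/andP; split; lra.
Qed.

Lemma max0_dist {R : realType} (a b : R) : `|Num.max 0 a - Num.max 0 b| <= `|a - b|.
Proof.
rewrite /Num.max; have := ler_norm (a - b); have := ler_norm (b - a); rewrite distrC.
case: (ltP 0 a) => h1; case: (ltP 0 b) => h2 // k1 k2; rewrite ?subrr ?normr0 ?normr_ge0//.
  by rewrite subr0 gtr0_norm//; lra.
by rewrite sub0r normrN gtr0_norm//; lra.
Qed.

Section ChartBalls.
Context {R : realType} (M : complex_manifold R).
Local Notation C := R[i].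
Local Notation dim := (@Defs.dim R M).
Local Notation dom := (Defs.dom (atlas M)).
Local Notation coord := (Defs.coord (atlas M)).
Local Notation param := (Defs.param (atlas M)).
Local Notation E k := ('rV[C]_(dim k) : normedModType C).
Implicit Types (k l m : chart M) (x y : M).

Definition chart_ball k (u : E k) (r : R) : set M :=
  [set y | dom k y /\ nm ((coord k y : E k) - u) < r].
Definition chart_cball k (u : E k) (r : R) : set M :=
  [set y | dom k y /\ nm ((coord k y : E k) - u) <= r].
Definition in_chart k (u : E k) (r : R) :=
  0 < r /\ forall v, nm (v - u) <= r -> (coord k @` dom k) v.

Lemma near_coord k x (d : R) : dom k x -> 0 < d ->
  \forall y \near x, nm ((coord k y : E k) - coord k x) < d.
Proof. by move=> h d0; move/cvgR: (coord_cvg h); exact. Qed.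

Lemma open_chart_ball k (u : E k) r : open (chart_ball u r).
Proof.
rewrite openE => y [hy hr].
have d0 : 0 < r - nm ((coord k y : E k) - u) by rewrite subr_gt0.
have H : \forall z \near y, dom k z /\ nm ((coord k z : E k) - coord k y) < r - nm ((coord k y : E k) - u).
  by apply: filterI; [exact: near_dom|exact: near_coord].
apply: filterS H => z [h1 h2]; split => //.
rewrite -[coord k z](subrK (coord k y)) -addrA; apply: nm_ltD.
by rewrite -ltrBrDr.
Qed.

(** The closed ball of the model is compact, hence so is its image under the
    parametrisation, and M is Hausdorff. If the ball were not contained in the
    image of the chart, its trace on M need not be closed. *)
Lemma closed_chart_cball k (u : E k) r : in_chart u r -> closed (chart_cball u r).
Proof.
move=> [r0 Hr]; apply: compact_closed; first exact: carrier_hausdorff.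
have -> : chart_cball u r = param k @` [set v : E k | nm (v - u) <= r].
  apply/seteqP; split => [y [h1 h2]|y [v hv <-]].
    by exists (coord k y) => //; rewrite param_coord.
  by have [h1 h2] := paramK (Hr v hv); split => //; rewrite h2.
apply: continuous_compact; last by apply: compact_closed_ball; exact: ltW.
have := @Defs.param_continuous R M (chart M) _ (atlas M) k.
by apply: continuous_subspaceW => v hv; exact: Hr.
Qed.

Lemma exists_in_chart k x : dom k x -> exists r, in_chart (coord k x : E k) r.
Proof.
move=> h; have /nbhsR[r r0 hr] := near_img h.
exists (r / 2); split; first by rewrite divr_gt0.
by move=> v hv; apply: hr; apply: le_lt_trans hv _; rewrite ltr_pdivrMr// ltr_pMr// ltr1n.
Qed.

(** A tent over the ball of centre u and radius r; the extension by 0 to all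
    of M is continuous because the closed ball is closed in M. *)
Definition hat k (u : E k) (r : R) (y : M) : R :=
  if `[< dom k y >] then Num.max 0 (r - nm ((coord k y : E k) - u)) else 0.

Lemma hat_ge0 k (u : E k) r y : 0 <= hat u r y.
Proof. by rewrite /hat; case: asboolP => // _; rewrite le_max lexx. Qed.

Lemma hat_gt0 k (u : E k) r y : (0 < hat u r y) <-> chart_ball u r y.
Proof.
rewrite /hat; case: asboolP => hy.
  by rewrite lt_max ltxx /= subr_gt0; split => [|[]].
by rewrite ltxx; split => // -[].
Qed.

Lemma continuous_hat k (u : E k) r : in_chart u r -> continuous (hat u r).
Proof.
move=> Hr y; apply/cvgrPdist_lt => e e0.
have [hy|hy] := pselect (dom k y).
  have H : \forall z \near y, dom k z /\ nm ((coord k z : E k) - coord k y) < e.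
    by apply: filterI; [exact: near_dom|exact: near_coord].
  apply: filterS H => z [h1 h2]; rewrite /hat !asboolT//.
  apply: le_lt_trans (max0_dist _ _) _.
  have -> : r - nm ((coord k y : E k) - u) - (r - nm ((coord k z : E k) - u)) = nm ((coord k z : E k) - u) - nm ((coord k y : E k) - u) by ring.
  apply: le_lt_trans (nm_dist _ _) _.
  by rewrite opprB addrA subrK.
(* outside the chart, hat vanishes near y since the closed ball is closed in
   M *)
have hc : ~ chart_cball u r y by case.
have H : \forall z \near y, ~ chart_cball u r z.
  by apply: open_nbhs_nbhs; split => //; apply: closed_openC; exact: closed_chart_cball.
apply: filterS H => z hz; rewrite /hat [ `[< dom k y >]]asboolF//.
case: asboolP => hz'; last by rewrite subrr normr0.
rewrite max_l ?subrr ?normr0// subr_le0; apply/ltW; rewrite ltNge; apply/negP => h.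
by apply: hz.
Qed.

End ChartBalls.

(** * A local addition from bump functions *)

Lemma cvg_finsum {K : numFieldType} {V : normedModType K} {T : Type} {F : set_system T}
    {FF : Filter F} (I : finType) (f : I -> T -> V) (a : I -> V) :
  (forall i, f i t @[t --> F] --> a i) -> (\sum_i f i t) @[t --> F] --> \sum_i a i.
Proof.
move=> H; elim: (index_enum I) => [|i r ih].
  have -> : (fun t => \sum_(i <- [::]) f i t) = fun=> 0 by apply/funext => t; rewrite big_nil.
  by rewrite big_nil; exact: cvg_cst.
have -> : (fun t => \sum_(j <- i :: r) f j t) = fun t => f i t + \sum_(j <- r) f j t.
  by apply/funext => t; rewrite big_cons.
by rewrite big_cons; apply: cvgD; [exact: H|exact: ih].
Qed.

Lemma differentiable_finsum {R : realType} (U V : normedModType R[i]) (I : finType) (f : I -> U -> V) u :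
  (forall i, differentiable (f i) u) -> differentiable (fun v => \sum_i f i v) u.
Proof.
move=> H; elim: (index_enum I) => [|i r ih].
  have -> : (fun t => \sum_(i <- [::]) f i t) = cst 0 by apply/funext => t; rewrite big_nil.
  exact: differentiable_cst.
have -> : (fun t => \sum_(j <- i :: r) f j t) = f i + (fun t => \sum_(j <- r) f j t).
  by apply/funext => t; rewrite big_cons.
exact: differentiableD.
Qed.

(** The closed sets bsupp contain the supports of the functions beta. They are
    part of the data because terms of sums are discarded near the points
    outside bsupp, where beta vanishes on a whole neighbourhood. *)
Record bumps {R : realType} (M : complex_manifold R) := Bumps {
  bidx : finType ;
  bchart : bidx -> chart M ;
  beta : bidx -> M -> R ;
  bsupp : bidx -> set M ;
  beta_continuous : forall i, continuous (beta i) ;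
  beta_ge0 : forall i x, 0 <= beta i x ;
  beta_supp : forall i x, beta i x != 0 -> bsupp i x ;
  bsupp_closed : forall i, closed (bsupp i) ;
  bsupp_dom : forall i x, bsupp i x -> Defs.dom (atlas M) (bchart i) x
}.

Section LocalAddition.
Context {R : realType} {M : complex_manifold R} (B : bumps M).
Local Notation C := R[i].
Local Notation dim := (@Defs.dim R M).
Local Notation transition := (@Defs.transition R M).
Local Notation dom := (Defs.dom (atlas M)).
Local Notation coord := (Defs.coord (atlas M)).
Local Notation param := (Defs.param (atlas M)).
Local Notation E k := ('rV[C]_(dim k) : normedModType C).
Local Notation kap := (bchart (b := B)).

Implicit Types (k : chart M) (i j l : bidx B) (x y : M).

Definition bsum x : R := \sum_(i : bidx B) beta i x.
Definition weight l x : R := beta l x / bsum x.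

(** The tangent vector from x to y in the chart kap i: the average, with
    weights depending on x, of the differences of the coordinates in the
    charts kap l, carried to kap i by the differential at x. It is holomorphic
    in y and merely continuous in x. *)
Definition xi x y i : E (kap i) :=
  \sum_(l : bidx B) (weight l x)%:C *: transition (kap l) (kap i) x (coord (kap l) y - coord (kap l) x).
(** The factor beta i x lets the component i, which is meaningful for x in the
    chart kap i, vanish continuously before x leaves that chart. *)
Definition theta x y i : E (kap i) := (beta i x)%:C *: xi x y i.

(** The families (beta i x *: v_i) that come from a tangent vector at x with
    coordinates v_i. In this form the compatibility of the coordinates is a
    closed linear condition for all i and j: a component i with beta i x = 0
    is forced to be 0 as soon as some beta j x is not. *)
Definition fib x (w : forall i, E (kap i)) := forall i j,
  (beta j x)%:C *: w i = (beta i x)%:C *: (transition (kap j) (kap i) x (w j) : E (kap i)).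

Lemma rc_eq0 (a : R) : (a%:C == 0 :> C) = (a == 0).
Proof. by apply/eqP/eqP => [/complexI|->]. Qed.

Lemma weight_supp l x : weight l x != 0 -> bsupp l x.
Proof. by rewrite /weight mulf_eq0 negb_or => /andP[/beta_supp]. Qed.

Lemma weight_ge0 l x : 0 <= weight l x.
Proof. by rewrite /weight divr_ge0 ?beta_ge0// sumr_ge0// => i _; exact: beta_ge0. Qed.

Lemma sum_weight x : bsum x != 0 -> \sum_(l : bidx B) weight l x = 1.
Proof. by move=> s0; rewrite /weight -mulr_suml mulfV. Qed.

Lemma bsum_neq0 i x : beta i x != 0 -> bsum x != 0.
Proof.
move=> b0; rewrite gt_eqF// /bsum (bigD1 i)//= ltr_pwDl//.
  by rewrite lt_neqAle eq_sym b0 beta_ge0.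
by rewrite sumr_ge0// => l _; exact: beta_ge0.
Qed.

Lemma theta_fib x y : fib x (theta x y).
Proof.
move=> i j; rewrite /theta.
have [bi|bi] := eqVneq (beta i x) 0; first by rewrite bi !scale0r scaler0.
have [bj|bj] := eqVneq (beta j x) 0.
  by rewrite bj !scale0r transition0 scaler0.
rewrite transitionZ !scalerA mulrC; congr (_ *: _).
rewrite /xi transition_sum; apply: eq_bigr => l _.
have [wl|wl] := eqVneq (weight l x) 0; first by rewrite transitionZ wl !scale0r.
rewrite transitionZ transition_cocycle//; apply: bsupp_dom.
- exact: weight_supp.
- exact: beta_supp.
- exact: beta_supp.
Qed.

(** One component over a chart where beta does not vanish determines the
    tangent vector. *)
Lemma fib_eq x w w' j : fib x w -> fib x w' -> beta j x != 0 -> w j = w' j -> forall i, w i = w' i.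
Proof.
move=> hw hw' bj e i; have b0 : (beta j x)%:C != 0 :> C by rewrite rc_eq0.
by apply: (scalerI b0); rewrite (hw i j) (hw' i j) e.
Qed.

Lemma weight_cvg l x : bsum x != 0 -> ((weight l y)%:C : C^o) @[y --> x] --> ((weight l x)%:C : C^o).
Proof.
move=> s0; have sc : bsum y @[y --> x] --> bsum x.
  by apply: (@cvg_finsum R R^o) => i; exact: beta_continuous.
have H : weight l y @[y --> x] --> weight l x.
  by apply: cvgM; [exact: beta_continuous|exact: cvgV].
apply/cvgR => e e0; move/cvgrPdist_lt: H => /(_ e e0); apply: filterS => y.
by rewrite nm_cabs -rcN -rcD cabsR distrC.
Qed.

Lemma near_beta0 l x : ~ bsupp l x -> \forall z \near x, beta l z = 0.
Proof.
move=> h; have : \forall z \near x, ~ bsupp l z.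
  by apply: open_nbhs_nbhs; split => //; apply: closed_openC; exact: bsupp_closed.
by apply: filterS => z hz; apply/eqP; apply: contrapT => /negP/beta_supp.
Qed.

(** Only the charts whose bsupp contains x are required to contain y: the
    other terms vanish identically for p.1 near x. *)
Lemma xi_cvg x y i : bsum x != 0 -> dom (kap i) x -> (forall l, bsupp l x -> dom (kap l) y) ->
  xi p.1 p.2 i @[p --> (x, y)] --> xi x y i.
Proof.
move=> s0 hi hy; apply: cvg_finsum => l.
have fx : p.1 @[p --> (x, y)] --> x by exact: cvg_fst.
have fy : p.2 @[p --> (x, y)] --> y by exact: cvg_snd.
have [hl|hl] := pselect (bsupp l x).
  apply: (@cvgZ C (E (kap i))).
    exact: (cvg_comp _ _ fx (@weight_cvg l x s0)).
  apply: transition_cvg => //; first exact: bsupp_dom.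
  apply: (@cvgB C (E (kap l))).
    exact: (cvg_comp _ _ fy (coord_cvg (hy l hl))).
  exact: (cvg_comp _ _ fx (coord_cvg (bsupp_dom hl))).
have w0 z : beta l z = 0 -> weight l z = 0 by move=> b0; rewrite /weight b0 mul0r.
have -> : weight l x = 0 by apply: w0; exact: nbhs_singleton (near_beta0 hl).
rewrite scale0r; apply: cvg_near_cst.
have N : \forall p \near (x, y), beta l p.1 = 0 := fx _ (near_beta0 hl).
apply: filterS N => p /= /w0 ->.
by rewrite scale0r.
Qed.

Lemma theta_cvg x y i : bsum x != 0 -> (forall l, bsupp l x -> dom (kap l) y) ->
  theta p.1 p.2 i @[p --> (x, y)] --> theta x y i.
Proof.
move=> s0 hy; have fx : p.1 @[p --> (x, y)] --> x by exact: cvg_fst.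
have [hi|hi] := pselect (bsupp i x).
  apply: (@cvgZ C (E (kap i))); last exact: xi_cvg (bsupp_dom hi) hy.
  apply/cvgR => e e0; have /cvgrPdist_lt := @beta_continuous _ _ B i x.
  move=> /(_ e e0) H.
  have N : \forall p \near (x, y), `|beta i x - beta i p.1| < e := fx _ H.
  apply: filterS N => p /=.
  by rewrite nm_cabs -rcN -rcD cabsR distrC.
rewrite /theta (nbhs_singleton (near_beta0 hi)) scale0r; apply: cvg_near_cst.
have N : \forall p \near (x, y), beta i p.1 = 0 := fx _ (near_beta0 hi).
by apply: filterS N => p /= ->; rewrite scale0r.
Qed.

Lemma xi_diff x y i k : dom (kap i) x -> dom k y -> (forall l, bsupp l x -> dom (kap l) y) ->
  differentiable (fun u : E k => xi x (param k u) i) (coord k y).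
Proof.
move=> hi hk hy; apply: differentiable_finsum => l.
have [hl|hl] := pselect (bsupp l x); last first.
  have -> : weight l x = 0 by rewrite /weight (nbhs_singleton (near_beta0 hl)) mul0r.
  have -> : (fun u : E k => 0%:C *: transition (kap l) (kap i) x (coord (kap l) (param k u) - coord (kap l) x)) = cst 0 :> (E k -> E (kap i)).
    by apply/funext => u; rewrite scale0r.
  exact: differentiable_cst.
apply: (@differentiableZ C (E k) (E (kap i))).
have hl' := bsupp_dom hl.
pose f (u : E k) : E (kap l) := coord (kap l) (param k u) - coord (kap l) x.
have Df : differentiable f (coord k y).
  apply: (@differentiableB C (E k) (E (kap l)) (fun u => coord (kap l) (param k u)) (cst (coord (kap l) x : E (kap l)))).
    exact: (tau_diff hk (hy l hl)).
  exact: differentiable_cst.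
have Lc : continuous ('d (coord (kap i) \o param (kap l) : E (kap l) -> E (kap i)) (coord (kap l) x)).
  exact: diff_continuous (tau_diff hl' hi).
exact: (diff_comp_linear Lc Df).1.
Qed.

Lemma theta_diff x y i k : dom k y -> (forall l, bsupp l x -> dom (kap l) y) ->
  differentiable (fun u : E k => theta x (param k u) i) (coord k y).
Proof.
move=> hk hy; have [hi|hi] := pselect (bsupp i x).
  apply: (@differentiableZ C (E k) (E (kap i))); apply: xi_diff => //; exact: bsupp_dom.
have -> : (fun u : E k => theta x (param k u) i) = cst 0.
  by apply/funext => u; rewrite /theta (nbhs_singleton (near_beta0 hi)) scale0r.
exact: differentiable_cst.
Qed.

End LocalAddition.

(** * Balls on which the local addition is nearly the identity *)

Lemma nm_sum {R : realType} {V : normedModType R[i]} (I : finType) (f : I -> V) :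
  nm (\sum_i f i) <= \sum_i nm (f i).
Proof.
elim/big_ind2 : _ => [|u a v b hu hv|//]; first by rewrite nm0.
by apply: le_trans (nmD _ _) _; exact: lerD.
Qed.

Lemma finite_radius {R : realType} (I : finType) (S : I -> R -> Prop) :
  (forall i d d', d' <= d -> S i d -> S i d') ->
  (forall i, exists2 d, 0 < d & S i d) -> exists2 d, 0 < d & forall i, S i d.
Proof.
move=> mono H.
have /choice[d hd] : forall i, exists d, 0 < d /\ S i d by move=> i; have [d d0 Sd] := H i; exists d.
exists (\big[Num.min/1]_i d i).
  by apply/bigmin_gtP; split => // i _; have [] := hd i.
by move=> i; have [_ Sd] := hd i; apply: mono Sd; exact: bigmin_le.
Qed.

Section NearlyIdentity.
Context {R : realType} {M : complex_manifold R} (B : bumps M).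
Local Notation C := R[i].
Local Notation dim := (@Defs.dim R M).
Local Notation transition := (@Defs.transition R M).
Local Notation dom := (Defs.dom (atlas M)).
Local Notation coord := (Defs.coord (atlas M)).
Local Notation param := (Defs.param (atlas M)).
Local Notation E k := ('rV[C]_(dim k) : normedModType C).
Local Notation kap := (bchart (b := B)).
Implicit Types (k : chart M) (i j l : bidx B) (x y : M).

Lemma near_chart_ball k x (P : set M) : dom k x -> nbhs x P ->
  exists2 d, 0 < d & chart_ball (coord k x : E k) d `<=` P.
Proof.
move=> hk nP; have N : \forall u \near (coord k x : E k), P (param k u) by exact: (param_cvg hk nP).
have /nbhsR[d d0 hd] := N; exists d => // y [hy hyd].
by have := hd _ hyd; rewrite param_coord.
Qed.

Lemma chart_ballW k (u : E k) r r' : r <= r' -> chart_ball u r `<=` chart_ball u r'.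
Proof. by move=> rr y [h1 h2]; split => //; exact: lt_le_trans rr. Qed.

(** The contribution of the chart kap l to the estimate of good_ball: measured
    in kap j, the differences of coordinates in kap l agree with those in kap
    j up to a factor 1/3. *)
Definition xi_good x0 j l (d : R) := forall x, chart_ball (coord (kap j) x0 : E (kap j)) d x ->
  bsupp l x -> chart_ball (coord (kap j) x0 : E (kap j)) d `<=` dom (kap l) /\
  forall y y', chart_ball (coord (kap j) x0 : E (kap j)) d y -> chart_ball (coord (kap j) x0 : E (kap j)) d y' ->
   nm (transition (kap l) (kap j) x (coord (kap l) y - coord (kap l) y'
         - transition (kap j) (kap l) x (coord (kap j) y - coord (kap j) y')) : E (kap j))
   <= 3^-1 * nm (coord (kap j) y - coord (kap j) y' : E (kap j)).

(** If bsupp l contains x0, the transition from kap j to kap l is strictly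
    differentiable at x0, and the factor 1/3 absorbs the norm of the
    transition back. Otherwise bsupp l is avoided near x0. *)
Lemma xi_good_exists x0 j l : dom (kap j) x0 -> exists2 d, 0 < d & xi_good x0 j l d.
Proof.
move=> hj; have [hl|hl] := pselect (bsupp l x0); last first.
  have N : \forall x \near x0, ~ bsupp l x.
    by apply: open_nbhs_nbhs; split => //; apply: closed_openC; exact: bsupp_closed.
  by have [d d0 hd] := near_chart_ball hj N; exists d => // x /hd.
have hl' := bsupp_dom hl.
have [L L0 hL] := transition_bounded hl' hj.
have e0 : 0 < 3^-1 / L by rewrite divr_gt0.
have [d1 d10 hd1] := strict_differentiable (near_tau hj hl') e0.
have N : \forall x \near x0, dom (kap l) x /\ forall t, nm (transition (kap l) (kap j) x t : E (kap j)) <= L * nm (t : E (kap l)).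
  by apply: filterI; [exact: near_dom|exact: hL].
have [d2 d20 hd2] := near_chart_ball hj N.
exists (Num.min d1 d2); first by rewrite lt_min d10.
have le1 : Num.min d1 d2 <= d1 by rewrite ge_min lexx.
have le2 : Num.min d1 d2 <= d2 by rewrite ge_min lexx orbT.
move=> x hx _; split => [y /(chart_ballW le2)/hd2[]//|y y' hy hy'].
have [hx1 hx2] := hd2 x (chart_ballW le2 hx).
apply: le_trans (hx2 _) _.
have [jx b1] := chart_ballW le1 hx; have [jy b2] := chart_ballW le1 hy; have [jy' b3] := chart_ballW le1 hy'.
have := hd1 _ _ _ b2 b3 b1; rewrite /= !param_coord// => H.
apply: le_trans (ler_wpM2l (ltW L0) H) _.
by rewrite mulrA [L * _]mulrC divfK// gt_eqF.
Qed.

(** For x in the ball, xi x is in the chart kap j a perturbation of the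
    identity by a map with Lipschitz constant 1/3, uniformly in x. *)
Definition good_ball (c : M) j (d : R) :=
  let V := chart_ball (coord (kap j) c : E (kap j)) d in
  [/\ in_chart (coord (kap j) c : E (kap j)) d,
    forall x, V x -> beta j x != 0,
    forall x l, V x -> bsupp l x -> V `<=` dom (kap l) &
    forall x y y', V x -> V y -> V y' ->
      nm (xi x y j - xi x y' j - (coord (kap j) y - coord (kap j) y') : E (kap j))
      <= 3^-1 * nm (coord (kap j) y - coord (kap j) y' : E (kap j))].

(** Since the weights add up to 1, xi x differs from the chart kap j by a
    weighted average of the differences controlled by xi_good. *)
Lemma exists_good_ball x0 j : beta j x0 != 0 -> exists d, good_ball x0 j d.
Proof.
move=> bj; have hj : dom (kap j) x0 by apply: bsupp_dom; exact: beta_supp.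
have [d1 [d10 hd1]] := exists_in_chart hj.
have N : \forall x \near x0, beta j x != 0.
  have b0 : 0 < beta j x0 by rewrite lt_neqAle eq_sym bj beta_ge0.
  have /cvgrPdist_lt/(_ _ b0) := @beta_continuous _ _ B j x0.
  apply: filterS => x; rewrite ltr_norml => /andP[_ h]; rewrite gt_eqF//; lra.
have [d2 d20 hd2] := near_chart_ball hj N.
have [||d3 d30 hd3] := finite_radius (S := fun l d => d <= d1 /\ d <= d2 /\ exists2 d', d <= d' & xi_good x0 j l d').
- move=> l d d' dd [h1 [h2 [d'' h3 h4]]]; split; first exact: le_trans h1.
  by split; [exact: le_trans h2|exists d'' => //; exact: le_trans h3].
- move=> l; have [d d0 hd] := xi_good_exists l hj.
  exists (Num.min d (Num.min d1 d2)); first by rewrite !lt_min d0 d10.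
  split; first by rewrite !ge_min lexx !orbT.
  split; first by rewrite !ge_min lexx !orbT.
  by exists d => //; rewrite ge_min lexx.
have [l1 [l2 _]] := hd3 j.
exists d3; split.
- by split => // v hv; apply: hd1; exact: le_trans l1.
- by move=> x /(chart_ballW l2)/hd2.
- move=> x l hx sl; have [_ [_ [d' dd' hd']]] := hd3 l.
  have [h _] := hd' x (chart_ballW dd' hx) sl.
  by move=> y /(chart_ballW dd')/h.
move=> x y y' hx hy hy'.
have bx : beta j x != 0 by apply: hd2; exact: chart_ballW hx.
have hjx : dom (kap j) x by case: hx.
set D := coord (kap j) y - coord (kap j) y'.
have sw : \sum_(l : bidx B) (weight l x)%:C = 1 :> C.
  rewrite -[1]rc1 -(sum_weight (bsum_neq0 bx)).
  by rewrite (raddf_sum (real_complex R)).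
have -> : xi x y j - xi x y' j - D = \sum_(l : bidx B) (weight l x)%:C *:
    (transition (kap l) (kap j) x (coord (kap l) y - coord (kap l) y' - transition (kap j) (kap l) x D)).
  rewrite -[D in LHS]scale1r -sw scaler_suml /xi -!sumrB; apply: eq_bigr => l _.
  have [->|wl] := eqVneq (weight l x) 0; first by rewrite !scale0r !subr0.
  have hlx : dom (kap l) x by apply: bsupp_dom; exact: weight_supp.
  rewrite -!scalerBr; congr (_ *: _).
  rewrite -transitionB opprB addrA subrK [in RHS]transitionB transition_cocycle// transition_id//.
apply: le_trans (nm_sum _) _.
apply: (@le_trans _ _ (\sum_(l : bidx B) weight l x * (3^-1 * nm (D : E (kap j))))); last first.
  by rewrite -mulr_suml sum_weight ?mul1r//; exact: bsum_neq0 bx.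
apply: ler_sum => l _; rewrite nmZ cabsR ger0_norm ?weight_ge0//.
have [->|wl] := eqVneq (weight l x) 0; first by rewrite !mul0r.
apply: ler_wpM2l; first exact: weight_ge0.
have [_ [_ [d' dd' hd']]] := hd3 l.
have [_ h] := hd' x (chart_ballW dd' hx) (weight_supp wl).
by apply: h; exact: chart_ballW dd' _ _.
Qed.

End NearlyIdentity.

(** * Differentiability of a continuous local inverse *)

Section InverseDiff.
Context {R : realType}.
Local Notation C := R[i].
Local Notation V n := ('rV[C]_n : normedModType C).

(** D is injective since it does not shrink vectors by more than a factor 2,
    hence bijective by a count of dimensions. *)
Lemma near_id_invertible n (D : {linear 'rV[C]_n -> 'rV[C]_n}) :
  (forall t, nm (D t - t) <= 2^-1 * nm t) ->
  exists L : 'M[C]_n, (forall t, D t *m L = t) /\ (forall t : 'rV[C]_n, nm (t *m L) <= 2 * nm t).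
Proof.
move=> HD; have lb t : nm t <= 2 * nm (D t).
  have : nm t <= nm (D t) + nm (D t - t).
    by rewrite [nm (D t - t)]nmB -{1}(subrK (D t) t) addrC; exact: nmD.
  by have := HD t; lra.
have Du : lin1_mx D \in unitmx.
  rewrite -row_free_unit; apply: inj_row_free => v; rewrite mul_rV_lin1 => Dv.
  apply: nm_eq0; apply/eqP; rewrite eq_le nm_ge0 andbT.
  by apply: le_trans (lb v) _; rewrite Dv nm0 mulr0.
exists (invmx (lin1_mx D)); split => t; first by rewrite -mul_rV_lin1 mulmxK.
by apply: le_trans (lb _) _; rewrite -mul_rV_lin1 mulmxKV.
Qed.

(** If H is nearly the identity and u solves H (u w) = Lam w, then u is
    Lipschitz at w0, and the first-order expansion of H can be solved for u. *)
Lemma inverse_diff (E : normedModType C) n (H : V n -> V n) (u : E -> V n)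
    (Lam : {linear E -> V n}) (K rho : R) (w0 : E) :
  (forall h, nm (Lam h) <= K * nm h) ->
  (\forall w \near w0, H (u w) = Lam w) ->
  u w @[w --> w0] --> u w0 ->
  differentiable H (u w0) -> 0 < rho ->
  (forall v, nm (v - u w0) < rho ->
    nm (H v - H (u w0) - (v - u w0)) <= 3^-1 * nm (v - u w0)) ->
  differentiable u w0.
Proof.
move=> bL HL uc DH r0 Hr.
have K0' : 0 <= `|K| by [].
(* the estimate for H at scale s t, with an error 1/6 so that 1/3 + 1/6 = 1/2 *)
have DI t : nm ('d H (u w0) t - t) <= 2^-1 * nm t.
  have e60 : 0 < 6^-1 :> R by rewrite invr_gt0.
  have [d d0 hd] := diffRE DH e60.
  pose s : R := Num.min d rho / 2 / (nm t + 1).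
  have m0 : 0 < Num.min d rho by rewrite lt_min d0.
  have t1 : 0 < nm t + 1 by rewrite ltr_wpDl ?nm_ge0.
  have s0 : 0 < s by rewrite !divr_gt0.
  have ns (v : 'rV[C]_n) : nm (s%:C *: v) = s * nm v by rewrite nmZ cabsR gtr0_norm.
  have st : nm (s%:C *: t) < Num.min d rho.
    rewrite ns; have : s * (nm t + 1) = Num.min d rho / 2 by rewrite divfK// gt_eqF.
    by rewrite mulrDr mulr1; move: m0; set m := Num.min d rho; lra.
  move: st; rewrite lt_min => /andP[st1 st2].
  have h1 := hd _ st1.
  have E1 : u w0 + s%:C *: t - u w0 = s%:C *: t by rewrite addrAC subrr add0r.
  have h2 := Hr (u w0 + s%:C *: t); rewrite E1 in h2; move/(_ st2) in h2.
  rewrite -(ler_pM2l s0) -ns scalerBr -[_ *: 'd H _ t]linearZ_LR.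
  rewrite ns in h1 h2; set A := H _ - H _ in h1 h2.
  have -> : 'd H (u w0) (s%:C *: t) - s%:C *: t = (A - s%:C *: t) - (A - 'd H (u w0) (s%:C *: t)).
    by rewrite opprB [RHS]addrC subrKA.
  apply: le_trans (nmD _ _) _; rewrite nmN.
  have -> : s * (2^-1 * nm t) = 3^-1 * (s * nm t) + 6^-1 * (s * nm t) by field.
  by apply: lerD; [exact: h2|exact: h1].
have [L [LD bLL]] := near_id_invertible DI.
pose D' (h : E) : V n := Lam h *m L.
have D'lin : linear D' by move=> a x y; rewrite /D' linearP mulmxDl -scalemxAl.
pose LL : {linear E -> V n} := HB.pack D' (GRing.isLinear.Build _ _ _ _ D' D'lin).
apply: (fun H1 H2 => (@diffR _ E (V n) u w0 LL (2 * `|K|) H1 H2).1).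
  move=> h; apply: le_trans (bLL _) _; rewrite -mulrA ler_pM2l//.
  by apply: le_trans (bL h) _; rewrite ler_wpM2r ?nm_ge0// ler_norm.
move=> e e0; pose e' := e / (3 * `|K| + 1).
have e'0 : 0 < e' by rewrite divr_gt0// ltr_wpDl// mulr_ge0.
have [d d0 hd] := diffRE DH e'0.
have N : \forall w \near w0, H (u w) = Lam w /\ nm (u w - u w0) < Num.min d rho.
  by apply: filterI => //; move/cvgR: uc; apply; rewrite lt_min d0.
have Hw0 := nbhs_singleton HL.
have /nbhsR[d' d'0 hd'] := N; exists d' => // h hh.
have [|Hh] := hd' (w0 + h); first by rewrite addrAC subrr add0r.
rewrite lt_min => /andP[b1 b2].
set dl := u (w0 + h) - u w0 in b1 b2 *.
have ud : u w0 + dl = u (w0 + h) by rewrite /dl addrC subrK.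
have HE : H (u (w0 + h)) - H (u w0) = Lam h by rewrite Hh Hw0 linearD addrAC subrr add0r.
(* from nm (Lam h - dl) <= 1/3 nm dl *)
have ldl : nm dl <= 3 / 2 * (`|K| * nm h).
  have h2 := Hr _ b2; rewrite HE -/dl in h2.
  have h3 : nm dl <= nm (Lam h) + nm (Lam h - dl).
    by rewrite [nm (Lam h - dl)]nmB -{1}(subrK (Lam h) dl) addrC; exact: nmD.
  have h4 : nm (Lam h) <= `|K| * nm h.
    by apply: le_trans (bL h) _; rewrite ler_wpM2r ?nm_ge0// ler_norm.
  by lra.
have h1 := hd _ b1; rewrite ud HE in h1.
have -> : dl - LL h = - ((Lam h - 'd H (u w0) dl) *m L).
  by rewrite mulmxBl LD opprB.
rewrite nmN; apply: le_trans (bLL _) _.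
apply: (@le_trans _ _ (2 * (e' * (3 / 2 * (`|K| * nm h))))).
  rewrite ler_pM2l//; apply: le_trans h1 _; rewrite ler_wpM2l//; exact: ltW.
have -> : 2 * (e' * (3 / 2 * (`|K| * nm h))) = e' * (3 * `|K|) * nm h by field.
rewrite ler_wpM2r ?nm_ge0//.
have : e' * (3 * `|K| + 1) = e by rewrite divfK// gt_eqF// ltr_wpDl// mulr_ge0.
by rewrite mulrDr mulr1; lra.
Qed.

End InverseDiff.

(** * Inverting the local addition *)

Section GoodBall.
Context {R : realType} {M : complex_manifold R} (B : bumps M).
Local Notation C := R[i].
Local Notation dim := (@Defs.dim R M).
Local Notation dom := (Defs.dom (atlas M)).
Local Notation coord := (Defs.coord (atlas M)).
Local Notation param := (Defs.param (atlas M)).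
Local Notation E k := ('rV[C]_(dim k) : normedModType C).
Local Notation kap := (bchart (b := B)).
Implicit Types (k : chart M) (i j l : bidx B) (x y : M).

Section Ball.
Variables (c : M) (j : bidx B) (d : R).
Hypothesis G : good_ball c j d.
Local Notation V := (chart_ball (coord (kap j) c : E (kap j)) d).
Local Notation k := (kap j).

Lemma xi_inj x y y' : V x -> V y -> V y' -> xi x y j = xi x y' j -> y = y'.
Proof.
have [_ _ _ H] := G; move=> hx hy hy' e.
have := H _ _ _ hx hy hy'; rewrite e subrr sub0r nmN => h.
have n0 : nm (coord k y - coord k y' : E k) = 0.
  by apply/eqP; rewrite eq_le nm_ge0 andbT; have := nm_ge0 (coord k y - coord k y' : E k); lra.
have [hdy _] := hy; have [hdy' _] := hy'.
by rewrite -(param_coord hdy) -(param_coord hdy'); congr param; apply/eqP; rewrite -subr_eq0; apply/eqP/nm_eq0.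
Qed.

Lemma theta_inj x y y' : V x -> V y -> V y' -> theta x y j = theta x y' j -> y = y'.
Proof.
move=> hx hy hy' e; apply: (xi_inj hx hy hy').
have [_ hb _ _] := G; have b0 : (beta j x)%:C != 0 :> C by rewrite rc_eq0 hb.
exact: (scalerI b0).
Qed.

(** The contraction argument of contraction_solve in the chart kap j. The
    tolerance e works for all x near x0: this uniformity is what makes the
    solutions depend continuously on x. *)
Lemma theta_open x0 y0 (W : set M) : V x0 -> V y0 -> nbhs y0 W ->
  exists2 e : R, 0 < e & \forall x \near x0, forall w, fib x w ->
    nm (w j - theta x0 y0 j : E k) < e ->
    exists y, [/\ W y, V y & forall i, theta x y i = w i].
Proof.
have [Hin hb hdom H] := G; move=> hx0 hy0 nW.
have [hdy _] := hy0; have [hdx _] := hx0.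
have nWV : nbhs y0 (W `&` V).
  apply: filterI => //; apply: open_nbhs_nbhs; split => //; exact: open_chart_ball.
have [r r0 hr] := near_chart_ball hdy nWV.
have /nbhsR[r' r'0 hr'] := near_img hdy.
pose rho := Num.min r r' / 2.
have m0 : 0 < Num.min r r' by rewrite lt_min r0.
have rho0 : 0 < rho by rewrite divr_gt0.
have rhom : rho < Num.min r r' by rewrite /rho; move: m0; set m := Num.min _ _; lra.
have inW u : nm (u - (coord k y0 : E k)) <= rho -> [/\ W (param k u), V (param k u) & coord k (param k u) = u].
  move=> hu; have : nm (u - (coord k y0 : E k)) < Num.min r r' by exact: le_lt_trans hu rhom.
  rewrite lt_min => /andP[h1 h2]; have [h3 h4] := paramK (hr' _ h2).
  have [] : (W `&` V) (param k u); last by [].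
  by apply: hr; split => //; rewrite h4.
have b0 : 0 < beta j x0 by rewrite lt_neqAle eq_sym hb// beta_ge0.
pose e := beta j x0 / 2 * rho / 4.
have e0 : 0 < e by rewrite !divr_gt0// mulr_gt0// divr_gt0.
exists e => //.
have s0 : bsum B x0 != 0 by apply: bsum_neq0; exact: hb _ hx0.
have hcov l : bsupp l x0 -> dom (kap l) y0 by move=> hl; exact: (hdom x0 l hx0 hl y0 hy0).
have N1 : \forall x \near x0, nm (theta x y0 j - theta x0 y0 j : E k) < e.
  have /cvgR/(_ e e0) := @theta_cvg R M B x0 y0 j s0 hcov.
  move=> [[P1 P2] /= [n1 n2] h]; apply: filterS n1 => x hx.
  by apply: (h (x, y0)); split => //; exact: nbhs_singleton.
have N2 : \forall x \near x0, beta j x0 / 2 < beta j x.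
  have b20 : 0 < beta j x0 / 2 by rewrite divr_gt0.
  have /cvgrPdist_lt/(_ _ b20) := @beta_continuous _ _ B j x0.
  by apply: filterS => x; rewrite ltr_norml => /andP[h1 h2]; lra.
have N3 : \forall x \near x0, V x by apply: open_nbhs_nbhs; split => //; exact: open_chart_ball.
apply: filterS (filterI (filterI N1 N2) N3) => x [[h1 h2] hx] w hw hwe.
have bx : 0 < beta j x by apply: lt_trans h2; rewrite divr_gt0.
have bxC : (beta j x)%:C != 0 :> C by rewrite rc_eq0 gt_eqF.
(* solving theta for the component j amounts to solving xi for t *)
pose t : E k := (beta j x)%:C^-1 *: w j.
have tt : nm (t - xi x (param k (coord k y0)) j) <= rho / 2.
  rewrite param_coord//.
  have -> : t - xi x y0 j = (beta j x)%:C^-1 *: (w j - theta x y0 j).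
    by rewrite scalerBr /theta scalerA mulVf// scale1r.
  rewrite nmZ cabsV cabsR gtr0_norm// ler_pdivrMl//.
  apply: (@le_trans _ _ (beta j x0 / 2 * (rho / 2))); last by apply: ler_wpM2r; [rewrite divr_ge0// ltW|exact: ltW].
  have -> : w j - theta x y0 j = (w j - theta x0 y0 j) - (theta x y0 j - theta x0 y0 j).
    by rewrite opprB subrKA.
  apply: le_trans (nmD _ _) _; rewrite nmN.
  have -> : beta j x0 / 2 * (rho / 2) = e + e by rewrite /e; field.
  by apply: lerD; exact: ltW.
have [|u hu Gu] := @contraction_solve R (dim k) (fun u => xi x (param k u) j) (coord k y0) t rho (ltW rho0) _ tt.
  move=> u v hu hv; have [_ V1 E1] := inW _ hu; have [_ V2 E2] := inW _ hv.
  by have := H _ _ _ hx V1 V2; rewrite E1 E2.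
have [Wy Vy Ey] := inW _ hu; exists (param k u); split => //.
(* the other components follow from the component j *)
apply: (fib_eq (j := j) (theta_fib _ _) hw); first by rewrite gt_eqF.
by rewrite /theta Gu /t scalerA mulfV// scale1r.
Qed.

(** A family g w of points found by solving theta x (g w) = w depends
    holomorphically on w, since in the chart kap j it is a continuous local
    inverse of xi x up to the factor beta j x. *)
Lemma inverse_theta_diff (F : normedModType C) (g : F -> M) (x : M) (w0 : F)
    (wj : {linear F -> E k}) (K : R) :
  V x -> V (g w0) -> (forall h, nm (wj h) <= K * nm h) ->
  g w @[w --> w0] --> g w0 ->
  (\forall w \near w0, theta x (g w) j = wj w) ->
  differentiable (fun w => coord k (g w) : E k) w0.
Proof.
have [Hin hb hdom H] := G; move=> hx hy bw gc HT.
have [hdy _] := hy; have [hdx _] := hx.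
have bx : beta j x != 0 by exact: hb.
have bxC : (beta j x)%:C != 0 :> C by rewrite rc_eq0.
pose L' h : E k := (beta j x)%:C^-1 *: wj h.
have Llin : linear L' by move=> a u v; rewrite /L' linearP scalerDr !scalerA mulrC.
pose L : {linear F -> E k} := HB.pack L' (GRing.isLinear.Build _ _ _ _ L' Llin).
have cg : (coord k (g w) : E k) @[w --> w0] --> (coord k (g w0) : E k).
  exact: (cvg_comp _ _ gc (coord_cvg hdy)).
have VN : \forall y \near g w0, V y by apply: open_nbhs_nbhs; split => //; exact: open_chart_ball.
have [r r0 hr] := near_chart_ball hdy VN.
have /nbhsR[r' r'0 hr'] := near_img hdy.
apply: (@inverse_diff _ F _ (fun u => xi x (param k u) j) (fun w => coord k (g w)) L (cabs (beta j x)%:C^-1 * K) (Num.min r r') w0).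
- by move=> h; rewrite nmZ -mulrA ler_wpM2l// cabs_ge0.
- have gdom : \forall w \near w0, dom k (g w) by exact: gc (near_dom hdy).
  apply: filterS (filterI HT gdom) => w [h1 h2]; rewrite param_coord//= /L' -h1.
  by rewrite /theta scalerA mulVf// scale1r.
- exact: cg.
- by apply: (xi_diff hdx hdy) => l hl; exact: (hdom x l hx hl _ hy).
- by rewrite lt_min r0.
- move=> v; rewrite lt_min => /andP[h1 h2]; have [h3 h4] := paramK (hr' _ h2).
  have Vv : V (param k v) by apply: hr; split => //; rewrite h4.
  by have := H _ _ _ hx Vv hy; rewrite h4 param_coord.
Qed.

End Ball.
End GoodBall.

(** * Tubes around a map from a compact space *)

(** Compactness in terms of chosen neighbourhoods, with a finite type of
    indices over which minima and sums can be taken. *)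
Lemma finite_subcover (T : topologicalType) (K : set T) (P : T -> set T) :
  compact K -> (forall a, K a -> nbhs a (P a)) ->
  exists (I : finType) (p : I -> T), (forall i, K (p i)) /\ forall a, K a -> exists i, P (p i) a.
Proof.
move=> cK HP; have [->|/set0P[a0 _]] := eqVneq K set0.
  by exists (void : finType), (@of_void T); split => // -[].
pose pT : ptopologicalType := HB.pack T (isPointed.Build T a0).
have /= cK' : @compact pT K by exact: cK.
rewrite compact_cover in cK'.
have [||D' D'K cov] := cK' T K (fun a => (P a)°).
- by move=> a _; exact: open_interior.
- by move=> a Ka; exists a => //; exact: HP.
exists (fset_sub_type D' : finType), (fun i => fsval i); split => [i|a Ka].
  by have := D'K _ (fsvalP i); rewrite inE.
have [b /= hb hab] := cov a Ka.
exists (FSetSub hb) => /=; exact: interior_subset.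
Qed.

Section Tubes.
Context {R : realType} (M : complex_manifold R) (A : topologicalType).
Hypothesis cptA : compact (@setT A).
Local Notation C := R[i].
Local Notation dim := (@Defs.dim R M).
Local Notation dom := (Defs.dom (atlas M)).
Local Notation coord := (Defs.coord (atlas M)).
Local Notation E k := ('rV[C]_(dim k) : normedModType C).
Local Notation kap := (bchart (b := _)).

Lemma bumps_exist (f : A -> M) : continuous f ->
  exists B : bumps M, forall a, exists i : bidx B, beta i (f a) != 0.
Proof.
move=> fc.
have /choice[kr hkr] : forall x : M, exists kr : chart M * R,
    dom kr.1 x /\ in_chart (coord kr.1 x : E kr.1) kr.2.
  move=> x; have [k hk] := @dom_cover R M (chart M) _ (atlas M) x.
  by have [r hr] := exists_in_chart hk; exists (k, r).
pose V (x : M) := chart_ball (coord (kr x).1 x : E (kr x).1) (kr x).2.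
have [|I [p [_ hp]]] := @finite_subcover A setT (fun a => f @^-1` V (f a)) cptA.
  move=> a _; apply: fc; apply: open_nbhs_nbhs; split; first exact: open_chart_ball.
  by have [h [r0 _]] := hkr (f a); split => //; rewrite subrr nm0.
pose be (i : I) := hat (coord (kr (f (p i))).1 (f (p i)) : E (kr (f (p i))).1) (kr (f (p i))).2.
pose su (i : I) := chart_cball (coord (kr (f (p i))).1 (f (p i)) : E (kr (f (p i))).1) (kr (f (p i))).2.
have bc i : continuous (be i) by apply: continuous_hat; have [] := hkr (f (p i)).
have b0 i x : 0 <= be i x by exact: hat_ge0.
have bs i x : be i x != 0 -> su i x.
  move=> h; have /hat_gt0[h1 h2] : 0 < be i x by rewrite lt_neqAle eq_sym h b0.
  by split => //; exact: ltW.
have sc i : closed (su i) by apply: closed_chart_cball; have [] := hkr (f (p i)).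
have sd i x : su i x -> dom (kr (f (p i))).1 x by case.
exists (@Bumps R M I (fun i => (kr (f (p i))).1) be su bc b0 bs sc sd) => a.
have [i hi] := hp a Logic.I; exists i => /=.
by rewrite gt_eqF//; apply/hat_gt0.
Qed.

(** Finitely many good balls such that the balls of half the radius cover the
    image of f; the distance between the two radii leaves room for maps close
    to f. *)
Record tube (f : A -> M) := Tube {
  tbumps : bumps M ;
  tidx : finType ;
  tcenter : tidx -> M ;
  tchart : tidx -> bidx tbumps ;
  tradius : tidx -> R ;
  tube_good : forall i, good_ball (tcenter i) (tchart i) (tradius i) ;
  tube_cover : forall a, exists i,
    chart_cball (coord (kap (tchart i)) (tcenter i) : E (kap (tchart i))) (tradius i / 2) (f a)
}.

Lemma tube_exists (f : A -> M) : continuous f -> inhabited (tube f).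
Proof.
move=> fc; have [B hB] := bumps_exist fc.
have /choice[jd hjd] : forall a : A, exists jd : bidx B * R,
    dom (kap jd.1) (f a) /\ good_ball (f a) jd.1 jd.2.
  move=> a; have [j hj] := hB a; have [d hd] := exists_good_ball hj.
  by exists (j, d); split => //; apply: bsupp_dom; exact: beta_supp.
pose V (a : A) := chart_ball (coord (kap (jd a).1) (f a) : E (kap (jd a).1)) ((jd a).2 / 2).
have [|I [p [_ hp]]] := @finite_subcover A setT (fun a => f @^-1` V a) cptA.
  move=> a _; apply: fc; apply: open_nbhs_nbhs; split; first exact: open_chart_ball.
  have [h [[r0 _] _ _ _]] := hjd a.
  by split => //; rewrite subrr nm0 divr_gt0.
constructor; apply: (@Tube f B I (fun i => f (p i)) (fun i => (jd (p i)).1) (fun i => (jd (p i)).2)).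
  by move=> i; have [] := hjd (p i).
move=> a; have [i [h1 h2]] := hp a Logic.I; exists i; split => //; exact: ltW.
Qed.

End Tubes.

(** * Sections along a map *)

(** Linear maps out of a space of row vectors are bounded. The differential of
    a transition is thus bounded even at points where nothing is known about
    it. *)
Lemma lin_rV_bd {R : realType} {V : normedModType R[i]} n (D : {linear 'rV[R[i]]_n -> V}) :
  exists2 K : R, 0 <= K & forall t, nm (D t) <= K * nm t.
Proof.
exists (\sum_j nm (D (delta_mx ord0 j))); first by apply: sumr_ge0 => j _; exact: nm_ge0.
move=> t; rewrite {1}(row_sum_delta t) linear_sum mulr_suml.
apply: le_trans (nm_sum _) _; apply: ler_sum => j _.
by rewrite linearZ_LR nmZ mulrC ler_wpM2l ?nm_ge0// cabs_coord.
Qed.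

Section Tube.
Context {R : realType} {M : complex_manifold R} {A : topologicalType}.
Variables (f : A -> M) (T : tube f).
Hypothesis fc : continuous f.
Local Notation C := R[i].
Local Notation dim := (@Defs.dim R M).
Local Notation transition := (@Defs.transition R M).
Local Notation dom := (Defs.dom (atlas M)).
Local Notation coord := (Defs.coord (atlas M)).
Local Notation param := (Defs.param (atlas M)).
Local Notation E k := ('rV[C]_(dim k) : normedModType C).
Local Notation kap := (bchart (b := tbumps T)).
Local Notation B := (tbumps T).
Implicit Types (a : A) (y : M).

Definition small_ball (i : tidx T) : set M :=
  chart_cball (coord (kap (tchart i)) (tcenter i) : E (kap (tchart i))) (tradius i / 2).
Definition large_ball (i : tidx T) : set M :=
  chart_ball (coord (kap (tchart i)) (tcenter i) : E (kap (tchart i))) (tradius i).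
(** y may serve as the value at a of a map in the tube. Since the small balls
    are closed and the large ones open, the condition persists under small
    changes of a and y. *)
Definition admissible a y := forall i, small_ball i (f a) -> large_ball i y.

Lemma closed_small_ball i : closed (small_ball i).
Proof.
have [[r0 hr] _ _ _] := tube_good i.
apply: closed_chart_cball; split; first by rewrite divr_gt0.
by move=> v hv; apply: hr; apply: le_trans hv _; lra.
Qed.

Lemma open_large_ball i : open (large_ball i).
Proof. exact: open_chart_ball. Qed.

Lemma small_large i : small_ball i `<=` large_ball i.
Proof.
have [[r0 hr] _ _ _] := tube_good i.
by move=> y [h1 h2]; split => //; apply: le_lt_trans h2 _; lra.
Qed.

Lemma admissible_refl a : admissible a (f a).
Proof. by move=> i; exact: small_large. Qed.

Lemma admissible_ball a y : admissible a y -> exists i, large_ball i (f a) /\ large_ball i y.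
Proof.
by move=> h; have [i hi] := tube_cover T a; exists i; split; [exact: small_large|exact: h].
Qed.

Lemma admissible_covered a y : admissible a y -> forall l : bidx B, bsupp l (f a) -> dom (kap l) y.
Proof.
move=> /admissible_ball[i [h1 h2]] l hl; have [_ _ H _] := tube_good i.
exact: (H _ _ h1 hl _ h2).
Qed.

Lemma bsum_tube a : bsum B (f a) != 0.
Proof.
have [i [h1 _]] := admissible_ball (@admissible_refl a); have [_ H _ _] := tube_good i.
exact: bsum_neq0 (H _ h1).
Qed.

Lemma admissible_inj a y y' : admissible a y -> admissible a y' ->
  (forall i : bidx B, theta (f a) y i = theta (f a) y' i) -> y = y'.
Proof.
have [i hi] := tube_cover T a; move=> h h' e.
exact: (theta_inj (tube_good i) (small_large hi) (h i hi) (h' i hi) (e _)).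
Qed.

(** When a moves slightly, f a may leave small balls but enters no new one. *)
Lemma near_admissible a y : admissible a y ->
  exists2 W : set M, nbhs y W & \forall a' \near a, forall y', W y' -> admissible a' y'.
Proof.
move=> h.
exists [set y' | forall i, small_ball i (f a) -> large_ball i y'].
  apply: filter_forall => i.
  have [hi|hi] := pselect (small_ball i (f a)).
    have : nbhs y (large_ball i) by apply: open_nbhs_nbhs; split; [exact: open_large_ball|exact: h].
    by apply: filterS => y' hy' _.
  by apply: filterS filterT => y' _ /hi.
have : \forall a' \near a, forall i, small_ball i (f a') -> small_ball i (f a).
  apply: filter_forall => i.
  have [hi|hi] := pselect (small_ball i (f a)); first by apply: filterS filterT.
  have : \forall x \near f a, ~ small_ball i x.
    by apply: open_nbhs_nbhs; split => //; apply: closed_openC; exact: closed_small_ball.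
  move=> N; have N' : \forall a' \near a, ~ small_ball i (f a') := @fc a _ N.
  by apply: filterS N' => a' /= h1 h2; have := h1 h2.
by apply: filterS => a' h1 y' h2 i /h1; exact: h2.
Qed.

(** theta_open along f: near a0, every tangent vector at f a close to theta (f
    a0) y0 is theta (f a) y for some y close to y0. *)
Lemma solve_local a0 y0 (W : set M) : admissible a0 y0 -> nbhs y0 W ->
  exists2 e : R, 0 < e & \forall a \near a0, forall w : forall i, E (kap i), fib (f a) w ->
    (forall i, nm (w i - theta (f a0) y0 i) < e) ->
    exists y, [/\ W y, admissible a y & forall i, theta (f a) y i = w i].
Proof.
move=> had nW; have [W' nW' hW'] := near_admissible had.
have [i [h1 h2]] := admissible_ball had.
have [e e0 he] := theta_open (tube_good i) h1 h2 (filterI nW nW').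
exists e => //.
have N : \forall a \near a0, forall w, fib (f a) w ->
    nm (w (tchart i) - theta (f a0) y0 (tchart i)) < e ->
    exists y, [/\ (W `&` W') y, large_ball i y & forall l, theta (f a) y l = w l].
  exact: (@fc a0 _ he).
apply: filterS (filterI N hW') => a [n1 n2] w hw hwe.
have [y [[y1 y2] y3 y4]] := n1 w hw (hwe _).
by exists y; split => //; exact: n2.
Qed.

(** One index for every scalar coordinate of the family theta, so that
    sections along f are scalar functions on a product. *)
Definition fibre_index : finType := {i : bidx B & 'I_(dim (kap i))}.
Definition block (s : A * fibre_index -> C) a (i : bidx B) : E (kap i) :=
  \row_c s (a, Tagged (fun i => 'I_(dim (kap i))) c).

Definition is_section (s : A * fibre_index -> C) :=
  (forall sigma, continuous (fun a => s (a, sigma) : C^o)) /\ forall a, fib (f a) (block s a).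

Definition raw_coord (g : A -> M) (p : A * fibre_index) : C :=
  theta (f p.1) (g p.1) (tag p.2) ord0 (tagged p.2).

Lemma block_raw g a i : block (raw_coord g) a i = theta (f a) (g a) i.
Proof. by apply/rowP => c; rewrite mxE. Qed.

Lemma theta_along_cvg g a (i : bidx B) : continuous g -> admissible a (g a) ->
  theta (f a') (g a') i @[a' --> a] --> theta (f a) (g a) i.
Proof.
move=> gc had.
have H := @theta_cvg R M B (f a) (g a) i (bsum_tube a) (admissible_covered had).
have fg : (f a', g a') @[a' --> a] --> (f a, g a) by apply: cvg_pair; [exact: fc|exact: gc].
exact: (cvg_comp _ _ fg H).
Qed.

Lemma raw_coord_section g : continuous g -> (forall a, admissible a (g a)) -> is_section (raw_coord g).
Proof.
move=> gc had; split; last first.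
  move=> a i j; rewrite !block_raw; exact: theta_fib.
move=> [i c] a /=; apply/cvgR => e e0.
have /cvgR/(_ e e0) := @theta_along_cvg g a i gc (had a).
apply: filterS => a'; apply: le_lt_trans.
have := cabs_coord (theta (f a') (g a') i - theta (f a) (g a) i) c.
by rewrite mxE [X in _ + X]mxE.
Qed.

Lemma block_cvg s a i : is_section s -> block s a' i @[a' --> a] --> block s a i.
Proof.
move=> [sc _]; apply/cvgR => e e0; have e20 : 0 < e / 2 by rewrite divr_gt0.
have N : \forall a' \near a, forall c : 'I_(dim (kap i)), nm (s (a', Tagged (fun i => 'I_(dim (kap i))) c) - s (a, Tagged (fun i => 'I_(dim (kap i))) c) : C^o) < e / 2.
  apply: filter_forall => c; move/cvgR: (sc (Tagged (fun i => 'I_(dim (kap i))) c) a) => H; exact: H _ e20.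
apply: filterS N => a' h; apply: (@le_lt_trans _ _ (e / 2)); last by rewrite ltr_pdivrMr// ltr_pMr// ltr1n.
by apply: nm_rV_le => [|c]; [exact: ltW|rewrite !mxE; exact: ltW (h c)].
Qed.

Lemma block_linear (b : C) s s' a i :
  block (fun p => b * s p + s' p) a i = b *: block s a i + block s' a i.
Proof. by apply/rowP => c; rewrite !mxE. Qed.

Lemma fib_linear x (b : C) (w w' : forall i : bidx B, E (kap i)) : fib x w -> fib x w' ->
  fib x (fun i => b *: w i + w' i).
Proof.
move=> h h' i j.
have sC (p q : C) (v : E (kap i)) : p *: (q *: v) = q *: (p *: v) by rewrite !scalerA mulrC.
have -> : transition (kap j) (kap i) x (b *: w j + w' j) = b *: transition (kap j) (kap i) x (w j) + transition (kap j) (kap i) x (w' j).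
  exact: linearP.
rewrite [LHS]scalerDr [RHS]scalerDr [in LHS]sC [in RHS]sC.
by congr (_ *: _ + _); [exact: h|exact: h'].
Qed.

Lemma block_dist s s' a i (e : R) : 0 <= e -> (forall p, cabs (s p - s' p) <= e) ->
  nm (block s a i - block s' a i) <= e.
Proof. by move=> e0 H; apply: nm_rV_le => // c; rewrite !mxE. Qed.

Hypothesis cptA : compact (@setT A).

Lemma section_bounded s : is_section s -> exists K : R, forall p, cabs (s p) <= K.
Proof.
move=> [sc _].
have /choice[K hK] : forall sigma, exists K : R, 0 <= K /\ forall a, cabs (s (a, sigma)) <= K.
  move=> sigma.
  have [|I [p [_ hp]]] := @finite_subcover A setT (fun a0 => [set a | nm (s (a, sigma) - s (a0, sigma) : C^o) < 1]) cptA.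
    by move=> a _; have := sc sigma a => /cvgR; apply.
  exists (\sum_i (cabs (s (p i, sigma)) + 1)); split.
    by apply: sumr_ge0 => i _; rewrite addr_ge0 ?cabs_ge0.
  move=> a; have [i /= hi] := hp a Logic.I.
  apply: (@le_trans _ _ (cabs (s (p i, sigma)) + 1)).
    have -> : s (a, sigma) = s (p i, sigma) + (s (a, sigma) - s (p i, sigma)) by ring.
    by apply: le_trans (cabsD _ _) _; rewrite lerD2l; exact: ltW.
  rewrite (bigD1 i)//= lerDl; apply: sumr_ge0 => j _; rewrite addr_ge0 ?cabs_ge0//.
exists (\sum_sigma K sigma) => -[a sigma].
apply: le_trans ((hK sigma).2 a) _; rewrite (bigD1 sigma)//= lerDl.
by apply: sumr_ge0 => j _; exact: (hK j).1.
Qed.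

Lemma section_zero : is_section (fun=> 0).
Proof.
split=> [sigma|a i j]; first by move=> a; exact: cvg_cst.
have z l : block (fun=> 0) a l = 0 by apply/rowP => c; rewrite !mxE.
by rewrite !z transition0 !scaler0.
Qed.

Lemma section_linear (b : C) s s' : is_section s -> is_section s' ->
  is_section (fun p => b * s p + s' p).
Proof.
move=> [h1 h2] [h1' h2']; split=> [sigma a|a].
  by apply: (@cvgD _ C^o); [apply: (@cvgM C); [exact: cvg_cst|exact: h1]|exact: h1'].
have := fib_linear b (h2 a) (h2' a).
by move=> H i j; rewrite !block_linear.
Qed.

(** The components are uniform limits of continuous functions. In the
    equations of fib both sides are bounded operators on the components, so
    that they pass to the limit. *)
Lemma section_closed s : (forall e : R, 0 < e ->
  exists2 g, is_section g & forall p, cabs (s p - g p) <= e) -> is_section s.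
Proof.
move=> H; split=> [sigma a|a i j].
  apply/cvgR => e e0; have e40 : 0 < e / 4 by rewrite divr_gt0.
  have [g [gc _] hg] := H _ e40.
  have /cvgR/(_ _ e40) := gc sigma a.
  apply: filterS => a' h.
  have -> : (s (a', sigma) : C^o) - s (a, sigma) = (s (a', sigma) - g (a', sigma)) + ((g (a', sigma) - g (a, sigma)) - (s (a, sigma) - g (a, sigma))) by ring.
  apply: nm_ltD; have h1 := hg (a', sigma); have h2 := hg (a, sigma).
  have h3 := @nmD _ C^o (g (a', sigma) - g (a, sigma)) (- (s (a, sigma) - g (a, sigma))).
  rewrite nmN in h3; move: h1 h2 h3 h; rewrite !nm_cabs; lra.
have [K K0 hK] := @lin_rV_bd R (E (kap i)) _ ('d (coord (kap i) \o param (kap j) : E (kap j) -> E (kap i)) (coord (kap j) (f a))).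
apply/eqP; rewrite -subr_eq0; apply/eqP; apply: (@nm_eq0 _ (E (kap i))).
apply/eqP; rewrite eq_le nm_ge0 andbT; apply/ler_addgt0Pr => e e0; rewrite add0r.
(* the defect of the equation at s is at most L times the distance from s to
   a section *)
pose L := beta j (f a) + beta i (f a) * K.
have L0 : 0 <= L by rewrite addr_ge0 ?mulr_ge0 ?beta_ge0.
have e10 : 0 < e / (L + 1) by rewrite divr_gt0// ltr_wpDl.
have [g [_ gf] hg] := H _ e10.
have bd l := block_dist a l (ltW e10) hg.
have -> : (beta j (f a))%:C *: block s a i - (beta i (f a))%:C *: transition (kap j) (kap i) (f a) (block s a j)
  = (beta j (f a))%:C *: (block s a i - block g a i) - (beta i (f a))%:C *: transition (kap j) (kap i) (f a) (block s a j - block g a j).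
  by rewrite transitionB !scalerBr gf opprB [RHS]addrA subrK.
apply: le_trans (@nmD _ (E (kap i)) _ _) _; rewrite nmN !nmZ !cabsR !ger0_norm ?beta_ge0//.
apply: (@le_trans _ _ (L * (e / (L + 1)))); last first.
  rewrite mulrCA; rewrite ler_piMr ?(ltW e0)// ler_pdivrMr ?ltr_wpDl// mul1r; lra.
rewrite /L mulrDl; apply: lerD; first by apply: ler_wpM2l; [exact: beta_ge0|exact: bd].
rewrite -mulrA; apply: ler_wpM2l; first exact: beta_ge0.
apply: le_trans (hK _) _; apply: ler_wpM2l => //; exact: bd.
Qed.

Definition section_space : fspace R (A * fibre_index) :=
  FSpace section_bounded section_zero section_linear section_closed.

End Tube.

(** * The chart of the mapping space at a map *)

(** M is regular, since points have compact neighbourhoods from the charts. *)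
Lemma closed_nbhs {R : realType} (M : complex_manifold R) (x : M) (P : set M) : nbhs x P ->
  exists Q : set M, [/\ closed Q, nbhs x Q & Q `<=` P].
Proof.
move=> nP; have [k hk] := @dom_cover R M (chart M) _ (atlas M) x.
have [r [r0 hr]] := exists_in_chart hk; have [d d0 hd] := near_chart_ball hk nP.
pose e := Num.min r (d / 2).
have e0 : 0 < e by rewrite lt_min r0 divr_gt0.
have er : e <= r by rewrite ge_min lexx.
have ed : e < d by apply: le_lt_trans (_ : e <= d / 2) _; [rewrite ge_min lexx orbT|lra].
exists (chart_cball (Defs.coord (atlas M) k x : 'rV[R[i]]_(Defs.dim k)) e); split.
- by apply: closed_chart_cball; split => // v hv; apply: hr; exact: le_trans er.
- have : nbhs x (chart_ball (Defs.coord (atlas M) k x : 'rV[R[i]]_(Defs.dim k)) e).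
    apply: open_nbhs_nbhs; split; first exact: open_chart_ball.
    by split => //; rewrite subrr nm0.
  by apply: filterS => y [h1 h2]; split => //; exact: ltW.
- by move=> y [h1 h2]; apply: hd; split => //; exact: le_lt_trans ed.
Qed.

Section MapsTo.
Context {A M : topologicalType}.

Definition mapfun (g : mapping_space A M) : A -> M := (g : continuousType A M).

Lemma mapfun_continuous (g : mapping_space A M) : continuous (mapfun g).
Proof. exact: (@cts_fun _ _ (g : continuousType A M)). Qed.

Lemma mapfun_inj (g h : mapping_space A M) : mapfun g =1 mapfun h -> g = h.
Proof. by move=> e; exact: (continuousEP (g : continuousType A M) (h : continuousType A M)).2. Qed.

Definition to_mapping (g : A -> M) (gc : continuous g) : mapping_space A M :=
  (HB.pack g (isContinuous.Build A M g gc) : continuousType A M).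

Lemma near_maps_to (g : mapping_space A M) (K : set A) (U : set M) :
  compact K -> open U -> mapfun g @` K `<=` U ->
  \forall h \near g, mapfun h @` K `<=` U.
Proof.
move=> cK oU gKU.
have O : open ([set h | h @` K `<=` U] : set {compact-open, A -> M}) by exact: compact_open_open.
have N : nbhs (mapfun g : {compact-open, A -> M}) [set h | h @` K `<=` U].
  exact: open_nbhs_nbhs.
exact: (@initial_continuous _ _ (fun f : continuousType A M => f : {compact-open, A -> M}) g _ N).
Qed.

Lemma mapping_space_cvg {T : Type} {F : set_system T} {FF : Filter F} (h : T -> mapping_space A M)
    (g : mapping_space A M) :
  (forall K U, compact K -> open U -> mapfun g @` K `<=` U ->
     F [set t | mapfun (h t) @` K `<=` U]) ->
  h t @[t --> F] --> g.
Proof.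
move=> H.
have Hc : ((fun t => (mapfun (h t) : {compact-open, A -> M})) @ F) --> (mapfun g : {compact-open, A -> M}).
  apply/compact_open_cvgP => K U cK oU gKU; exact: H.
move=> P; rewrite nbhsE => -[_ [[Q oQ <-] Qg] QP].
have N : nbhs (mapfun g : {compact-open, A -> M}) Q by apply: open_nbhs_nbhs.
have N' : F [set t | Q (mapfun (h t))] := Hc _ N.
suff : F [set t | P (h t)] by [].
by apply: filterS N' => t ht; exact: (QP (h t) ht).
Qed.

Lemma near_eval (g : mapping_space A M) a (P : set M) : nbhs (mapfun g a) P -> \forall h \near g, P (mapfun h a).
Proof.
move=> nP; have : \forall h \near g, mapfun h @` [set a] `<=` P°.
  apply: near_maps_to; [exact: compact_set1|exact: open_interior|].
  by move=> _ [b -> <-].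
by apply: filterS => h H; apply: interior_subset; apply: H; exists a.
Qed.

Lemma mapping_space_hausdorff : hausdorff_space M -> hausdorff_space (mapping_space A M).
Proof.
move=> hM g h gh; apply: mapfun_inj => a; apply: hM => U V nU nV.
have [k [k1 k2]] := gh _ _ (near_eval nU) (near_eval nV).
by exists (mapfun k a).
Qed.

End MapsTo.

Section ChartAt.
Context {R : realType} {M : complex_manifold R} {A : topologicalType}.
Hypothesis cptA : compact (@setT A).
Variables (f : mapping_space A M) (T : tube (mapfun f)).
Local Notation C := R[i].
Local Notation B := (tbumps T).
Local Notation MS := (mapping_space A M).
Local Notation fc := (@mapfun_continuous A M f).
Local Notation Sec := (section_space T cptA).
Implicit Types (g h : MS) (a : A) (y : M).

Definition tube_dom : set MS := [set g | forall a, admissible T a (mapfun g a)].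

(** Outside tube_dom the raw coordinates need not form a section; the value 0
    there is arbitrary. *)
Definition tube_coord g : fvec Sec :=
  match pselect (is_section (@raw_coord R M A (mapfun f) T (mapfun g))) with
  | left P => FVec (P : fs_mem Sec (@raw_coord R M A (mapfun f) T (mapfun g)))
  | right _ => 0
  end.

Lemma tube_coordE g : tube_dom g -> forall p, tube_coord g p = @raw_coord R M A (mapfun f) T (mapfun g) p.
Proof.
move=> hg p; rewrite /tube_coord; case: pselect => // -[].
by apply: raw_coord_section => //; exact: mapfun_continuous.
Qed.

Lemma block_tube_coord g a i : tube_dom g -> block (tube_coord g) a i = theta (mapfun f a) (mapfun g a) i.
Proof.
by move=> hg; rewrite -block_raw; apply/rowP => c; rewrite !mxE tube_coordE.
Qed.

Lemma tube_coord_inj g h : tube_dom g -> tube_dom h -> tube_coord g = tube_coord h -> g = h.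
Proof.
move=> hg hh e; apply: mapfun_inj => a; apply: (admissible_inj (hg a) (hh a)) => i.
by rewrite -(block_tube_coord a i hg) -(block_tube_coord a i hh) e.
Qed.

Lemma block_nm (w w' : fvec Sec) a i : nm (block w a i - block w' a i) <= nm (w - w').
Proof. by apply: block_dist; [exact: nm_ge0|move=> p; rewrite -fvalB; exact: cabs_fval]. Qed.

(** The preimage under f of a small ball is closed in the compact space A,
    hence compact, and the compact-open topology controls the values of g on
    it. *)
Lemma open_tube_dom : open tube_dom.
Proof.
rewrite openE => g hg.
have Hi (i : tidx T) : nbhs g [set h | mapfun h @` (mapfun f @^-1` small_ball i) `<=` large_ball i].
  apply: near_maps_to.
  - apply: (@subclosed_compact _ _ setT) => //.
    by apply: preimage_closed; [move=> t _; exact: fc|exact: (@closed_small_ball R M A _ T i)].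
  - exact: open_large_ball.
  - by move=> _ [a ha <-]; exact: hg.
have N : nbhs g [set h | forall i : tidx T, mapfun h @` (mapfun f @^-1` small_ball i) `<=` large_ball i].
  exact: (@filter_forall MS (tidx T) _ (nbhs g) _ Hi).
by apply: filterS N => h hh a i hi; apply: (hh i); exists a.
Qed.

(** By joint continuity theta stays within e of its values along g on a
    product of L and U; L is closed, hence compact, as the compact-open
    topology requires. *)
Lemma near_theta g a0 (e : R) : tube_dom g -> 0 < e ->
  exists L U, [/\ closed L, nbhs a0 L, open U, mapfun g @` L `<=` U &
    forall a y, L a -> U y -> forall i : bidx B, nm (theta (mapfun f a) y i - theta (mapfun f a) (mapfun g a) i) < e].
Proof.
move=> hg e0; have e20 : 0 < e / 2 by rewrite divr_gt0.
have Hi (i : bidx B) : nbhs (mapfun f a0, mapfun g a0)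
    [set p | nm (theta p.1 p.2 i - theta (mapfun f a0) (mapfun g a0) i) < e / 2].
  have /cvgR H := @theta_cvg R M B (mapfun f a0) (mapfun g a0) i (bsum_tube T a0) (admissible_covered (hg a0)).
  exact: H _ e20.
have := @filter_forall (M * M) (bidx B) _ (nbhs (mapfun f a0, mapfun g a0)) _ Hi.
move=> [[P1 P2] /= [n1 n2] hP].
have [Q1 [c1 m1 s1]] := closed_nbhs n1.
have n2' : nbhs (mapfun g a0) P2° by exact: nbhs_interior.
have [Q2 [c2 m2 s2]] := closed_nbhs n2'.
exists (mapfun f @^-1` Q1 `&` mapfun g @^-1` Q2), P2°; split.
- by apply: closedI; (apply: preimage_closed; [move=> t _; exact: mapfun_continuous|by []]).
- by apply: filterI; [exact: (@mapfun_continuous _ _ f a0 _ m1)|exact: (@mapfun_continuous _ _ g a0 _ m2)].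
- exact: open_interior.
- by move=> _ [a [_ h] <-]; exact: s2.
- move=> a y [h1 h2] h3 i.
  have k1 := hP (mapfun f a, y) (conj (s1 _ h1) (interior_subset h3)) i.
  have k2 := hP (mapfun f a, mapfun g a) (conj (s1 _ h1) (interior_subset (s2 _ h2))) i.
  have -> : theta (mapfun f a) y i - theta (mapfun f a) (mapfun g a) i
    = (theta (mapfun f a) y i - theta (mapfun f a0) (mapfun g a0) i)
      - (theta (mapfun f a) (mapfun g a) i - theta (mapfun f a0) (mapfun g a0) i) by rewrite opprB subrKA.
  apply: nm_ltD; rewrite nmN [ltRHS]splitr; apply: ltrD; [exact: k1|exact: k2].
Qed.

Lemma tube_coord_cvg g : tube_dom g -> tube_coord h @[h --> g] --> tube_coord g.
Proof.
move=> hg; apply: (@cvgR R MS (nbhs g) (nbhs_filter g) _ _ _).2 => e e0; have e20 : 0 < e / 2 by rewrite divr_gt0.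
have /choice[LU hLU] : forall a0, exists LU : set A * set M, [/\ closed LU.1, nbhs a0 LU.1, open LU.2, mapfun g @` LU.1 `<=` LU.2 &
    forall a y, LU.1 a -> LU.2 y -> forall i : bidx B, nm (theta (mapfun f a) y i - theta (mapfun f a) (mapfun g a) i) < e / 2].
  by move=> a0; have [L [U H]] := near_theta a0 hg e20; exists (L, U).
have [|I [p [_ hp]]] := @finite_subcover A setT (fun a => (LU a).1) cptA.
  by move=> a _; have [] := hLU a.
have Hi i : nbhs g [set h | mapfun h @` (LU (p i)).1 `<=` (LU (p i)).2].
  have [h1 h2 h3 h4 _] := hLU (p i).
  by apply: near_maps_to => //; apply: (subclosed_compact h1 cptA).
have N1 : nbhs g [set h | forall i, mapfun h @` (LU (p i)).1 `<=` (LU (p i)).2].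
  exact: (@filter_forall MS I _ (nbhs g) _ Hi).
have N2 : \forall h \near g, tube_dom h by apply: open_nbhs_nbhs; split => //; exact: open_tube_dom.
apply: filterS (filterI N1 N2) => h [h1 h2].
apply: (@le_lt_trans _ _ (e / 2)); last by rewrite ltr_pdivrMr// ltr_pMr// ltr1n.
apply: nm_fvec_le => [|[a [i c]]]; first exact: ltW.
have [j hj] := hp a Logic.I; have [_ _ _ _ H] := hLU (p j).
have ha : (LU (p j)).2 (mapfun h a) by apply: (h1 j); exists a.
have hn := ltW (H a _ hj ha i); apply: le_trans hn.
have := cabs_coord (theta (mapfun f a) (mapfun h a) i - theta (mapfun f a) (mapfun g a) i) c.
rewrite mxE [X in _ + X]mxE; apply: le_trans.
have eh : tube_coord h (a, existT _ i c) = theta (mapfun f a) (mapfun h a) i ord0 c := tube_coordE h2 _.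
have eg : tube_coord g (a, existT _ i c) = theta (mapfun f a) (mapfun g a) i ord0 c := tube_coordE hg _.
have ed := etrans (fvalB (tube_coord h) (tube_coord g) (a, existT _ i c)) (congr2 (fun u v => u - v) eh eg).
have -> := congr1 cabs ed; exact: lexx.
Qed.

End ChartAt.

(** * The image and the inverse of the chart *)

Section Realisation.
Context {R : realType} {M : complex_manifold R} {A : topologicalType}.
Variable (cptA : compact (@setT A)).
Variables (f : mapping_space A M) (T : tube (mapfun f)).
Local Notation C := R[i].
Local Notation dim := (@Defs.dim R M).
Local Notation dom := (Defs.dom (atlas M)).
Local Notation coord := (Defs.coord (atlas M)).
Local Notation E k := ('rV[C]_(dim k) : normedModType C).
Local Notation B := (tbumps T).
Local Notation kap := (bchart (b := tbumps T)).
Local Notation MS := (mapping_space A M).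
Local Notation fc := (@mapfun_continuous A M f).
Local Notation Sec := (section_space T cptA).
Local Notation tube_dom := (tube_dom T).
Local Notation tube_coord := (tube_coord cptA T).
Implicit Types (g h : MS) (a : A) (y : M) (w : fvec Sec).

Definition solves w a y := admissible T a y /\ forall i, theta (mapfun f a) y i = block w a i.

Lemma solves_inj w a y y' : solves w a y -> solves w a y' -> y = y'.
Proof.
by move=> [h e] [h' e']; apply: (admissible_inj h h') => i; rewrite e e'.
Qed.

Lemma solves_tube_coord g a : tube_dom g -> solves (tube_coord g) a (mapfun g a).
Proof. by move=> hg; split; [exact: hg|move=> i; rewrite block_tube_coord]. Qed.

(** solve_local at each point of K, with one tolerance for all points by
    compactness. *)
Lemma solve_uniform g (K : set A) (U : set M) : tube_dom g -> compact K -> open U ->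
  mapfun g @` K `<=` U ->
  exists2 e : R, 0 < e & forall w, nm (w - tube_coord g) < e ->
    forall a, K a -> exists2 y, U y & solves w a y.
Proof.
move=> hg cK oU gKU.
have /choice[eP heP] : forall a0 : A, exists eP : R * set A, K a0 ->
    [/\ 0 < eP.1, nbhs a0 eP.2 & forall w, nm (w - tube_coord g) < eP.1 ->
      forall a, eP.2 a -> exists2 y, U y & solves w a y].
  move=> a0; have [Ka|nK] := pselect (K a0); last by exists (1, setT) => /nK.
  have nU : nbhs (mapfun g a0) U by apply: open_nbhs_nbhs; split => //; apply: gKU; exists a0.
  have [e e0 N] := solve_local fc (hg a0) nU.
  have e20 : 0 < e / 2 by rewrite divr_gt0.
  have Hi (i : bidx B) : nbhs a0 [set a | nm (theta (mapfun f a) (mapfun g a) i - theta (mapfun f a0) (mapfun g a0) i) < e / 2].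
    have /cvgR H := @theta_along_cvg R M A (mapfun f) T fc (mapfun g) a0 i (@mapfun_continuous A M g) (hg a0).
    exact: H _ e20.
  have N' : nbhs a0 [set a | forall i : bidx B, nm (theta (mapfun f a) (mapfun g a) i - theta (mapfun f a0) (mapfun g a0) i) < e / 2].
    exact: (@filter_forall A (bidx B) _ (nbhs a0) _ Hi).
  exists (e / 2, [set a | forall w, nm (w - tube_coord g) < e / 2 -> exists2 y, U y & solves w a y]) => _.
  split; [exact: e20| |by move=> w hw a; apply].
  rewrite /=; apply: filterS (filterI N N') => a [h1 h2] w hw.
  have [|y [y1 y2 y3]] := h1 (block w a) ((fvalP w).2 a); last by exists y.
  move=> i.
  have -> : block w a i - theta (mapfun f a0) (mapfun g a0) i
    = (block w a i - block (tube_coord g) a i) + (theta (mapfun f a) (mapfun g a) i - theta (mapfun f a0) (mapfun g a0) i).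
    by rewrite block_tube_coord// addrA subrK.
  apply: nm_ltD; rewrite [ltRHS]splitr; apply: ltrD; last exact: h2.
  by apply: le_lt_trans (block_nm w (tube_coord g) a i) _; exact: hw.
have [|I [p [pK hp]]] := @finite_subcover A K (fun a => (eP a).2) cK.
  by move=> a Ka; have [] := heP a Ka.
have [||e e0 he] := finite_radius (S := fun i e => e <= (eP (p i)).1).
- by move=> i d d' h1 h2; exact: le_trans h2.
- by move=> i; exists (eP (p i)).1 => //; have [] := heP _ (pK i).
exists e => // w hw a Ka; have [i hi] := hp a Ka; have [_ _ H] := heP _ (pK i).
by apply: H hi; exact: lt_le_trans (he i).
Qed.

(** solve_local provides a solution close to g a at every point near a; by
    solves_inj it is the value of g there. *)
Lemma solution_continuous w (g : A -> M) : (forall a, solves w a (g a)) -> continuous g.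
Proof.
move=> H a W nW; have [had _] := H a.
have [e e0 N] := solve_local fc had nW.
have Hi (i : bidx B) : nbhs a [set a' | nm (block w a' i - block w a i) < e].
  have /cvgR Q := @block_cvg R M A (mapfun f) T w a i (fvalP w).
  exact: Q _ e0.
have N' : nbhs a [set a' | forall i : bidx B, nm (block w a' i - block w a i) < e].
  exact: (@filter_forall A (bidx B) _ (nbhs a) _ Hi).
suff : \forall a' \near a, W (g a') by [].
apply: filterS (filterI N N') => a' [h1 h2].
have [|y [y1 y2 y3]] := h1 (block w a') ((fvalP w).2 a').
  by move=> i; rewrite (H a).2; exact: h2.
by rewrite (solves_inj (H a') (conj y2 y3)).
Qed.

Lemma realise w (g : A -> M) : (forall a, solves w a (g a)) ->
  exists h, [/\ tube_dom h, tube_coord h = w & mapfun h = g].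
Proof.
move=> H; pose h := to_mapping (solution_continuous H).
have hh : tube_dom h by move=> a; exact: (H a).1.
exists h; split => //; apply: fvec_ext => -[a [i c]].
rewrite tube_coordE// /raw_coord /=; rewrite [theta _ _ _](H a).2 mxE.
by [].
Qed.

Lemma open_tube_image : open (tube_coord @` tube_dom).
Proof.
rewrite openE => _ [g hg <-].
have [|e e0 he] := @solve_uniform g setT setT hg cptA openT; first by [].
apply/nbhsR; exists e => // w hw.
have /choice[y hy] : forall a, exists y, solves w a y.
  by move=> a; have [y _ hy] := he w hw a Logic.I; exists y.
by have [h [h1 h2 _]] := realise hy; exists h.
Qed.

Definition tube_param w : MS := xget f [set g | tube_dom g /\ tube_coord g = w].

Lemma tube_paramP w : (tube_coord @` tube_dom) w ->
  tube_dom (tube_param w) /\ tube_coord (tube_param w) = w.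
Proof. by move=> [g hg e]; exact: (@xgetI _ f [set g | tube_dom g /\ tube_coord g = w] g (conj hg e)). Qed.

Lemma tube_paramK g : tube_dom g -> tube_param (tube_coord g) = g.
Proof.
move=> hg; have [|h e] := @tube_paramP (tube_coord g); first by exists g.
exact: tube_coord_inj e.
Qed.

Lemma solves_tube_param w a : (tube_coord @` tube_dom) w -> solves w a (mapfun (tube_param w) a).
Proof. by move=> /tube_paramP[h {1}<-]; exact: solves_tube_coord. Qed.

Lemma near_tube_image g : tube_dom g -> \forall w \near tube_coord g, (tube_coord @` tube_dom) w.
Proof. by move=> hg; apply: open_nbhs_nbhs; split; [exact: open_tube_image|exists g]. Qed.

Lemma tube_param_cvg g : tube_dom g -> tube_param w @[w --> tube_coord g] --> g.
Proof.
move=> hg; apply: (@mapping_space_cvg A M (fvec Sec) (nbhs (tube_coord g)) (nbhs_filter _)) => K U cK oU gKU.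
have [e e0 he] := solve_uniform hg cK oU gKU.
have N : \forall w \near tube_coord g, nm (w - tube_coord g) < e by apply/nbhsR; exists e.
apply: filterS (filterI N (near_tube_image hg)) => w [h1 h2] _ [a Ka <-].
have [y Uy hy] := he w h1 a Ka.
by rewrite (solves_inj (solves_tube_param a h2) hy).
Qed.

(** Evaluation at a, read in a chart of M, depends holomorphically on the
    section: the section enters through the bounded linear map that takes its
    value at a, and inverse_theta_diff does the rest. *)
Lemma eval_param_diff g a : tube_dom g -> exists k : chart M,
  dom k (mapfun g a) /\
  differentiable (fun w => coord k (mapfun (tube_param w) a) : E k) (tube_coord g).
Proof.
move=> hg; have [i [h1 h2]] := admissible_ball (hg a).
exists (kap (tchart i)); split; first by case: h2.
have wlin : linear (fun w => block w a (tchart i) : E (kap (tchart i))).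
  by move=> b w w'; rewrite -block_linear.
pose wj : {linear fvec Sec -> E (kap (tchart i))} :=
  HB.pack (fun w => block w a (tchart i) : E (kap (tchart i))) (GRing.isLinear.Build _ _ _ _ (fun w => block w a (tchart i) : E (kap (tchart i))) wlin).
have gc : mapfun (tube_param w) a @[w --> tube_coord g] --> mapfun (tube_param (tube_coord g)) a.
  rewrite tube_paramK// => P nP; exact: (tube_param_cvg hg (near_eval nP)).
apply: (@inverse_theta_diff R M B _ _ _ (tube_good i) (fvec Sec) (fun w => mapfun (tube_param w) a) (mapfun f a) (tube_coord g) wj 1).
- exact: h1.
- by rewrite tube_paramK.
- move=> w; rewrite mul1r; apply: nm_rV_le; first exact: nm_ge0.
  by move=> c; rewrite /wj /= mxE; exact: cabs_fval.
- exact: gc.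
- by apply: filterS (near_tube_image hg) => w /(solves_tube_param a)[_ ->].
Qed.

End Realisation.

(** * The atlas of the mapping space *)

Section Transition.
Context {R : realType} {M : complex_manifold R} {A : topologicalType}.
Variable (cptA : compact (@setT A)).
Variables (f1 f2 : mapping_space A M) (T1 : tube (mapfun f1)) (T2 : tube (mapfun f2)).
Local Notation C := R[i].
Local Notation dim := (@Defs.dim R M).
Local Notation dom := (Defs.dom (atlas M)).
Local Notation coord := (Defs.coord (atlas M)).
Local Notation param := (Defs.param (atlas M)).
Local Notation E k := ('rV[C]_(dim k) : normedModType C).
Local Notation Sec1 := (section_space T1 cptA).
Local Notation Sec2 := (section_space T2 cptA).
Implicit Types (g h : mapping_space A M) (a : A).

Definition chart_change (w : fvec Sec1) : fvec Sec2 := tube_coord cptA T2 (tube_param w).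

Lemma chart_change_cvg g : tube_dom T1 g -> tube_dom T2 g ->
  chart_change w @[w --> tube_coord cptA T1 g] --> chart_change (tube_coord cptA T1 g).
Proof.
move=> h1 h2; rewrite {2}/chart_change tube_paramK// => P nP.
have Q : \forall h \near g, P (tube_coord cptA T2 h) by exact: (tube_coord_cvg h2 nP).
have Q' : \forall w \near tube_coord cptA T1 g, P (tube_coord cptA T2 (tube_param w)) by exact: (tube_param_cvg cptA h1 Q).
exact: Q'.
Qed.

Lemma near_chart_change_dom g : tube_dom T1 g -> tube_dom T2 g ->
  \forall w \near tube_coord cptA T1 g, tube_dom T2 (tube_param w).
Proof.
move=> h1 h2; apply: (tube_param_cvg cptA h1).
by apply: open_nbhs_nbhs; split => //; exact: open_tube_dom.
Qed.

(** At a fixed a only finite-dimensional maps are involved: evaluation of the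
    inverse chart, then theta at the fixed base point f2 a. *)
Lemma chart_change_eval_diff g (p : A * fibre_index T2) : tube_dom T1 g -> tube_dom T2 g ->
  differentiable (fun w => chart_change w p : C^o) (tube_coord cptA T1 g).
Proof.
case: p => a [i c] h1 h2; have [k [hk D]] := eval_param_diff cptA a h1.
have TD := theta_diff i hk (admissible_covered (h2 a)).
have ev : (coord k (mapfun (tube_param (tube_coord cptA T1 g)) a) : E k) = coord k (mapfun g a).
  by rewrite tube_paramK.
have Nd : \forall w \near tube_coord cptA T1 g, dom k (mapfun (tube_param w) a).
  exact: (tube_param_cvg cptA h1 (near_eval (near_dom hk))).
have Nt : \forall w \near tube_coord cptA T1 g,
    theta (mapfun f2 a) (param k (coord k (mapfun (tube_param w) a))) i = theta (mapfun f2 a) (mapfun (tube_param w) a) i.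
  by apply: filterS Nd => w hw; rewrite param_coord.
have [Dt _] := near_diff_comp ev Nt D TD.
have [Dc _] := diff_coord c Dt.
refine (near_diff _ Dc).1.
apply: filterS (near_chart_change_dom h1 h2) => w hw.
by rewrite /chart_change tube_coordE.
Qed.

(** Continuity gives a bound near the point, and differentiable_fvec reduces
    the claim to the evaluations. *)
Lemma chart_change_diff g : tube_dom T1 g -> tube_dom T2 g ->
  differentiable chart_change (tube_coord cptA T1 g).
Proof.
move=> h1 h2; have /cvgR H := chart_change_cvg h1 h2.
have N1 : \forall w \near tube_coord cptA T1 g, nm (chart_change w - chart_change (tube_coord cptA T1 g)) < 1 by exact: H _ ltr01.
have N : \forall w \near tube_coord cptA T1 g,
    [/\ nm (chart_change w - chart_change (tube_coord cptA T1 g)) < 1, tube_dom T2 (tube_param w)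
      & (tube_coord cptA T1 @` tube_dom T1) w].
  by apply: filterS (filterI (filterI N1 (near_chart_change_dom h1 h2)) (near_tube_image cptA h1)) => w [[]].
have /nbhsR[r r0 hr] := N.
apply: (@differentiable_fvec R _ _ _ chart_change _ r (nm (chart_change (tube_coord cptA T1 g)) + 1) r0).
  move=> w hw; have [q1 _ _] := hr w hw.
  rewrite -[chart_change w](subrK (chart_change (tube_coord cptA T1 g))) addrC.
  by apply: le_trans (nmD _ _) _; rewrite lerD2l; exact: ltW.
move=> w p hw; have [_ q2 q3] := hr w hw.
have [d1 e1] := tube_paramP q3.
rewrite -[X in differentiable _ X]e1; exact: chart_change_eval_diff.
Qed.

End Transition.

Section Atlas.
Context {R : realType} (M : complex_manifold R) (A : topologicalType).
Variable (cptA : compact (@setT A)).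
Local Notation C := R[i].
Local Notation MS := (mapping_space A M).

Lemma tube_at_exists (f : MS) : exists T : tube (mapfun f), True.
Proof. by have [T] := tube_exists cptA (@mapfun_continuous A M f); exists T. Qed.

Definition tube_at (f : MS) : tube (mapfun f) := sval (cid (tube_at_exists f)).

Definition model (f : MS) : completeNormedModType C := fvec (section_space (tube_at f) cptA).

(** The maps themselves serve as indices: f lies in the domain of its own
    chart. *)
Lemma mapping_atlas : inhabited (complex_atlas MS model).
Proof.
constructor.
apply: (@ComplexAtlas R MS MS model (fun f => tube_dom (tube_at f))
  (fun f => tube_coord cptA (tube_at f)) (fun f w => tube_param w)).
- by move=> f; exists f => a; exact: (@admissible_refl R M A (mapfun f) (tube_at f) a).
- by move=> f; exact: open_tube_dom.
- by move=> f; exact: open_tube_image.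
- by move=> f g; exact: tube_paramK.
- move=> f; rewrite continuous_open_subspace; last exact: open_tube_dom.
  by move=> g; rewrite inE => hg; exact: tube_coord_cvg.
- move=> f; rewrite continuous_open_subspace; last exact: open_tube_image.
  move=> w; rewrite inE => -[g hg <-].
  by rewrite /continuous_at tube_paramK//; exact: tube_param_cvg.
- by move=> f1 f2 _ [g [h1 h2] <-]; exact: chart_change_diff.
Qed.

End Atlas.

Theorem theorem5p2 (R : realType) (M : complex_manifold R)
    (nabla : holomorphic_connection M)
    (A : topologicalType) (cptA : compact (@setT A)) :
  is_complex_banach_manifold R (mapping_space A M).
Proof.
split; first by apply: mapping_space_hausdorff; exact: carrier_hausdorff.
by exists (mapping_space A M), (model (M := M) cptA); exact: mapping_atlas.
Qed.
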